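(* If $A$ is a $\mathbb C$-affine domain, then $\mathcal B(A)$ is absolutely integrally closed. In particular, if $A$ is local, then $\mathcal B(A)$ is Henselian.
   Context: A domain $S$ is called absolutely integrally closed if every monic polynomial (of positive degree) over $S$ has a root in $S$. A $\mathbb C$-affine algebra is a finitely generated $\mathbb C$-algebra or a localization of such an algebra at a prime ideal; in the latter case it is called local $\mathbb C$-affine. Fix a non-principal ultrafilter on the set of prime numbers; ''almost all $p$'' and ultraproducts $\operatorname{ulim}_p$ are with respect to it. Fix a field isomorphism $\mathbb C\cong\operatorname{ulim}_p\mathbb F_p^{\rm alg}$ ($\mathbb F_p^{\rm alg}$ the algebraic closure of $\mathbb F_p$). An approximation of $c\in\mathbb C$ is a sequence $c_p\in\mathbb F_p^{\rm alg}$ with $\operatorname{ulim}_p c_p=c$; an approximation of a polynomial $f\in\mathbb C[X]$ ($X$ a finite tuple of variables) is the sequence $f_p\in\mathbb F_p^{\rm alg}[X]$ obtained by approximating each coefficient; an approximation of an ideal is the sequence of ideals generated by approximations of a finite generating set. An approximation of $A=\mathbb C[X]/I$ (respectively of its localization at a prime ideal $\mathfrak p$) is the sequence $A_p=\mathbb F_p^{\rm alg}[X]/I_p$ (respectively its localization at $\mathfrak p_p$, which is prime for almost all $p$). It is unique up to isomorphism for almost all $p$; if $A$ is a domain, so are almost all $A_p$. The non-standard hull of $A$ is $A_\infty=\operatorname{ulim}_pA_p$, with natural map $A\to A_\infty$ sending an element to the ultraproduct of an approximation of it. For a domain $D$, $D^+$ is the integral closure of $D$ in an algebraic closure of its fraction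 field (and $D^+=0$ if $D$ is not a domain). For a $\mathbb C$-affine domain $A$, $\mathcal B(A):=\operatorname{ulim}_pA_p^+$, an $A$-algebra via $A\to A_\infty\to\mathcal B(A)$; it is unique up to $A$-algebra isomorphism.
   Formalization: B(A) need not be a local ring when A is local (e.g. A = C[x]_(x)), so ''Henselian'' is read as: at every maximal ideal M of B(A), simple roots mod M of monic polynomials lift to B(A), and the localization B(A)_M is a Henselian local ring. *)

(* Defs.v *)
From HB Require Import structures.
From mathcomp Require Import all_boot all_order all_algebra all_field.
From mathcomp Require Import boolp classical_sets filter reals complex.
From mathcomp Require Import ring.
From mathcomp Require Import mpoly.

Set Implicit Arguments.
Unset Strict Implicit.
Unset Printing Implicit Defensive.

Import GRing.Theory.

Local Open Scope classical_set_scope.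
Local Open Scope ring_scope.
Local Open Scope quotient_scope.

(* The zero ring occurs (D^+ is 0 when D is not a domain), hence the use of
   [comPzRingType] throughout. *)

Record ideal (R : comPzRingType) := Ideal {
  ideal_set :> set R;
  ideal0 : ideal_set 0;
  idealD : forall x y, ideal_set x -> ideal_set y -> ideal_set (x + y);
  idealM : forall a x, ideal_set x -> ideal_set (a * x) }.

Definition ideal_mem (R : comPzRingType) (I : ideal R) : R -> Prop :=
  ideal_set I.
Coercion ideal_mem : ideal >-> Funclass.

Section IdealTheory.
Context (R : comPzRingType) (I : ideal R).

Lemma idealN x : I x -> I (- x).
Proof. by rewrite -mulN1r; apply: idealM. Qed.

Lemma idealB x y : I x -> I y -> I (x - y).
Proof. by move=> Ix Iy; apply: idealD => //; apply: idealN. Qed.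

End IdealTheory.

Section SeqIdeal.
Context (R : comPzRingType) (s : seq R).

Local Definition span : set R :=
  [set x | exists c : nat -> R, x = \sum_(i < size s) c i * s`_i].

Local Lemma span0 : span 0.
Proof. by exists (fun=> 0); rewrite big1 // => i _; rewrite mul0r. Qed.

Local Lemma spanD x y : span x -> span y -> span (x + y).
Proof.
move=> [c ->] [d ->]; exists (fun i => c i + d i).
by rewrite -big_split /=; apply: eq_bigr => i _; rewrite mulrDl.
Qed.

Local Lemma spanM a x : span x -> span (a * x).
Proof.
move=> [c ->]; exists (fun i => a * c i).
by rewrite mulr_sumr; apply: eq_bigr => i _; rewrite mulrA.
Qed.

Definition seq_ideal : ideal R := Ideal span0 spanD spanM.

End SeqIdeal.

Section QuotientRing.
Context (R : comPzRingType) (I : ideal R).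

Local Definition qequiv (x y : R) : bool := `[< I (x - y) >].

Local Lemma qequiv_is_equiv : equiv_class_of qequiv.
Proof.
split=> [x|x y|y x z]; rewrite /qequiv.
- by rewrite subrr; apply/asboolP/ideal0.
- by apply: asbool_equiv_eq; split=> /idealN; rewrite opprB.
- move=> /asboolP xy /asboolP yz; apply/asboolP.
  by rewrite -(subrK y x) -addrA; apply: idealD.
Qed.

Local Definition qequiv_equiv := EquivRelPack qequiv_is_equiv.

Definition quot := {eq_quot qequiv_equiv}.

HB.instance Definition _ := Choice.on quot.

Definition to_quot (x : R) : quot := \pi_quot x.

Lemma to_quotP x y : to_quot x = to_quot y <-> I (x - y).
Proof.
split=> [/eqP|Ixy]; first by rewrite eqmodE => /asboolP.
by apply/eqP; rewrite eqmodE; apply/asboolP.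
Qed.

Lemma to_quot_surj (q : quot) : exists x, to_quot x = q.
Proof. by exists (repr q); rewrite /to_quot reprK. Qed.

Local Definition qrep (q : quot) : R := repr q.

Local Lemma qrepK q : to_quot (qrep q) = q.
Proof. by rewrite /to_quot reprK. Qed.

Local Lemma qrep_to x : I (qrep (to_quot x) - x).
Proof. by apply/to_quotP; rewrite qrepK. Qed.

Local Definition qadd p q := to_quot (qrep p + qrep q).
Local Definition qopp q := to_quot (- qrep q).
Local Definition qmul p q := to_quot (qrep p * qrep q).

Local Lemma qaddE x y : qadd (to_quot x) (to_quot y) = to_quot (x + y).
Proof.
apply/to_quotP; rewrite opprD addrACA.
by apply: idealD; apply: qrep_to.
Qed.

Local Lemma qoppE x : qopp (to_quot x) = to_quot (- x).
Proof. by apply/to_quotP; rewrite -opprD; apply/idealN/qrep_to. Qed.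

Local Lemma qmulE x y : qmul (to_quot x) (to_quot y) = to_quot (x * y).
Proof.
apply/to_quotP.
set x' := qrep _; set y' := qrep _.
have -> : x' * y' - x * y = y' * (x' - x) + x * (y' - y) by ring.
by apply: idealD; apply: idealM; apply: qrep_to.
Qed.

Local Lemma qaddA : associative qadd.
Proof.
by move=> p q r; rewrite -(qrepK p) -(qrepK q) -(qrepK r) !qaddE addrA.
Qed.
Local Lemma qaddC : commutative qadd.
Proof. by move=> p q; rewrite -(qrepK p) -(qrepK q) !qaddE addrC. Qed.
Local Lemma qadd0 : left_id (to_quot 0) qadd.
Proof. by move=> p; rewrite -(qrepK p) qaddE add0r. Qed.
Local Lemma qaddN : left_inverse (to_quot 0) qopp qadd.
Proof. by move=> p; rewrite -(qrepK p) qoppE qaddE addNr. Qed.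

HB.instance Definition _ := GRing.isZmodule.Build quot qaddA qaddC qadd0 qaddN.

Local Lemma qmulA : associative qmul.
Proof.
by move=> p q r; rewrite -(qrepK p) -(qrepK q) -(qrepK r) !qmulE mulrA.
Qed.
Local Lemma qmulC : commutative qmul.
Proof. by move=> p q; rewrite -(qrepK p) -(qrepK q) !qmulE mulrC. Qed.
Local Lemma qmul1 : left_id (to_quot 1) qmul.
Proof. by move=> p; rewrite -(qrepK p) qmulE mul1r. Qed.
Local Lemma qmulD : left_distributive qmul +%R.
Proof.
move=> p q r; rewrite -(qrepK p) -(qrepK q) -(qrepK r).
by rewrite /GRing.add /= !(qmulE, qaddE) mulrDl.
Qed.

HB.instance Definition _ :=
  GRing.Zmodule_isComPzRing.Build quot qmulA qmulC qmul1 qmulD.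

Local Lemma to_quot_zmod : zmod_morphism to_quot.
Proof. by move=> x y; rewrite /GRing.add /GRing.opp /= qoppE qaddE. Qed.
HB.instance Definition _ :=
  GRing.isZmodMorphism.Build R quot to_quot to_quot_zmod.

Local Lemma to_quot_monoid : monoid_morphism to_quot.
Proof. by split=> // x y; rewrite /GRing.mul /= qmulE. Qed.
HB.instance Definition _ :=
  GRing.isMonoidMorphism.Build R quot to_quot to_quot_monoid.

End QuotientRing.

Arguments to_quot {R} I x.

(* The multiplicative submonoid of R generated by S; it is S itself when S is the
   complement of a prime ideal. *)
Definition mult_closure (R : comPzRingType) (S : set R) : set R :=
  [set x | exists2 s : seq R, (forall y, y \in s -> S y) & x = \prod_(y <- s) y].

(* The localization of R at the multiplicative set generated by S: classes of
   fractions a / s, where a / s = b / t iff u (a t - b s) = 0 for some u in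
   that multiplicative set. *)
Section Localization.
Context (R : comPzRingType) (S : set R).

Local Notation M := (mult_closure S).

Lemma mult_closure1 : M 1.
Proof. by exists [::]; rewrite ?big_nil. Qed.

Lemma mult_closureM x y : M x -> M y -> M (x * y).
Proof.
move=> [s Ss ->] [t St ->]; exists (s ++ t); last by rewrite big_cat.
by move=> z; rewrite mem_cat => /orP[/Ss|/St].
Qed.

Definition fraction_pair := {x : R * R | `[< M x.2 >]}.

Local Lemma den_in (f : fraction_pair) : M (val f).2.
Proof. by case: f => x /= /asboolP. Qed.

Local Definition mkf a s (Ms : M s) : fraction_pair :=
  exist _ (a, s) (asboolT Ms).

Local Definition lequiv (f g : fraction_pair) : bool :=
  `[< exists2 u, M u &
      u * ((val f).1 * (val g).2 - (val g).1 * (val f).2) = 0 >].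

Local Lemma lequiv_is_equiv : equiv_class_of lequiv.
Proof.
split=> [f|f g|g f h]; rewrite /lequiv.
- by apply/asboolP; exists 1; [exact: mult_closure1 | rewrite subrr mulr0].
- apply: asbool_equiv_eq; split=> -[u Mu e]; exists u => //;
  by rewrite -opprB mulrN e oppr0.
- move=> /asboolP[u Mu eu] /asboolP[v Mv ev]; apply/asboolP.
  exists (u * v * (val g).2).
    by apply: mult_closureM (den_in g); apply: mult_closureM.
  move: (val f).1 (val f).2 (val g).1 (val g).2 (val h).1 (val h).2 eu ev.
  move=> a s b t c w eu ev.
  have -> : u * v * t * (a * w - c * s) =
    v * w * (u * (a * t - b * s)) + u * s * (v * (b * w - c * t)) by ring.
  by rewrite eu ev !mulr0 addr0.
Qed.

Local Definition lequiv_equiv := EquivRelPack lequiv_is_equiv.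

Definition localization := {eq_quot lequiv_equiv}.

HB.instance Definition _ := Choice.on localization.

Definition frac a s (Ms : M s) : localization := \pi_localization (mkf a Ms).

Lemma fracP a s (Ms : M s) b t (Mt : M t) :
  frac a Ms = frac b Mt <-> exists2 u, M u & u * (a * t - b * s) = 0.
Proof.
split=> [/eqP|H]; first by rewrite eqmodE => /asboolP.
by apply/eqP; rewrite eqmodE; apply/asboolP.
Qed.

Lemma frac_surj (x : localization) : exists a s (Ms : M s), x = frac a Ms.
Proof.
exists (val (repr x)).1, (val (repr x)).2, (den_in (repr x)).
rewrite -[LHS]reprK /frac; congr (\pi _); apply: val_inj => /=.
by case: (sval (repr x)).
Qed.

Local Definition num (x : localization) : R := (val (repr x)).1.
Local Definition den (x : localization) : R := (val (repr x)).2.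
Local Lemma Mden x : M (den x). Proof. exact: den_in. Qed.

Local Lemma lrepK x : frac (num x) (Mden x) = x.
Proof.
rewrite -[RHS]reprK /frac; congr (\pi _); apply: val_inj => /=.
by rewrite /num /den /=; case: (sval (repr x)).
Qed.

Local Definition ladd x y := frac (num x * den y + num y * den x)
  (mult_closureM (Mden x) (Mden y)).
Local Definition lopp x := frac (- num x) (Mden x).
Local Definition lmul x y := frac (num x * num y)
  (mult_closureM (Mden x) (Mden y)).

Local Lemma eq_rep a s (Ms : M s) :
  exists2 u, M u & u * (num (frac a Ms) * s - a * den (frac a Ms)) = 0.
Proof. by move: (lrepK (frac a Ms)) => /fracP. Qed.

Local Lemma laddE a s (Ms : M s) b t (Mt : M t) :
  ladd (frac a Ms) (frac b Mt) = frac (a * t + b * s) (mult_closureM Ms Mt).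
Proof.
apply/fracP; have [u Mu] := eq_rep a Ms; have [v Mv] := eq_rep b Mt.
move: (num (frac a Ms)) (den (frac a Ms)) => a' s'.
move: (num (frac b Mt)) (den (frac b Mt)) => b' t' ev eu.
exists (u * v); first exact: mult_closureM.
have -> : u * v * ((a' * t' + b' * s') * (s * t) - (a * t + b * s) * (s' * t'))
  = v * t * t' * (u * (a' * s - a * s')) + u * s * s' * (v * (b' * t - b * t'))
  by ring.
by rewrite eu ev !mulr0 addr0.
Qed.

Local Lemma loppE a s (Ms : M s) : lopp (frac a Ms) = frac (- a) Ms.
Proof.
apply/fracP; have [u Mu] := eq_rep a Ms.
move: (num (frac a Ms)) (den (frac a Ms)) => a' s' eu.
exists u => //.
have -> : u * (- a' * s - - a * s') = - (u * (a' * s - a * s')) by ring.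
by rewrite eu oppr0.
Qed.

Local Lemma lmulE a s (Ms : M s) b t (Mt : M t) :
  lmul (frac a Ms) (frac b Mt) = frac (a * b) (mult_closureM Ms Mt).
Proof.
apply/fracP; have [u Mu] := eq_rep a Ms; have [v Mv] := eq_rep b Mt.
move: (num (frac a Ms)) (den (frac a Ms)) => a' s'.
move: (num (frac b Mt)) (den (frac b Mt)) => b' t' ev eu.
exists (u * v); first exact: mult_closureM.
have -> : u * v * (a' * b' * (s * t) - a * b * (s' * t'))
  = v * b' * t * (u * (a' * s - a * s')) + u * a * s' * (v * (b' * t - b * t'))
  by ring.
by rewrite eu ev !mulr0 addr0.
Qed.

Local Lemma frac_eq a s (Ms : M s) b t (Mt : M t) :
  a * t = b * s -> frac a Ms = frac b Mt.
Proof.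
move=> e; apply/fracP; exists 1; first exact: mult_closure1.
by rewrite e subrr mulr0.
Qed.

Local Lemma laddA : associative ladd.
Proof.
move=> x y z; rewrite -(lrepK x) -(lrepK y) -(lrepK z) !laddE.
by apply: frac_eq; ring.
Qed.
Local Lemma laddC : commutative ladd.
Proof.
by move=> x y; rewrite -(lrepK x) -(lrepK y) !laddE; apply: frac_eq; ring.
Qed.
Local Lemma ladd0 : left_id (frac 0 mult_closure1) ladd.
Proof. by move=> x; rewrite -(lrepK x) laddE; apply: frac_eq; ring. Qed.
Local Lemma laddN : left_inverse (frac 0 mult_closure1) lopp ladd.
Proof. by move=> x; rewrite -(lrepK x) loppE laddE; apply: frac_eq; ring. Qed.

HB.instance Definition _ :=
  GRing.isZmodule.Build localization laddA laddC ladd0 laddN.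

Local Lemma lmulA : associative lmul.
Proof.
move=> x y z; rewrite -(lrepK x) -(lrepK y) -(lrepK z) !lmulE.
by apply: frac_eq; ring.
Qed.
Local Lemma lmulC : commutative lmul.
Proof.
by move=> x y; rewrite -(lrepK x) -(lrepK y) !lmulE; apply: frac_eq; ring.
Qed.
Local Lemma lmul1 : left_id (frac 1 mult_closure1) lmul.
Proof. by move=> x; rewrite -(lrepK x) lmulE; apply: frac_eq; ring. Qed.
Local Lemma lmulD : left_distributive lmul +%R.
Proof.
move=> x y z; rewrite -(lrepK x) -(lrepK y) -(lrepK z).
by rewrite /GRing.add /= !(lmulE, laddE); apply: frac_eq; ring.
Qed.

HB.instance Definition _ :=
  GRing.Zmodule_isComPzRing.Build localization lmulA lmulC lmul1 lmulD.

Lemma frac_add a s (Ms : M s) b t (Mt : M t) :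
  frac a Ms + frac b Mt = frac (a * t + b * s) (mult_closureM Ms Mt).
Proof. exact: laddE. Qed.

Lemma frac_opp a s (Ms : M s) : - frac a Ms = frac (- a) Ms.
Proof. exact: loppE. Qed.

Lemma frac_mul a s (Ms : M s) b t (Mt : M t) :
  frac a Ms * frac b Mt = frac (a * b) (mult_closureM Ms Mt).
Proof. exact: lmulE. Qed.

Lemma frac0E : 0 = frac 0 mult_closure1. Proof. by []. Qed.
Lemma frac1E : 1 = frac 1 mult_closure1. Proof. by []. Qed.

End Localization.

Definition localization_at (R : comPzRingType) (P : ideal R) : comPzRingType :=
  localization (~` P).

Section DependentProduct.
Context (T : Type) (R_ : T -> comPzRingType).

Definition dprod := forall t, R_ t.

HB.instance Definition _ := Choice.on dprod.

Local Definition padd (x y : dprod) : dprod := fun t => x t + y t.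
Local Definition popp (x : dprod) : dprod := fun t => - x t.
Local Definition pmul (x y : dprod) : dprod := fun t => x t * y t.

Local Lemma paddA : associative padd.
Proof. by move=> x y z; apply: functional_extensionality_dep => t; apply: addrA. Qed.
Local Lemma paddC : commutative padd.
Proof. by move=> x y; apply: functional_extensionality_dep => t; apply: addrC. Qed.
Local Lemma padd0 : left_id (fun=> 0) padd.
Proof. by move=> x; apply: functional_extensionality_dep => t; apply: add0r. Qed.
Local Lemma paddN : left_inverse (fun=> 0) popp padd.
Proof. by move=> x; apply: functional_extensionality_dep => t; apply: addNr. Qed.

HB.instance Definition _ := GRing.isZmodule.Build dprod paddA paddC padd0 paddN.

Local Lemma pmulA : associative pmul.
Proof. by move=> x y z; apply: functional_extensionality_dep => t; apply: mulrA. Qed.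
Local Lemma pmulC : commutative pmul.
Proof. by move=> x y; apply: functional_extensionality_dep => t; apply: mulrC. Qed.
Local Lemma pmul1 : left_id (fun=> 1) pmul.
Proof. by move=> x; apply: functional_extensionality_dep => t; apply: mul1r. Qed.
Local Lemma pmulD : left_distributive pmul +%R.
Proof. by move=> x y z; apply: functional_extensionality_dep => t; apply: mulrDl. Qed.

HB.instance Definition _ :=
  GRing.Zmodule_isComPzRing.Build dprod pmulA pmulC pmul1 pmulD.

Lemma dprod0 t : (0 : dprod) t = 0. Proof. by []. Qed.
Lemma dprod1 t : (1 : dprod) t = 1. Proof. by []. Qed.
Lemma dprodD (x y : dprod) t : (x + y) t = x t + y t. Proof. by []. Qed.
Lemma dprodB (x y : dprod) t : (x - y) t = x t - y t. Proof. by []. Qed.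
Lemma dprodM (x y : dprod) t : (x * y) t = x t * y t. Proof. by []. Qed.

End DependentProduct.

Section Ultraproduct.
Context (T : Type) (U : set_system T) {FU : Filter U}.
Context (R_ : T -> comPzRingType).

Local Definition ulim_null : set (dprod R_) := [set x | \forall t \near U, x t = 0].

Local Lemma null0 : ulim_null 0.
Proof. by apply: filterE. Qed.

Local Lemma nullD x y : ulim_null x -> ulim_null y -> ulim_null (x + y).
Proof.
move=> nx ny; near=> t; rewrite dprodD.
by rewrite (near nx t) ?(near ny t) ?addr0.
Unshelve. all: by end_near.
Qed.

Local Lemma nullM a x : ulim_null x -> ulim_null (a * x).
Proof. by apply: filterS => t xt; rewrite dprodM xt mulr0. Qed.

Definition ulim : comPzRingType := quot (Ideal null0 nullD nullM).

Definition ulim_of (x : forall t, R_ t) : ulim := to_quot _ (x : dprod R_).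

Lemma ulim_ofP x y :
  ulim_of x = ulim_of y <-> \forall t \near U, x t = y t.
Proof.
rewrite /ulim_of to_quotP; split; apply: filterS => t.
  by move/eqP; rewrite dprodB subr_eq0 => /eqP.
by move=> e; rewrite dprodB e subrr.
Qed.

Lemma ulim_of_surj (z : ulim) : exists x, ulim_of x = z.
Proof. by have [x <-] := to_quot_surj z; exists x. Qed.

End Ultraproduct.

Arguments ulim {T} U {FU} R_.
Arguments ulim_of {T} U {FU R_} x.

Section RingNotions.
Context (S : comPzRingType).

Definition is_domain : Prop :=
  (1 : S) <> 0 /\ forall x y : S, x * y = 0 -> x = 0 \/ y = 0.

Definition prime_ideal (P : ideal S) : Prop :=
  ~ P 1 /\ forall x y, P (x * y) -> P x \/ P y.

Definition maximal_ideal (M : ideal S) : Prop :=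
  ~ M 1 /\ forall J : ideal S, M `<=` J -> J 1 \/ J `<=` M.

(* Values at x of X^n + sum_(i < n) c_i X^i and of its derivative.  MathComp has
   polynomials only over nonzero rings. *)
Definition monic_eval n (c : 'I_n -> S) (x : S) : S :=
  x ^+ n + \sum_(i < n) c i * x ^+ i.

Definition monic_deriv_eval n (c : 'I_n -> S) (x : S) : S :=
  x ^+ n.-1 *+ n + \sum_(i < n) c i * x ^+ i.-1 *+ i.

Definition absolutely_integrally_closed : Prop :=
  is_domain /\
  forall n (c : 'I_n -> S), (0 < n)%N -> exists x, monic_eval c x = 0.

(* Simple roots in S/M of monic polynomials over S lift to roots in S. *)
Definition lifts_simple_roots (M : ideal S) : Prop :=
  forall n (c : 'I_n -> S) (a : S),
    M (monic_eval c a) -> ~ M (monic_deriv_eval c a) ->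
    exists2 b, monic_eval c b = 0 & M (b - a).

Definition henselian_local : Prop :=
  exists M : ideal S,
    [/\ maximal_ideal M,
        forall N : ideal S, maximal_ideal N -> N `<=>` M
      & lifts_simple_roots M].

End RingNotions.

(* For rings that need not be local: ulim_p A_p^+ has many maximal ideals as a
   rule, even when A is local, because A_p is not Henselian and so A_p^+ is not
   local.  Hensel's lemma is asked at every maximal ideal M, both for S itself
   and for the local ring S_M; when S is local, S_M is S and this is the usual
   notion [henselian_local]. *)
Definition henselian (S : comPzRingType) : Prop :=
  forall M : ideal S, maximal_ideal M ->
    lifts_simple_roots M /\ henselian_local (localization_at M).

(* E is D^+: with K the fraction field of D and L an algebraic closure of K,
   E is the integral closure of D in L; and E = 0 if D is not a domain. *)
Definition is_absolute_integral_closure (D E : comPzRingType) : Prop :=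
  (is_domain D ->
    exists (K : fieldType) (inK : {rmorphism D -> K})
           (L : closedFieldType) (inL : {rmorphism K -> L})
           (j : {rmorphism E -> L}),
      [/\ injective inK,
          forall z, exists a b, inK b != 0 /\ z = inK a / inK b,
          integralRange inL,
          injective j
        & forall z, (exists x, j x = z) <->
            exists2 q : {poly L}, q \is monic /\
              (forall i, exists d, q`_i = inL (inK d)) & root q z]) /\
  (~ is_domain D -> (1 : E) = 0).

Definition prime_number := {p : nat | prime p}.

Definition Falg (p : prime_number) : closedFieldType :=
  projT1 (countable_algebraic_closure 'F_(val p)).

(* Presents K[X_1,..,X_n]/(relations) or, if [localized_at] is [Some gs], the
   localization of that ring at the ideal generated by the images of gs. *)
Record affine_presentation (K : fieldType) (n : nat) := Affine {
  relations : seq {mpoly K[n]};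
  localized_at : option (seq {mpoly K[n]}) }.

Section AffineRing.
Context (K : fieldType) (n : nat) (A : affine_presentation K n).

Definition affine_fg : comPzRingType := quot (seq_ideal (relations A)).

Definition localized_ideal (gs : seq {mpoly K[n]}) : ideal affine_fg :=
  seq_ideal [seq to_quot (seq_ideal (relations A)) g | g <- gs].

Definition localized_at_prime : Prop :=
  if localized_at A is Some gs then prime_ideal (localized_ideal gs) else True.

Definition affine_ring : comPzRingType :=
  if localized_at A is Some gs then localization_at (localized_ideal gs)
  else affine_fg.

Definition local_affine : Prop := localized_at A : bool.

End AffineRing.

Section Approximation.
Context (C : fieldType) (U : set_system prime_number) {FU : Filter U}.
Context (iso : C -> ulim U Falg) (n : nat).

Definition approximates (c : C) (c_ : forall p, Falg p) : Prop :=
  iso c = ulim_of U c_.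

(* Without the condition on supports the coefficientwise condition would allow
   spurious monomials whose degrees grow with p. *)
Definition approximates_poly (f : {mpoly C[n]})
    (f_ : forall p, {mpoly (Falg p)[n]}) : Prop :=
  (\forall p \near U, {subset msupp (f_ p) <= msupp f}) /\
  forall m, approximates f@_m (fun p => (f_ p)@_m).

Definition approximates_seq (s : seq {mpoly C[n]})
    (s_ : forall p, seq {mpoly (Falg p)[n]}) : Prop :=
  (forall p, size (s_ p) = size s) /\
  forall i, approximates_poly s`_i (fun p => (s_ p)`_i).

Definition approximates_affine (A : affine_presentation C n)
    (A_ : forall p, affine_presentation (Falg p) n) : Prop :=
  approximates_seq (relations A) (fun p => relations (A_ p)) /\
  match localized_at A with
  | None => forall p, localized_at (A_ p) = None
  | Some gs => exists2 gs_ : forall p, seq {mpoly (Falg p)[n]},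
      forall p, localized_at (A_ p) = Some (gs_ p) & approximates_seq gs gs_
  end.

End Approximation.

(* Main.v *)
(** By Los' theorem the ultraproduct of the [A_p^+] is absolutely integrally
    closed as soon as almost all [A_p] are domains, and a domain in which every
    monic polynomial splits satisfies Hensel's lemma at every prime.  So the
    point is that almost all [A_p] are domains if [A] is one.

    Let [A = C[X]/I] be a domain and [x] the image of [X] in its fraction field.
    Let [K_p] be an ultrapower of [F_p^alg]: it is algebraically closed and, by
    a diagonal argument, has elements transcendental over any finitely generated
    subfield.  One coordinate at a time we choose points [xi_p] of [K_p^n] whose
    limit satisfies exactly the polynomial relations of [x]: a coordinate of
    [xi_p] is transcendental over the previous ones, or a root of an
    approximation of the minimal polynomial of the coordinate of [x].  Minimal
    polynomials stay minimal because [C(x)] is relatively algebraically closed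
    in the ultraproduct of the fields [F_p^alg(xi_p)].  This persists at a
    transcendental coordinate (bound the degree of an integral element and
    interpolate it at integers) and at an algebraic one (interpolate at the
    conjugates).  By pseudo-division the prime ideal of [xi_p] agrees with [I_p]
    up to powers of an approximation [h_p] of a single [h] not in [I].

    Finally [h_p] is regular modulo [I_p], because colon ideals commute with
    approximation: by Schreyer's theorem the syzygies of a Groebner basis are
    generated by the reductions of its S-polynomials, and these are finitely
    many identities, valid for almost all [p].  The local case is the same with
    [I] replaced by its saturation. *)

From HB Require Import structures.
From mathcomp Require Import all_boot all_order all_algebra all_field.
From mathcomp Require Import boolp classical_sets filter reals complex.
From mathcomp Require Import ring zify.
From mathcomp Require Import mpoly.
Require Import Defs.

Set Implicit Arguments.
Unset Strict Implicit.
Unset Printing Implicit Defensive.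

Import GRing.Theory.

Local Open Scope classical_set_scope.
Local Open Scope ring_scope.

(** * Ultraproducts of rings and of algebraically closed fields *)

(** Two limits of the ultraproduct shape the proof. Polynomials over the factors have a polynomial
    limit only if their degrees are bounded, and only finitely many identities can be required to
    hold for almost all factors at once. Hence the explicit bounds on sizes, and the finite families
    of witnesses fixed over [C] before a factor is chosen.

    A polynomial irreducible over [C(x)] could still factor over almost all fields [F_p^alg(xi_p)].
    Such factors have bounded degree, so their limit would be a factorization over the ultraproduct
    of these fields, which is much larger than [C(x)]. Relative algebraic closedness excludes
    exactly this, so it has to be carried along the induction.

    The generic point determines [I_p] only away from [h_p = 0]: an element of the prime of [xi_p]
    lies in [I_p] after multiplication by a power of [h_p] whose exponent depends on the element and
    on [p], so the exponent cannot be transferred. The colon ideal by [h_p], in contrast, has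
    generators that come from [C], and they remove the factors [h_p] one at a time. *)

Section UltraproductRing.
Context (T : Type) (U : set_system T) {FU : Filter U}.
Context (R_ : T -> comPzRingType).
Implicit Types x y : forall t, R_ t.

Lemma ulim_of0 : ulim_of U (fun t => 0 : R_ t) = 0.
Proof. exact: (raddf0 (to_quot _)). Qed.

Lemma ulim_of1 : ulim_of U (fun t => 1 : R_ t) = 1.
Proof. exact: (rmorph1 (to_quot _)). Qed.

Lemma ulim_ofD x y : ulim_of U (fun t => x t + y t) = ulim_of U x + ulim_of U y.
Proof. exact: (raddfD (to_quot _) (x : dprod R_) y). Qed.

Lemma ulim_ofN x : ulim_of U (fun t => - x t) = - ulim_of U x.
Proof. exact: (raddfN (to_quot _) (x : dprod R_)). Qed.

Lemma ulim_ofM x y : ulim_of U (fun t => x t * y t) = ulim_of U x * ulim_of U y.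
Proof. exact: (rmorphM (to_quot _) (x : dprod R_) y). Qed.

Lemma ulim_ofX x n : ulim_of U (fun t => x t ^+ n) = ulim_of U x ^+ n.
Proof.
elim: n => [|n IH]; first by rewrite expr0 -ulim_of1; congr ulim_of.
rewrite exprS -IH -ulim_ofM; congr ulim_of.
by apply: functional_extensionality_dep => t; rewrite exprS.
Qed.

Lemma ulim_of_sum (I : Type) (r : seq I) (P : pred I) (F : I -> forall t, R_ t) :
  ulim_of U (fun t => \sum_(i <- r | P i) F i t) =
  \sum_(i <- r | P i) ulim_of U (F i).
Proof.
elim: r => [|i r IH].
  rewrite big_nil -ulim_of0; congr ulim_of.
  by apply: functional_extensionality_dep => t; rewrite big_nil.
rewrite big_cons -IH; case: ifP => Pi; last first.
  by congr ulim_of; apply: functional_extensionality_dep => t; rewrite big_cons Pi.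
rewrite -ulim_ofD; congr ulim_of.
by apply: functional_extensionality_dep => t; rewrite big_cons Pi.
Qed.

Lemma ulim_of_eq0 x : ulim_of U x = 0 <-> \forall t \near U, x t = 0.
Proof. by rewrite -ulim_of0 ulim_ofP. Qed.

End UltraproductRing.

Section Ultrafilter.
Context (T : Type) (U : set_system T) {FU : UltraFilter U}.

Lemma ultra_dec (P : T -> Prop) :
  (\forall t \near U, P t) \/ (\forall t \near U, ~ P t).
Proof. exact: in_ultra_setVsetC. Qed.

Lemma ultra_false : ~ \forall t \near U, False.
Proof. by move=> h; apply: (@filter_not_empty _ U); exact: h. Qed.

Lemma ultra_notP (P : T -> Prop) :
  (~ \forall t \near U, P t) <-> (\forall t \near U, ~ P t).
Proof.
split=> [h|h h']; first by case: (ultra_dec P).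
by apply: ultra_false; apply: filterS2 h h'.
Qed.

Lemma ultra_or (P Q : T -> Prop) : (\forall t \near U, P t \/ Q t) ->
  (\forall t \near U, P t) \/ (\forall t \near U, Q t).
Proof.
move=> h; case: (ultra_dec P) => [|nP]; [by left | right].
by apply: filterS2 h nP => t [].
Qed.

Lemma ultra_fin (I : finType) (P : I -> T -> Prop) :
  (\forall t \near U, exists i, P i t) -> exists i, \forall t \near U, P i t.
Proof.
move=> h; apply: contrapT => /forallNP nP.
have : \forall t \near U, forall i, ~ P i t.
  by apply: filter_forall => i; apply/ultra_notP.
by move=> h'; apply: ultra_false; apply: filterS2 h h' => t [i Pi] /(_ i).
Qed.

Context (R_ : T -> comPzRingType).

Lemma ulim_domain : (\forall t \near U, is_domain (R_ t)) -> is_domain (ulim U R_).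
Proof.
move=> dom; split.
  rewrite -ulim_of1 => /ulim_of_eq0 h; apply: ultra_false.
  by apply: filterS2 h dom => t h [].
move=> x y; have [a <-] := ulim_of_surj x; have [b <-] := ulim_of_surj y.
rewrite -ulim_ofM => /ulim_of_eq0 h.
have /ultra_or[] : \forall t \near U, a t = 0 \/ b t = 0.
  by apply: filterS2 h dom => t h [_]; apply.
- by move=> /ulim_of_eq0; left.
- by move=> /ulim_of_eq0; right.
Qed.

End Ultrafilter.

Section UltraField.
Context (T : Type) (U : set_system T) (FU : UltraFilter U).
Context (R_ : T -> closedFieldType).

(** A copy of [ulim] tied to the proof [FU] that [U] is an ultrafilter: the field structure depends
    on it, whereas [ulim] asks only for a filter. *)
Definition ufield : Type := ulim U R_.
HB.instance Definition _ := GRing.ComPzRing.on ufield.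

Local Notation lim x := (ulim_of U (x : forall t, (R_ t : comPzRingType)) : ufield).

Lemma ufield_surj (z : ufield) : {x : forall t, R_ t | lim x = z}.
Proof. exact: (cid (ulim_of_surj z)). Qed.

Lemma ufield_one_neq0 : (1 : ufield) != 0.
Proof.
apply/eqP => /esym; rewrite -[1](@ulim_of1 _ U _ R_) => /esym/ulim_of_eq0 h.
by apply: (@ultra_false T U); apply: filterS h => t /eqP; rewrite oner_eq0.
Qed.
HB.instance Definition _ :=
  GRing.PzSemiRing_isNonZero.Build ufield ufield_one_neq0.

Definition ufield_inv (z : ufield) : ufield :=
  lim (fun t => (sval (ufield_surj z) t)^-1).

Lemma ufield_mulVf (z : ufield) : z != 0 -> ufield_inv z * z = 1.
Proof.
rewrite /ufield_inv; case: (ufield_surj z) => x /= <- nz0.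
rewrite -[RHS](@ulim_of1 _ U _ R_) -ulim_ofM; apply/ulim_ofP.
have : \forall t \near U, x t <> 0.
  by apply/ultra_notP => /ulim_of_eq0 h; rewrite h eqxx in nz0.
by apply: filterS => t /eqP nx; rewrite mulVf.
Qed.

Lemma ufield_invr0 : ufield_inv 0 = 0.
Proof.
rewrite /ufield_inv; case: (ufield_surj 0) => x /= /ulim_of_eq0 h.
by apply/ulim_of_eq0; apply: filterS h => t ->; rewrite invr0.
Qed.
HB.instance Definition _ :=
  GRing.ComNzRing_isField.Build ufield ufield_mulVf ufield_invr0.

Lemma ufield_closed : GRing.closed_field_axiom ufield.
Proof.
move=> n P n0.
pose c i := sval (ufield_surj (P i)).
have cP i : lim (c i) = P i by rewrite /c; case: ufield_surj.
have root_ t : exists x : R_ t, x ^+ n = \sum_(i < n) c i t * x ^+ i.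
  exact: (@solve_monicpoly (R_ t) n (fun i => c i t) n0).
pose x t := sval (cid (root_ t)).
exists (lim x); rewrite -ulim_ofX.
under [RHS]eq_bigr do rewrite -cP -ulim_ofX -ulim_ofM.
rewrite -ulim_of_sum; congr ulim_of; apply: functional_extensionality_dep => t.
by rewrite /x; case: cid.
Qed.
HB.instance Definition _ := Field_isAlgClosed.Build ufield ufield_closed.

Definition ulimf (x : forall t, R_ t) : ufield := lim x.

Lemma ulimfP x y : ulimf x = ulimf y <-> \forall t \near U, x t = y t.
Proof. exact: ulim_ofP. Qed.
Lemma ulimf_surj z : exists x, ulimf x = z.
Proof. exact: ulim_of_surj. Qed.
Lemma ulimf1 : ulimf (fun=> 1) = 1. Proof. exact: ulim_of1. Qed.
Lemma ulimfD x y : ulimf (fun t => x t + y t) = ulimf x + ulimf y.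
Proof. exact: ulim_ofD. Qed.
Lemma ulimfN x : ulimf (fun t => - x t) = - ulimf x.
Proof. exact: ulim_ofN. Qed.
Lemma ulimfB x y : ulimf (fun t => x t - y t) = ulimf x - ulimf y.
Proof. by rewrite ulimfD ulimfN. Qed.
Lemma ulimfM x y : ulimf (fun t => x t * y t) = ulimf x * ulimf y.
Proof. exact: ulim_ofM. Qed.
Lemma ulimfX x n : ulimf (fun t => x t ^+ n) = ulimf x ^+ n.
Proof. exact: ulim_ofX. Qed.
Lemma ulimf_sum (I : Type) (r : seq I) (P : pred I) (F : I -> forall t, R_ t) :
  ulimf (fun t => \sum_(i <- r | P i) F i t) = \sum_(i <- r | P i) ulimf (F i).
Proof. exact: ulim_of_sum. Qed.
Lemma ulimf_eq0 x : ulimf x = 0 <-> \forall t \near U, x t = 0.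
Proof. exact: ulim_of_eq0. Qed.
Lemma ulimfV x : ulimf (fun t => (x t)^-1) = (ulimf x)^-1.
Proof.
case: (eqVneq (ulimf x) 0) => [x0|nx0].
  rewrite x0 invr0; apply/ulimf_eq0; move/ulimf_eq0: x0.
  by apply: filterS => t ->; rewrite invr0.
apply: (mulfI nx0); rewrite divff // -ulimfM -ulimf1; apply/ulimfP.
have : \forall t \near U, x t <> 0.
  by apply/ultra_notP => /ulimf_eq0 h; rewrite h eqxx in nx0.
by apply: filterS => t /eqP nx; rewrite divff.
Qed.

End UltraField.

(** * Subfields, minimal polynomials and interpolation *)

Definition subfield (K : fieldType) (E : set K) : Prop :=
  [/\ E 1, forall x y, E x -> E y -> E (x - y)
    & forall x y, E x -> E y -> E (x / y)].

Definition polyin (K : fieldType) (E : set K) (p : {poly K}) : Prop :=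
  forall i, E p`_i.

Definition algin (K : fieldType) (E : set K) (z : K) : Prop :=
  exists p : {poly K}, [/\ polyin E p, p != 0 & root p z].

Section SubfieldType.
Context (K : fieldType) (E : set K) (sE : subfield E).

(* The idle [let] makes the predicate depend on [sE], which its algebraic
   structure needs. *)
Definition subfield_pred : pred K :=
  let _ := sE in fun x => `[< E x >].

Lemma subfield_divring : divring_closed subfield_pred.
Proof.
case: sE => E1 EB EV; split; first exact/asboolP.
- by move=> x y /asboolP ? /asboolP ?; apply/asboolP/EB.
- by move=> x y /asboolP ? /asboolP ?; apply/asboolP/EV.
Qed.
HB.instance Definition _ := GRing.isDivringClosed.Build K subfield_pred
  subfield_divring.

Record subfield_type := SubfieldElt {
  subfield_val : K; subfield_valP : subfield_val \in subfield_pred }.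

HB.instance Definition _ := [isSub for subfield_val].
HB.instance Definition _ := [Choice of subfield_type by <:].
HB.instance Definition _ := [SubChoice_isSubIntegralDomain of subfield_type by <:].
HB.instance Definition _ := [SubIntegralDomain_isSubField of subfield_type by <:].

End SubfieldType.

(** Subfields are handled as sets, since they vary with the factor and are compared inside one large
    field. This embedding is the bridge to the theory of algebraic elements, division and gcd, which
    is stated for field types. *)
Lemma subfield_fieldType (K : fieldType) (E : set K) : subfield E ->
  exists (F : fieldType) (m : {rmorphism F -> K}), forall z, E z <-> exists a, m a = z.
Proof.
move=> sE; exists (subfield_type sE : fieldType).
exists (val : {rmorphism (subfield_type sE) -> K}) => z.
split=> [/asboolP Ez|[a <-]]; first by exists (SubfieldElt Ez).
by case: a => x /= /asboolP.
Qed.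

Section SubfieldTheory.
Context (K : fieldType) (E : set K) (sE : subfield E).

Lemma subfield1 : E 1. Proof. by case: sE. Qed.
Lemma subfieldB x y : E x -> E y -> E (x - y).
Proof. by case: sE => _ h _; apply: h. Qed.
Lemma subfield_div x y : E x -> E y -> E (x / y).
Proof. by case: sE => _ _; apply. Qed.
Lemma subfield0 : E 0.
Proof. by rewrite -(subrr 1); apply: subfieldB; apply: subfield1. Qed.
Lemma subfieldN x : E x -> E (- x).
Proof. by rewrite -sub0r; apply: subfieldB; apply: subfield0. Qed.
Lemma subfieldD x y : E x -> E y -> E (x + y).
Proof. by move=> Ex Ey; rewrite -[y]opprK; apply: subfieldB => //; apply: subfieldN. Qed.
Lemma subfieldV x : E x -> E x^-1.
Proof. by rewrite -div1r; apply: subfield_div; apply: subfield1. Qed.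
Lemma subfieldM x y : E x -> E y -> E (x * y).
Proof. by move=> Ex Ey; rewrite -[y]invrK; apply: subfield_div => //; apply: subfieldV. Qed.
Lemma subfieldX x n : E x -> E (x ^+ n).
Proof.
move=> Ex; elim: n => [|n IH]; first by rewrite expr0; apply: subfield1.
by rewrite exprS; apply: subfieldM.
Qed.
Lemma subfield_nat n : E n%:R.
Proof.
elim: n => [|n IH]; first exact: subfield0.
by rewrite -natr1; apply: subfieldD => //; apply: subfield1.
Qed.
Lemma subfield_sum (I : Type) (r : seq I) (P : pred I) (F : I -> K) :
  (forall i, P i -> E (F i)) -> E (\sum_(i <- r | P i) F i).
Proof. by move=> h; apply: big_ind => //; [apply: subfield0 | apply: subfieldD]. Qed.

Lemma polyin_horner p x : polyin E p -> E x -> E p.[x].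
Proof.
move=> Ep Ex; rewrite horner_coef; apply: subfield_sum => i _.
by apply: subfieldM => //; apply: subfieldX.
Qed.

Lemma polyinD p q : polyin E p -> polyin E q -> polyin E (p + q).
Proof. by move=> Ep Eq i; rewrite coefD; apply: subfieldD. Qed.
Lemma polyinN p : polyin E p -> polyin E (- p).
Proof. by move=> Ep i; rewrite coefN; apply: subfieldN. Qed.
Lemma polyinM p q : polyin E p -> polyin E q -> polyin E (p * q).
Proof.
by move=> Ep Eq i; rewrite coefM; apply: subfield_sum => j _; apply: subfieldM.
Qed.
Lemma polyinC c : E c -> polyin E c%:P.
Proof. by move=> Ec i; rewrite coefC; case: ifP => // _; apply: subfield0. Qed.
Lemma polyinX : polyin E 'X.
Proof.
by move=> i; rewrite coefX; case: eqP => _; [apply: subfield1 | apply: subfield0].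
Qed.
Lemma polyin1 : polyin E 1. Proof. exact: polyinC subfield1. Qed.
Lemma polyinXn p n : polyin E p -> polyin E (p ^+ n).
Proof.
move=> Ep; elim: n => [|n IH]; first by rewrite expr0; apply: polyin1.
by rewrite exprS; apply: polyinM.
Qed.
Lemma polyin_sum (I : Type) (r : seq I) (P : pred I) (F : I -> {poly K}) :
  (forall i, P i -> polyin E (F i)) -> polyin E (\sum_(i <- r | P i) F i).
Proof.
move=> h; apply: big_ind => //; [move=> i; rewrite coef0; apply: subfield0|].
exact: polyinD.
Qed.
Lemma polyin_comp p q : polyin E p -> polyin E q -> polyin E (p \Po q).
Proof.
move=> Ep Eq; rewrite comp_polyE; apply: polyin_sum => i _.
by rewrite -mul_polyC; apply: polyinM; [apply: polyinC | apply: polyinXn].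
Qed.
Lemma polyin_deriv p : polyin E p -> polyin E p^`().
Proof.
move=> Ep i; rewrite coef_deriv -mulr_natr.
by apply: subfieldM => //; apply: subfield_nat.
Qed.

(** Newton interpolation: write [p = q * ('X - c%:P) + p.[c]%:P] at the first node [c]. At another
    node [d] the quotient takes the value [(p.[d] - p.[c]) / (d - c)], again in [E], so induction
    applies to [q]. *)
Lemma polyin_interp (s : seq K) (p : {poly K}) : uniq s -> (size p <= size s)%N ->
  (forall c, c \in s -> E c /\ E p.[c]) -> polyin E p.
Proof.
elim: s p => [|c s IH] p /=.
  by rewrite leqn0 size_poly_eq0 => _ /eqP -> _ i; rewrite coef0; apply: subfield0.
move=> /andP[cs us] sp h.
have [Ec Epc] : E c /\ E p.[c] by apply: h; rewrite mem_head.
have : root (p - p.[c]%:P) c by rewrite rootE !hornerE subrr.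
move=> /factor_theorem[q pq].
have {}pq : p = q * ('X - c%:P) + p.[c]%:P by rewrite -pq subrK.
have Eq : polyin E q.
  apply: IH => //.
    have : (size (q * ('X - c%:P))%R <= (size s).+1)%N.
      have -> : q * ('X - c%:P) = p - p.[c]%:P by rewrite {1}pq addrK.
      rewrite (leq_trans (size_polyD _ _)) // geq_max sp size_polyN.
      by rewrite (leq_trans (size_polyC_leq1 _)).
    have [->|q0] := eqVneq q 0; first by rewrite size_poly0.
    by rewrite size_Mmonic ?monicXsubC // size_XsubC addn2.
  move=> d ds; have [Ed Epd] : E d /\ E p.[d] by apply: h; rewrite inE ds orbT.
  split=> //; have dc : d - c != 0.
    by rewrite subr_eq0; apply: contraNneq cs => <-.
  have -> : q.[d] = (p.[d] - p.[c]) / (d - c).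
    by rewrite {1}pq !hornerE addrK mulfK.
  by apply: subfield_div; apply: subfieldB.
rewrite pq; apply: polyinD; last exact: polyinC.
by apply: polyinM => //; apply: polyinD; [apply: polyinX | apply/polyinN/polyinC].
Qed.

Section Lift.
Context (F : fieldType) (m : {rmorphism F -> K}).
Hypothesis mE : forall z, E z <-> exists a, m a = z.

Lemma polyin_map (p : {poly F}) : polyin E (map_poly m p).
Proof. by move=> i; rewrite coef_map; apply/mE; exists p`_i. Qed.

Lemma polyin_lift p : polyin E p -> exists q : {poly F}, p = map_poly m q.
Proof.
move=> Ep; pose c i := sval (cid (iffLR (mE _) (Ep i))).
have cE i : m (c i) = p`_i by rewrite /c; case: cid.
exists (\poly_(i < size p) c i); apply/polyP => i.
rewrite coef_map coef_poly; case: ltnP => [_|h]; first exact: esym (cE i).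
by rewrite nth_default //; exact: esym (rmorph0 m).
Qed.

Lemma algin_algebraic z : algin E z <-> algebraicOver m z.
Proof.
split=> [[p [/polyin_lift[q ->] q0 r]]|[q q0 r]].
  by exists q => //; rewrite map_poly_eq0 in q0.
by exists (map_poly m q); split; rewrite ?map_poly_eq0 //; apply: polyin_map.
Qed.

End Lift.

Lemma algin_subfield : subfield (algin E).
Proof.
have [F [m mE]] := subfield_fieldType sE.
split=> [|x y|x y]; rewrite ?(algin_algebraic mE).
- exact: algebraic1.
- exact: algebraic_sub.
- exact: algebraic_div.
Qed.

Lemma algin_id z : E z -> algin E z.
Proof.
have [F [m mE]] := subfield_fieldType sE.
by move=> /mE[a <-]; apply/(algin_algebraic mE); apply: algebraic_id.
Qed.

Lemma algin_trans p z : polyin (algin E) p -> p != 0 -> root p z -> algin E z.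
Proof.
have [F [m mE]] := subfield_fieldType sE.
move=> Ap p0 r; apply/(algin_algebraic mE)/integral_algebraic.
apply: integral_root p0 r _; apply/integral_poly => i.
by apply/integral_algebraic/(algin_algebraic mE).
Qed.

Lemma polyin_modp p q : polyin E p -> polyin E q -> polyin E (p %% q).
Proof.
have [F [m mE]] := subfield_fieldType sE.
move=> /(polyin_lift mE)[p' ->] /(polyin_lift mE)[q' ->].
by rewrite -map_modp; apply: (polyin_map mE).
Qed.

Lemma polyin_divp p q : polyin E p -> polyin E q -> polyin E (p %/ q).
Proof.
have [F [m mE]] := subfield_fieldType sE.
move=> /(polyin_lift mE)[p' ->] /(polyin_lift mE)[q' ->].
by rewrite -map_divp; apply: (polyin_map mE).
Qed.

Lemma polyin_gcdp p q : polyin E p -> polyin E q -> polyin E (gcdp p q).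
Proof.
have [F [m mE]] := subfield_fieldType sE.
move=> /(polyin_lift mE)[p' ->] /(polyin_lift mE)[q' ->].
by rewrite -gcdp_map; apply: (polyin_map mE).
Qed.

Lemma polyin_bezout p q : polyin E p -> polyin E q -> coprimep p q ->
  exists u v, [/\ polyin E u, polyin E v & u * p + v * q = 1].
Proof.
have [F [m mE]] := subfield_fieldType sE.
move=> /(polyin_lift mE)[p' ->] /(polyin_lift mE)[q' ->].
rewrite coprimep_map => /Bezout_eq1_coprimepP[[u v] /= uv].
exists (map_poly m u), (map_poly m v); split; try exact: (polyin_map mE).
by rewrite -!rmorphM -rmorphD uv rmorph1.
Qed.

Definition minpoly_in (g : {poly K}) (z : K) : Prop :=
  [/\ polyin E g, g \is monic, root g z
    & forall q, polyin E q -> root q z -> g %| q].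

Lemma minpoly_exists z : algin E z -> exists g, minpoly_in g z.
Proof.
move=> [p [Ep p0 rp]].
pose P n := `[< exists g, [/\ polyin E g, g != 0, root g z & size g = n] >].
have exP : exists n, P n by exists (size p); apply/asboolP; exists p.
case: (ex_minnP exP) => n /asboolP[g [Eg g0 rg sg]] nmin.
have lg : lead_coef g != 0 by rewrite lead_coef_eq0.
exists ((lead_coef g)^-1 *: g); split.
- by rewrite -mul_polyC; apply: polyinM => //; apply/polyinC/subfieldV/Eg.
- by rewrite monicE lead_coefZ mulVf.
- by rewrite rootE hornerZ (rootP rg) mulr0.
move=> q Eq rq; rewrite dvdpZl ?invr_eq0 //.
apply/modp_eq0P; apply/eqP; apply: contraT => r0.
have : P (size (q %% g)).
  apply/asboolP; exists (q %% g); split=> //; first exact: polyin_modp.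
  have := rootP rq; rewrite {1}(divp_eq q g) !hornerE (rootP rg) mulr0 add0r.
  by move/rootP.
by move=> /nmin; rewrite -sg leqNgt ltn_modp g0.
Qed.

(** The gcd [d] of [g] and [b] does not vanish at [z], so [g %/ d] does. By minimality [g] divides
    [g %/ d], which forces [d] to be constant. *)
Lemma minpoly_coprimep g z b : minpoly_in g z -> polyin E b -> ~~ root b z ->
  coprimep g b.
Proof.
move=> [Eg mg rg gmin] Eb nb.
have g0 : g != 0 by rewrite monic_neq0.
set d := gcdp g b; have dg : d %| g by apply: dvdp_gcdl.
have d0 : d != 0 by rewrite gcdp_eq0 (negPf g0).
have re : root (g %/ d) z.
  move: rg; rewrite -{1}(divpK dg) rootM => /orP[//|rd].
  case/negP: nb; rewrite -(divpK (dvdp_gcdr g b)) rootM -/d rd orbT //.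
have /gmin /(_ re) ge : polyin E (g %/ d).
  by apply: polyin_divp => //; apply: polyin_gcdp.
have e0 : g %/ d != 0.
  by apply: contraNneq g0 => e0; rewrite -(divpK dg) e0 mul0r.
rewrite /coprimep -/d; have := dvdp_leq e0 ge.
have := size_mul e0 d0; rewrite divpK // => ->.
move: d0 e0; rewrite -!size_poly_gt0; lia.
Qed.

End SubfieldTheory.

(** In characteristic 0 the derivative of [g] is non-zero and shorter than [g], so it does not
    vanish at [z] and is coprime to [g]; thus [g] is separable. Distinct conjugates are needed as
    interpolation nodes. *)
Lemma minpoly_roots (K : closedFieldType) (E : set K) (g : {poly K}) (z : K) :
  [pchar K] =i pred0 -> subfield E -> minpoly_in E g z ->
  exists rs : seq K, uniq rs /\ g = \prod_(r <- rs) ('X - r%:P).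
Proof.
move=> char0 sE mz; have [Eg mg rg gmin] := mz.
have [rs grs] := closed_field_poly_normal g.
exists rs; split; last by rewrite [LHS]grs (monicP mg) scale1r.
have g0 : g != 0 by rewrite monic_neq0.
suff : separable_poly g.
  by rewrite grs (monicP mg) scale1r separable_prod_XsubC.
rewrite separable_poly.unlock.
apply: (minpoly_coprimep sE mz); first exact: polyin_deriv.
apply/negP => /(gmin _ (polyin_deriv sE Eg)) gd.
have sg : (1 < size g)%N.
  by apply: (root_size_gt1 g0 rg).
have d0 : g^`() != 0.
  have [k sk] : exists k, size g = k.+2.
    by case: (size g) sg => [|[|k]] // _; exists k.
  apply/eqP => d0; have lc := monicP mg.
  have := congr1 (fun p : {poly K} => p`_k) d0.
  rewrite coef_deriv coef0 => /eqP; rewrite -mulr_natr mulf_eq0.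
  by move: lc; rewrite lead_coefE sk /= => ->; rewrite oner_eq0 (iffLR (pcharf0P _) char0).
by have := dvdp_leq d0 gd; rewrite leqNgt (leq_trans (lt_size_deriv g0)).
Qed.

(** The field [E(t)], as fractions so that one definition serves transcendental and algebraic
    [t]. *)
Definition ratext (K : fieldType) (E : set K) (t : K) : set K :=
  [set z | exists a b, [/\ polyin E a, polyin E b, b.[t] != 0 & z = a.[t] / b.[t]]].

Lemma ratext_subfield (K : fieldType) (E : set K) t : subfield E ->
  subfield (ratext E t).
Proof.
move=> sE; split.
- exists 1, 1; rewrite !hornerE oner_neq0 ?divr1 ?invr1 ?mulr1.
  by split=> //; apply: polyin1.
- move=> _ _ [a [b [Ea Eb b0 ->]]] [c [d [Ec Ed d0 ->]]].
  exists (a * d - c * b), (b * d); rewrite !hornerE mulf_neq0 //; split=> //.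
  + apply: polyinD => //; last apply: polyinN => //; exact: polyinM.
  + exact: polyinM.
  by field; rewrite b0 d0.
- move=> _ _ [a [b [Ea Eb b0 ->]]] [c [d [Ec Ed d0 ->]]].
  have [c0|c0] := eqVneq c.[t] 0.
    exists 0, 1; rewrite !hornerE c0 mul0r invr0 mulr0 oner_neq0; split=> //.
      by move=> i; rewrite coef0; apply: subfield0.
    exact: polyin1.
  exists (a * d), (b * c); rewrite !hornerE mulf_neq0 //; split=> //; try exact: polyinM.
  by field; rewrite b0 c0 d0.
Qed.

Lemma ratext_sub (K : fieldType) (E : set K) t z : subfield E -> E z -> ratext E t z.
Proof.
move=> sE Ez; exists z%:P, 1; rewrite !hornerE oner_neq0 ?divr1 ?invr1 ?mulr1; split=> //.
  exact: polyinC.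
exact: polyin1.
Qed.

Lemma ratext_gen (K : fieldType) (E : set K) t : subfield E -> ratext E t t.
Proof.
move=> sE; exists 'X, 1; rewrite !hornerE oner_neq0 ?divr1 ?invr1 ?mulr1; split=> //.
  exact: polyinX.
exact: polyin1.
Qed.

(** A Bezout relation with the minimal polynomial of [t] inverts the denominator, and reduction
    modulo it bounds the size. The bound is stated for any [g] killing [t], because an approximation
    of a minimal polynomial need not be minimal. *)
Lemma ratext_poly (K : fieldType) (E : set K) t g z : subfield E ->
  polyin E g -> g != 0 -> root g t -> ratext E t z ->
  exists2 Z, polyin E Z & (size Z < size g)%N /\ z = Z.[t].
Proof.
move=> sE Eg g0 rg [a [b [Ea Eb b0 ->]]].
have algt : algin E t by exists g.
have [m mt] := minpoly_exists sE algt; have [Em mm rm mmin] := mt.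
have m0 : m != 0 by rewrite monic_neq0.
have cop : coprimep m b by apply: (minpoly_coprimep sE mt).
have [u [v [Eu Ev uv]]] := polyin_bezout sE Em Eb cop.
exists ((a * v) %% m); first by apply: polyin_modp => //; apply: polyinM.
split.
  apply: leq_trans (dvdp_leq g0 (mmin _ Eg rg)).
  by rewrite ltn_modp.
have vb : v.[t] * b.[t] = 1.
  by have := congr1 (horner^~ t) uv; rewrite !hornerE (rootP rm) mulr0 add0r.
have := congr1 (horner^~ t) (divp_eq (a * v) m).
rewrite !hornerE (rootP rm) mulr0 add0r => <-.
by apply: (mulIf b0); rewrite divfK // -mulrA vb mulr1.
Qed.

(** A fraction in lowest terms that is integral over a polynomial ring has a constant denominator.
    If [w] had degree above [B], then [w ^+ m] would outgrow all other terms. The bound does not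
    depend on [u] and [v], so limits of such [w] can be taken. *)
Lemma integral_ratio_poly (F : fieldType) (m B : nat) (c : 'I_m -> {poly F})
    (u v : {poly F}) : v != 0 -> (forall i, (size (c i) <= B)%N) ->
  u ^+ m + \sum_(i < m) c i * u ^+ i * v ^+ (m - i) = 0 ->
  exists w, [/\ u = w * v, (size w <= B.+1)%N & w ^+ m + \sum_(i < m) c i * w ^+ i = 0].
Proof.
move=> v0 cB e.
suff [w uw] : exists w, u = w * v.
  have ew : w ^+ m + \sum_(i < m) c i * w ^+ i = 0.
    apply: (mulIf (expf_neq0 m v0)); rewrite mul0r -[RHS]e mulrDl uw exprMn.
    congr (_ + _); rewrite mulr_suml; apply: eq_bigr => i _.
    by rewrite exprMn -!mulrA -exprD subnKC // ltnW.
  exists w; split=> //; rewrite leqNgt; apply/negP => sw.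
  have w0 : w != 0 by rewrite -size_poly_gt0; apply: leq_trans sw.
  have : w ^+ m = - \sum_(i < m) c i * w ^+ i by apply/eqP; rewrite -subr_eq0 opprK ew.
  move=> /(congr1 (fun p : {poly F} => size p)); apply/eqP.
  rewrite neq_ltn size_polyN; apply/orP; right.
  have sz k : size (w ^+ k) = ((size w).-1 * k).+1.
    by rewrite -size_exp prednK // size_poly_gt0 expf_neq0.
  rewrite sz ltnS.
  apply: (leq_trans (size_sum _ _ _)); apply/bigmax_leqP => i _.
  apply: leq_trans (size_polyMleq _ _) _.
  rewrite sz addnS /= (leq_trans (leq_add (cB i) (leqnn _))) //.
  apply: (@leq_trans ((size w).-1 * i.+1)); last by rewrite leq_mul2l ltn_ord orbT.
  by rewrite mulnS leq_add2r; move: sw; case: (size w) => // k /ltnW.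
have [d [u' [v' [d0 du dv cop]]]] :
    exists d u' v', [/\ d != 0, u = u' * d, v = v' * d & coprimep u' v'].
  exists (gcdp u v), (u %/ gcdp u v), (v %/ gcdp u v).
  rewrite !divpK ?dvdp_gcdl ?dvdp_gcdr // gcdp_eq0 negb_and v0 orbT; split=> //.
  by apply: coprimep_div_gcd; rewrite v0 orbT.
have e' : u' ^+ m + \sum_(i < m) c i * u' ^+ i * v' ^+ (m - i) = 0.
  apply: (mulIf (expf_neq0 m d0)); rewrite mul0r -[RHS]e mulrDl du dv exprMn.
  congr (_ + _); rewrite mulr_suml; apply: eq_bigr => i _.
  rewrite !exprMn -!mulrA; congr (_ * (_ * _)); rewrite mulrCA; congr (_ * _).
  by rewrite -exprD subnKC // ltnW.
have : v' %| u' ^+ m.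
  have -> : u' ^+ m = - \sum_(i < m) c i * u' ^+ i * v' ^+ (m - i).
    by apply/eqP; rewrite -subr_eq0 opprK e'.
  rewrite dvdpNr; elim/big_ind: _ => [|x y|i _]; [exact: dvdp0 | exact: dvdp_add |].
  apply: dvdp_mull; have := ltn_ord i; rewrite -subn_gt0.
  by case: (m - i)%N => // k _; rewrite exprS dvdp_mulIl.
rewrite -[u' ^+ m]mulr1 Gauss_dvdpr; last by rewrite coprimep_sym coprimep_expl.
rewrite dvdp1 => /size_poly1P[a a0 va]; exists (a^-1 *: u').
by rewrite [LHS]du dv va -!mul_polyC mulrACA -polyCM mulVf // mul1r mulrC.
Qed.

(** * Relative algebraic closedness in an ultraproduct *)

(** The predicate [P] keeps numerators and denominators in a chosen subset: polynomials over [E] in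
    one use, no condition in the other. *)
Lemma common_denominator (R : comNzRingType) (K : fieldType)
    (phi : {rmorphism R -> K}) (P : R -> Prop) :
  P 1 -> (forall a b, P a -> P b -> P (a * b)) ->
  forall n (c : nat -> K),
    (forall i, (i < n)%N ->
      exists a b, [/\ P a, P b, phi b != 0 & c i = phi a / phi b]) ->
  exists b (A : nat -> R), [/\ P b, phi b != 0 &
    forall i, (i < n)%N -> P (A i) /\ phi (A i) = c i * phi b].
Proof.
move=> P1 PM; elim=> [|n IH] c h.
  by exists 1, (fun=> 1); rewrite rmorph1 oner_neq0; split.
have [i ilt|b [A [Pb b0 hA]]] := IH c; first by apply: h; apply: ltnW.
have [a [d [Pa Pd d0 cn]]] := h n (ltnSn n).
exists (b * d), (fun i => if i == n then a * b else A i * d).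
split; [exact: PM | by rewrite rmorphM mulf_neq0 |].
move=> i; rewrite ltnS leq_eqVlt; case: eqP => [->|_] /=.
  by split; [apply: PM | rewrite !rmorphM cn; field].
by move=> /hA[PA e]; split; [apply: PM | rewrite !rmorphM e mulrA].
Qed.

Section Ulimset.
Context (T : Type) (U : set_system T) (FU : UltraFilter U).
Context (K_ : T -> closedFieldType).
Local Notation K := (ufield FU K_).
Local Notation lim := (@ulimf T U FU K_).

Definition ulimset (E_ : forall t, set (K_ t)) : set K :=
  [set z | exists2 x, lim x = z & \forall t \near U, E_ t (x t)].

Lemma ulimset_subfield E_ : (forall t, subfield (E_ t)) -> subfield (ulimset E_).
Proof.
move=> sE; split.
- exists (fun=> 1); first exact: ulimf1.
  by apply: filterE => t; apply: subfield1.
- move=> _ _ [x <- Ex] [y <- Ey]; exists (fun t => x t - y t); first exact: ulimfB.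
  by apply: filterS2 Ex Ey => t; apply: subfieldB.
- move=> _ _ [x <- Ex] [y <- Ey]; exists (fun t => x t / y t).
    by rewrite ulimfM ulimfV.
  by apply: filterS2 Ex Ey => t; apply: subfield_div.
Qed.

(** The bound on sizes makes evaluation a sum of fixed length, so that it commutes with the limit
    ([papx_horner]). *)
Definition papx (f : {poly K}) (f_ : forall t, {poly K_ t}) : Prop :=
  (exists B, \forall t \near U, (size (f_ t) <= B)%N) /\
  forall i, f`_i = lim (fun t => (f_ t)`_i).

Lemma papx_size f f_ B : papx f f_ -> (\forall t \near U, (size (f_ t) <= B)%N) ->
  (size f <= B)%N.
Proof.
move=> [_ h] hB; apply/leq_sizeP => i iB; rewrite h; apply/ulimf_eq0.
by apply: filterS hB => t hB; rewrite nth_default // (leq_trans hB).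
Qed.

Lemma papx_of_bound B (f_ : forall t, {poly K_ t}) :
  (\forall t \near U, (size (f_ t) <= B)%N) ->
  papx (\poly_(i < B) lim (fun t => (f_ t)`_i)) f_.
Proof.
move=> hB; split=> [|i]; first by exists B.
rewrite coef_poly; case: ltnP => // iB; apply/esym/ulimf_eq0.
by apply: filterS hB => t hB; rewrite nth_default // (leq_trans hB).
Qed.

Lemma papx_lift E_ f : (forall t, subfield (E_ t)) -> polyin (ulimset E_) f ->
  exists f_, [/\ papx f f_, forall t, (size (f_ t) <= size f)%N
    & \forall t \near U, polyin (E_ t) (f_ t)].
Proof.
move=> sE Ef; pose c i := s2val (cid2 (Ef i)).
have cf i : lim (c i) = f`_i := s2valP (cid2 (Ef i)).
have Ec i : \forall t \near U, E_ t (c i t) := s2valP' (cid2 (Ef i)).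
exists (fun t => \poly_(i < size f) c i t); split.
- split; first by exists (size f); apply: filterE => t; apply: size_poly.
  move=> i; case: (ltnP i (size f)) => iB; last first.
    rewrite nth_default //; apply/esym/ulimf_eq0; apply: filterE => t.
    by rewrite coef_poly ltnNge iB.
  by rewrite -cf; apply/ulimfP; apply: filterE => t; rewrite coef_poly iB.
- by move=> t; apply: size_poly.
- have : \forall t \near U, forall i : 'I_(size f), E_ t (c i t).
    by apply: filter_forall.
  apply: filterS => t h i; rewrite coef_poly; case: ltnP => [iB|_].
    exact: (h (Ordinal iB)).
  exact: subfield0.
Qed.

Lemma papx_eq f g f_ g_ : papx f f_ -> papx g g_ ->
  (\forall t \near U, f_ t = g_ t) -> f = g.
Proof.
move=> [_ hf] [_ hg] h; apply/polyP => i; rewrite hf hg; apply/ulimfP.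
by apply: filterS h => t ->.
Qed.

Lemma papx0 : papx 0 (fun=> 0).
Proof.
split; first by exists 0; apply: filterE => t; rewrite size_poly0.
by move=> i; rewrite coef0; apply/esym/ulimf_eq0; apply: filterE => t; rewrite coef0.
Qed.

Lemma papx1 : papx 1 (fun=> 1).
Proof.
split; first by exists 1; apply: filterE => t; rewrite size_poly1.
move=> i; rewrite coef1; case: eqP => /= i0.
  by rewrite -[LHS](@ulimf1 _ _ FU K_); apply/ulimfP; apply: filterE => t; rewrite coef1 i0.
apply/esym/ulimf_eq0; apply: filterE => t; rewrite coef1; by move/eqP/negPf: i0 => ->.
Qed.

Lemma papxD f g f_ g_ : papx f f_ -> papx g g_ -> papx (f + g) (fun t => f_ t + g_ t).
Proof.
move=> [[A hA] hf] [[B hB] hg]; split.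
  exists (maxn A B); apply: filterS2 hA hB => t hA hB.
  apply: leq_trans (size_polyD _ _) _.
  by rewrite geq_max !leq_max hA hB orbT.
move=> i; rewrite coefD hf hg -ulimfD; apply/ulimfP; apply: filterE => t.
by rewrite coefD.
Qed.

Lemma papxM f g f_ g_ : papx f f_ -> papx g g_ -> papx (f * g) (fun t => f_ t * g_ t).
Proof.
move=> [[A hA] hf] [[B hB] hg]; split.
  exists (A + B)%N; apply: filterS2 hA hB => t hA hB.
  apply: leq_trans (size_polyMleq _ _) _.
  by rewrite (leq_trans (leq_pred _)) // leq_add.
move=> i; rewrite coefM.
under eq_bigr do rewrite hf hg -ulimfM.
by rewrite -ulimf_sum; apply/ulimfP; apply: filterE => t; rewrite coefM.
Qed.

Lemma papxX f f_ n : papx f f_ -> papx (f ^+ n) (fun t => f_ t ^+ n).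
Proof.
move=> h; elim: n => [|n IH]; first by rewrite expr0; apply: papx1.
rewrite exprS.
have -> : (fun t => f_ t ^+ n.+1) = (fun t => f_ t * f_ t ^+ n).
  by apply: functional_extensionality_dep => t; rewrite exprS.
exact: papxM.
Qed.

Lemma papx_sum (I : Type) (r : seq I) (F : I -> {poly K}) F_ :
  (forall i, papx (F i) (F_ i)) ->
  papx (\sum_(i <- r) F i) (fun t => \sum_(i <- r) F_ i t).
Proof.
move=> h; elim: r => [|i r IH].
  rewrite big_nil; have -> // : (fun t => \sum_(i <- [::]) F_ i t) = fun=> 0.
    by apply: functional_extensionality_dep => t; rewrite big_nil.
  exact: papx0.
rewrite big_cons.
have -> : (fun t => \sum_(j <- i :: r) F_ j t) =
          (fun t => F_ i t + \sum_(j <- r) F_ j t).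
  by apply: functional_extensionality_dep => t; rewrite big_cons.
exact: papxD.
Qed.

Lemma papx_horner f f_ x : papx f f_ -> f.[lim x] = lim (fun t => (f_ t).[x t]).
Proof.
move=> h; have [[B hB] hf] := h.
rewrite (horner_coef_wide _ (papx_size h hB)).
under eq_bigr do rewrite hf -ulimfX -ulimfM.
rewrite -ulimf_sum; apply/ulimfP; apply: filterS hB => t hB.
by rewrite (horner_coef_wide _ hB).
Qed.

Context (E_ : forall t, set (K_ t)) (E : set K).
Arguments E_ : clear implicits.
Hypothesis sE_ : forall t, subfield (E_ t).
Hypothesis sE : subfield E.
Hypothesis sub : E `<=` ulimset E_.

Definition rel_alg_closed (E'_ : forall t, set (K_ t)) (E' : set K) : Prop :=
  forall z, ulimset E'_ z -> algin E' z -> E' z.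

Hypothesis rac : rel_alg_closed E_ E.
Hypothesis char0 : [pchar K] =i pred0.

Let polyin_sub f : polyin E f -> polyin (ulimset E_) f.
Proof. by move=> h i; apply: sub. Qed.

Let sL : subfield (ulimset E_) := ulimset_subfield sE_.

(* The coefficients of the minimal polynomial over the ultraproduct are
   polynomials in roots of [g], hence algebraic over [E], hence in [E]. *)
Lemma rac_minpoly g z : minpoly_in E g z -> minpoly_in (ulimset E_) g z.
Proof.
move=> gz; have [Eg mg rg gmin] := gz.
have [|g' [Eg' mg' rg' gmin']] := @minpoly_exists _ _ sL z.
  by exists g; split; [apply: polyin_sub | apply: monic_neq0 |].
have g'g : g' %| g by apply: gmin' => //; apply: polyin_sub.
have {}Eg' : polyin E g'.
  have sA := algin_subfield sE.
  suff Ag : polyin (algin E) g' by move=> i; apply: rac.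
  have [rs e] := closed_field_poly_normal g'.
  have : forall r, r \in rs -> algin E r.
    move=> r rr; exists g; split=> //; first exact: monic_neq0.
    rewrite -dvdp_XsubCl; apply: dvdp_trans g'g; rewrite e (monicP mg') scale1r (big_rem r) //=.
    exact: dvdp_mulIl.
  rewrite e (monicP mg') scale1r; elim: rs {e} => [|r rs IH] h.
    by rewrite big_nil; apply: polyin1.
  rewrite big_cons; apply: polyinM => //; last first.
    by apply: IH => s ss; apply: h; rewrite inE ss orbT.
  apply: polyinD => //; first exact: polyinX.
  by apply: polyinN => //; apply: polyinC => //; apply: h; rewrite mem_head.
split=> //; first exact: polyin_sub.
by move=> q Eq rq; apply: dvdp_trans (gmin _ Eg' rg') (gmin' _ Eq rq).
Qed.

(** After scaling, [z] becomes an element [y] integral over [E[tau]]. In each factor [E_ t [tau t]]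
    is a polynomial ring, hence integrally closed, so [y_ t] is a polynomial in [tau t] of bounded
    degree. The limit polynomial [w] inherits the monic equation, which specializes at integers and
    puts those values of [w] into [E]. *)
Lemma rac_trans (tau : forall t, K_ t) :
  (\forall t \near U, forall p, polyin (E_ t) p -> root p (tau t) -> p = 0) ->
  rel_alg_closed (fun t => ratext (E_ t) (tau t)) (ratext E (lim tau)).
Proof.
move=> trtau z Lz [q [Eq q0 rq]].
have sq := root_size_gt1 q0 rq.
pose m := (size q).-1.
have sqm : size q = m.+1 by rewrite /m prednK // ltnW.
have m0 : (0 < m)%N by rewrite -ltnS -sqm.
have [||i _|b [A [Eb b0 hA]]] := @common_denominator _ _ (horner_eval (lim tau))
  (polyin E) _ _ (size q) (fun i => q`_i).
- exact: polyin1.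
- by move=> a b; apply: polyinM.
- have [a [b [Ea Eb b0 e]]] := Eq i.
  by exists a, b; split.
have {}b0 : b.[lim tau] != 0 := b0.
have {}hA i : (i <= m)%N -> polyin E (A i) /\ (A i).[lim tau] = q`_i * b.[lim tau].
  by rewrite -ltnS -sqm => /hA.
have Am0 : (A m).[lim tau] != 0.
  rewrite (proj2 (hA m (leqnn m))) mulf_neq0 //.
  by have := q0; rewrite -lead_coef_eq0 lead_coefE.
(* Multiplying the equation of [z] by the power [m.-1] of its leading coefficient makes it monic in
   [y], with coefficients [c i]. *)
pose y := (A m).[lim tau] * z.
pose c (i : 'I_m) := A i * A m ^+ (m.-1 - i).
have Ec i : polyin E (c i).
  apply: polyinM => //; first by apply: (proj1 (hA _ _)); apply: ltnW.
  by apply: polyinXn => //; apply: (proj1 (hA _ _)).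
have ey : y ^+ m + \sum_(i < m) (c i).[lim tau] * y ^+ i = 0.
  have e : \sum_(i < m.+1) (A i).[lim tau] * z ^+ i = 0.
    have := rootP rq; rewrite horner_coef sqm => /(congr1 (fun x => x * b.[lim tau])).
    rewrite mul0r mulr_suml => e; rewrite -[RHS]e; apply: eq_bigr => i _.
    have im : (i <= m)%N by rewrite -ltnS.
    by rewrite (proj2 (hA i im)) mulrAC.
  transitivity ((A m).[lim tau] ^+ m.-1 * \sum_(i < m.+1) (A i).[lim tau] * z ^+ i).
    rewrite big_ord_recr /= mulrDr addrC mulr_sumr; congr (_ + _).
      apply: eq_bigr => i _; rewrite /c /y hornerM horner_exp exprMn.
      have e2 : m.-1 = (m.-1 - i + i)%N by rewrite subnK // -ltnS prednK.
      rewrite [in RHS]e2 exprD.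
      move: (A i).[lim tau] (_ ^+ (m.-1 - i)) ((A m).[lim tau] ^+ i) (z ^+ i) => x1 x2 x3 x4.
      by rewrite -!mulrA mulrCA; congr (_ * _); rewrite mulrCA.
    by rewrite mulrA -exprSr prednK // /y exprMn.
  by rewrite e mulr0.
have Ly : ulimset (fun t => ratext (E_ t) (tau t)) y.
  have sL' := @ulimset_subfield (fun t => ratext (E_ t) (tau t))
    (fun t => ratext_subfield (tau t) (sE_ t)).
  apply: subfieldM => //; apply: polyin_horner => //.
    move=> i; have [x <- Ex] := sub (proj1 (hA m (leqnn m)) i).
    by exists x => //; apply: filterS Ex => t; apply: ratext_sub.
  by exists tau => //; apply: filterE => t; apply: ratext_gen.
have [y_ yE y_in] := Ly.
pose c_ i := sval (cid (papx_lift sE_ (polyin_sub (Ec i)))).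
have [cpapx csize cin] : [/\ forall i, papx (c i) (c_ i),
    forall i t, (size (c_ i t) <= size (c i))%N
  & forall i, \forall t \near U, polyin (E_ t) (c_ i t)].
  by split=> i; rewrite /c_; case: cid => ? [].
have {}cin : \forall t \near U, forall i, polyin (E_ t) (c_ i t).
  by apply: filter_forall.
pose B := \max_(i < m) size (c i).
have cB i t : (size (c_ i t) <= B)%N.
  by apply: leq_trans (csize i t) _; rewrite /B (bigD1 i) //= leq_maxl.
have ey_ : \forall t \near U, y_ t ^+ m + \sum_(i < m) (c_ i t).[tau t] * y_ t ^+ i = 0.
  apply/ulimf_eq0; rewrite ulimfD ulimfX ulimf_sum yE -[RHS]ey; congr (_ + _).
  by apply: eq_bigr => i _; rewrite (papx_horner _ (cpapx i)) ulimfM ulimfX yE.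
have : \forall t \near U, exists w, [/\ polyin (E_ t) w, (size w <= B.+1)%N,
    w ^+ m + \sum_(i < m) c_ i t * w ^+ i = 0 & y_ t = w.[tau t]].
  have cintr : \forall t \near U, (forall i, polyin (E_ t) (c_ i t)) /\
      forall p, polyin (E_ t) p -> root p (tau t) -> p = 0.
    exact: filterI cin trtau.
  apply: filterS3 ey_ y_in cintr => t ey_t [u [v [Eu Ev v0 yuv]]] [cint tr].
  have vn0 : v != 0 by apply: contraNneq v0 => ->; rewrite horner0.
  (* The equation of [y_ t] at [tau t], cleared of denominators, is an identity of polynomials
     because [tau t] is transcendental over [E_ t]. *)
  have e : u ^+ m + \sum_(i < m) c_ i t * u ^+ i * v ^+ (m - i) = 0.
    apply: tr.
      apply: polyinD => //; first exact: polyinXn.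
      apply: polyin_sum => // i _.
      by apply: polyinM => //; [apply: polyinM => //|]; apply: polyinXn.
    rewrite rootE hornerD horner_exp horner_sum.
    have uy : u.[tau t] = y_ t * v.[tau t] by rewrite yuv divfK.
    rewrite uy; apply/eqP; transitivity ((y_ t ^+ m + \sum_(i < m) (c_ i t).[tau t] * y_ t ^+ i)
      * v.[tau t] ^+ m); last by rewrite ey_t mul0r.
    rewrite mulrDl exprMn; congr (_ + _); rewrite mulr_suml; apply: eq_bigr => i _.
    rewrite !hornerM !horner_exp uy exprMn -!mulrA; congr (_ * (_ * _)).
    by rewrite -exprD subnKC // ltnW.
  have [w [uw sw ew]] := integral_ratio_poly vn0 (fun i => cB i t) e.
  exists w; split=> //; last by rewrite yuv uw hornerM mulfK.
  by rewrite -(mulpK w vn0) -uw; apply: polyin_divp.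
move=> hw; pose w_ t := if pselect (exists w, [/\ polyin (E_ t) w, (size w <= B.+1)%N,
    w ^+ m + \sum_(i < m) c_ i t * w ^+ i = 0 & y_ t = w.[tau t]])
  is left h then sval (cid h) else 0.
have {}hw : \forall t \near U, [/\ polyin (E_ t) (w_ t), (size (w_ t) <= B.+1)%N,
    w_ t ^+ m + \sum_(i < m) c_ i t * w_ t ^+ i = 0 & y_ t = (w_ t).[tau t]].
  by apply: filterS hw => t h; rewrite /w_; case: pselect => // h'; case: cid.
have sw : \forall t \near U, (size (w_ t) <= B.+1)%N by apply: filterS hw => t [].
have pw := papx_of_bound sw.
set w := \poly_(i < B.+1) _ in pw.
have Lw : polyin (ulimset E_) w.
  move=> i; have [_ ->] := pw; exists (fun t => (w_ t)`_i) => //.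
  by apply: filterS hw => t [h _ _ _]; apply: h.
have ew : w ^+ m + \sum_(i < m) c i * w ^+ i = 0.
  apply: (papx_eq (f_ := fun t => w_ t ^+ m + \sum_(i < m) c_ i t * w_ t ^+ i) _ papx0).
    apply: papxD; first exact: papxX.
    by apply: papx_sum => i; apply: papxM => //; apply: papxX.
  by apply: filterS hw => t [].
have yw : y = w.[lim tau].
  rewrite (papx_horner _ pw) -yE; apply/ulimfP.
  by apply: filterS hw => t [].
have Ew : polyin E w.
  (* The nodes are distinct in characteristic 0. The value of [w] at a node lies in the ultraproduct
     of the [E_ t] and is a root of a monic polynomial over [E], so [rac] applies to it. *)
  apply: (@polyin_interp _ _ sE [seq k%:R | k <- iota 0 B.+1]).
  - have inj i j : (i <= j)%N -> i%:R = j%:R :> K -> i = j.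
      move=> ij /eqP; rewrite eq_sym -subr_eq0 -natrB //.
      by rewrite (iffLR (pcharf0P _) char0) subn_eq0 => ji; apply/eqP; rewrite eqn_leq ij.
    rewrite map_inj_in_uniq ?iota_uniq // => i j _ _ e.
    by case: (leqP i j) => [|/ltnW] h; [|symmetry]; apply: inj.
  - by rewrite size_map size_iota size_poly.
  - move=> _ /mapP[k _ ->]; have Ek : E k%:R by apply: subfield_nat.
    split=> //; apply: rac.
      by apply: polyin_horner => //; apply: sub.
    exists ('X^m + \sum_(i < m) (c i).[k%:R] *: 'X^i); split.
    + apply: polyinD => //; first by apply: polyinXn => //; apply: polyinX.
      apply: polyin_sum => // i _; rewrite -mul_polyC.
      apply: polyinM => //; first by apply: polyinC => //; apply: polyin_horner.
      by apply: polyinXn => //; apply: polyinX.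
    + apply/eqP => /(congr1 (fun p : {poly _} => p`_m)) /eqP.
      rewrite coefD coefXn eqxx coef_sum coef0 big1 ?addr0 ?oner_eq0 // => i _.
      by rewrite coefZ coefXn eq_sym ltn_eqF // mulr0.
    + have := congr1 (horner^~ k%:R) ew.
      rewrite hornerD horner_exp horner_sum horner0 => e.
      rewrite rootE hornerD hornerXn horner_sum; apply/eqP; rewrite -[RHS]e.
      congr (_ + _); apply: eq_bigr => i _.
      by rewrite hornerZ hornerXn (hornerM (c i) (w ^+ i)) (horner_exp w).
exists w, (A m); split=> //; first by apply: (proj1 (hA _ _)).
by rewrite -yw /y mulrAC divff // mul1r.
Qed.

(** In each factor [z_ t] is a polynomial in [theta t] shorter than [g], so [z] is the value at
    [lim theta] of a limit polynomial [Z]. If [q] over [E] kills [z], then [g] divides [q \Po Z],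
    since [g] is minimal even over the ultraproduct of the [E_ t]. So [Z] maps every conjugate of
    [lim theta] to a root of [q], and interpolation at the conjugates makes the coefficients of [Z]
    algebraic over [E]; by [rac] they lie in [E]. *)
Lemma rac_alg (theta : forall t, K_ t) : algin E (lim theta) ->
  rel_alg_closed (fun t => ratext (E_ t) (theta t)) (ratext E (lim theta)).
Proof.
move=> alg z Lz algz.
have sA := algin_subfield sE.
have [g gmin] := minpoly_exists sE alg; have [Eg mg rg _] := gmin.
have [_ _ _ gminL] := rac_minpoly gmin.
have g0 := monic_neq0 mg.
have [rs [urs grs]] := minpoly_roots char0 sE gmin.
have [g_ [pg sg Eg_]] := papx_lift sE_ (polyin_sub Eg).
have [z_ zE z_in] := Lz.
have rg_ : \forall t \near U, root (g_ t) (theta t).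
  move/rootP: rg; rewrite (papx_horner _ pg) => /ulimf_eq0.
  by apply: filterS => t /rootP.
have g0_ : \forall t \near U, g_ t <> 0.
  apply/ultra_notP => h; move/eqP: g0; apply.
  exact: (papx_eq pg papx0).
have : \forall t \near U, exists Z, [/\ polyin (E_ t) Z, (size Z < size g)%N
    & z_ t = Z.[theta t]].
  have rg0 : \forall t \near U, root (g_ t) (theta t) /\ g_ t <> 0.
    exact: filterI rg_ g0_.
  apply: filterS3 rg0 Eg_ z_in => t [rgt /eqP g0t] Egt zt.
  have [Z EZ [sZ e]] := ratext_poly (sE_ t) Egt g0t rgt zt.
  by exists Z; split=> //; apply: leq_trans (sg t).
move=> hZ; pose Z_ t := if pselect (exists Z, [/\ polyin (E_ t) Z,
    (size Z < size g)%N & z_ t = Z.[theta t]]) is left h then sval (cid h) else 0.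
have {}hZ : \forall t \near U, [/\ polyin (E_ t) (Z_ t), (size (Z_ t) < size g)%N
    & z_ t = (Z_ t).[theta t]].
  by apply: filterS hZ => t h; rewrite /Z_; case: pselect => // h'; case: cid.
have sgrs : size g = (size rs).+1 by rewrite grs size_prod_XsubC.
have sZ : \forall t \near U, (size (Z_ t) <= size rs)%N.
  by apply: filterS hZ => t [_]; rewrite sgrs ltnS.
have pZ := papx_of_bound sZ.
set Z := \poly_(i < size rs) _ in pZ.
have LZ : polyin (ulimset E_) Z.
  move=> i; have [_ ->] := pZ; exists (fun t => (Z_ t)`_i) => //.
  by apply: filterS hZ => t [h _ _]; apply: h.
have zZ : z = Z.[lim theta].
  rewrite (papx_horner _ pZ) -zE; apply/ulimfP.
  by apply: filterS hZ => t [].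
(* All of [E(lim theta)] is algebraic over [E], so by transitivity the equation of [z] may be taken
   over [E]. *)
have {}algz : algin E z.
  have [q [Eq q0 rq]] := algz; apply: (algin_trans sE (p := q)) => // i.
  have [a [b [Ea Eb _ ->]]] := Eq i.
  by apply: subfield_div => //; apply: polyin_horner => // j; apply: algin_id.
have [q [Eq q0 rq]] := algz.
have dv : g %| q \Po Z.
  apply: gminL; first by apply: polyin_comp => //; apply: polyin_sub.
  by rewrite rootE horner_comp -zZ.
have AZ : polyin (algin E) Z.
  apply: (@polyin_interp _ _ sA rs) => //; first exact: size_poly.
  move=> r rr; have rr' : root g r by rewrite grs root_prod_XsubC.
  split; first by exists g.
  exists q; split=> //.
  have : 'X - r%:P %| q \Po Z by apply: dvdp_trans dv; rewrite dvdp_XsubCl.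
  by rewrite dvdp_XsubCl rootE horner_comp.
exists Z, 1; rewrite !hornerE oner_neq0 ?divr1 ?invr1 ?mulr1; split=> //.
- by move=> i; apply: rac.
- exact: polyin1.
Qed.

End Ulimset.

(** * Elements avoiding countably many polynomials *)

Section Saturation.
Context (U : set_system prime_number) (FU : UltraFilter U).
Hypothesis U_nonprincipal : forall p : prime_number, ~ U [set p].

(** Each single prime is negligible, hence so are the finitely many primes below [i]. *)
Lemma nonprincipal_ge (i : nat) : \forall s \near U, (i <= val s)%N.
Proof.
elim: i => [|i IH]; first exact: filterE.
have ni : \forall s \near U, val s <> i.
  apply/ultra_notP => h; case: (ultra_dec (fun=> prime i)) => [pi|npi].
    have pi' : prime i by have [s] := filter_ex pi.
    apply: (@U_nonprincipal (exist _ i pi')); apply: filterS h => s si.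
    exact: val_inj.
  apply: (@ultra_false _ U); apply: filterS2 h npi => s <-; apply.
  exact: (valP s).
by apply: filterS2 IH ni => s; rewrite leq_eqVlt => /orP[/eqP -> //|].
Qed.

Context (F : closedFieldType).
Local Notation K := (ufield FU (fun=> F)).

Lemma countable_nonroot (Q : nat -> {poly K}) :
  exists tau : K, forall i, root (Q i) tau -> Q i = 0.
Proof.
have sT : subfield [set: F] by [].
have lift i : polyin (ulimset (FU := FU) (fun=> [set: F])) (Q i).
  by move=> j; have [x <-] := ulimf_surj ((Q i)`_j); exists x => //; apply: filterE.
pose Q_ i := sval (cid (papx_lift (fun=> sT) (lift i))).
have pQ i : papx (Q i) (Q_ i) by rewrite /Q_; case: cid => ? [].
(* [tau] at [s] avoids the roots of the first [s + 1] polynomials, and every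
   index [i] is at most [s] for almost all primes [s]. *)
pose P s := \prod_(j < (val s).+1) (if Q_ j s == 0 then 1 else Q_ j s).
have P0 s : P s != 0.
  by apply/prodf_neq0 => j _; case: ifP => [_|->] //; rewrite oner_neq0.
pose tau s := sval (cid (elimT (closed_nonrootP (P s)) (P0 s))).
have tauP s : ~~ root (P s) (tau s) by rewrite /tau; case: cid.
exists (ulimf FU tau) => i /rootP; rewrite (papx_horner _ (pQ i)) => /ulimf_eq0 h.
apply: (papx_eq (pQ i) (@papx0 _ U FU (fun=> F))).
apply: filterS2 h (nonprincipal_ge i) => s r si.
apply/eqP; apply: contraNT (tauP s) => nz.
have -> : P s = \prod_(j < (val s).+1 | true) (if Q_ j s == 0 then 1 else Q_ j s) by [].
rewrite (bigD1 (inord i)) //= inordK ?ltnS // (negPf nz) rootM.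
by apply/orP; left; apply/rootP.
Qed.

End Saturation.

(** * Approximations of multivariate polynomials *)

Section Approx.
Context (T : Type) (U : set_system T) (FU : UltraFilter U).
Context (F_ : T -> closedFieldType) (K : fieldType).
Context (a : {rmorphism K -> ufield FU F_}).
Local Notation lim := (@ulimf T U FU F_).

Section Fixed.
Context (n : nat).

(* Without the degree bound, monomials of degree growing with [t] would be
   invisible in the limit. *)
Definition apx (f : {mpoly K[n]}) (f_ : forall t, {mpoly (F_ t)[n]}) : Prop :=
  (exists d, \forall t \near U, (msize (f_ t) <= d)%N) /\
  forall m, a f@_m = lim (fun t => (f_ t)@_m).

(** A fixed choice of approximation, supported on the monomials of [f]. For fixed [t] it is not a
    ring morphism; it respects each given identity for almost all [t], by uniqueness of
    approximations. *)
Definition ap (t : T) (f : {mpoly K[n]}) : {mpoly (F_ t)[n]} :=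
  \sum_(m <- msupp f) sval (ufield_surj (a f@_m)) t *: 'X_[m].

Lemma ap_coef t f m :
  (ap t f)@_m = if m \in msupp f then sval (ufield_surj (a f@_m)) t else 0.
Proof.
rewrite /ap raddf_sum /=; case: ifP => [mf|/negP mf].
  rewrite (big_rem m) //= mcoeffZ mcoeffX eqxx mulr1 big_seq_cond big1 ?addr0 //.
  move=> k; rewrite andbT mem_rem_uniq ?msupp_uniq // inE => /andP[/negPf km _].
  by rewrite mcoeffZ mcoeffX km mulr0.
rewrite big_seq_cond big1 // => k; rewrite andbT => kf.
rewrite mcoeffZ mcoeffX; case: eqP => [km|_]; last by rewrite mulr0.
by rewrite -km kf in mf.
Qed.

Lemma ap_supp t f : {subset msupp (ap t f) <= msupp f}.
Proof. by move=> m; rewrite mcoeff_msupp ap_coef; case: ifP; rewrite ?eqxx. Qed.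

Lemma ap0 t : ap t 0 = 0.
Proof. by apply/mpolyP => m; rewrite ap_coef mcoeff_msupp !mcoeff0 eqxx. Qed.

Lemma apx_ap f : apx f (ap ^~ f).
Proof.
split=> [|m].
  exists (msize f); apply: filterE => t; rewrite [X in (X <= _)%N]msizeE.
  by apply/bigmax_leqP_seq => m /ap_supp mf _; apply: msize_mdeg_lt.
transitivity (if m \in msupp f then a f@_m else 0).
  by case: ifPn => // /memN_msupp_eq0 ->; rewrite rmorph0.
case: ifP => mf.
  rewrite -[LHS](svalP (ufield_surj (a f@_m))); apply/ulimfP; apply: filterE => t.
  by rewrite ap_coef mf.
by apply/esym/ulimf_eq0; apply: filterE => t; rewrite ap_coef mf.
Qed.

Lemma apx_supp f f_ : (\forall t \near U, {subset msupp (f_ t) <= msupp f}) ->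
  (forall m, a f@_m = lim (fun t => (f_ t)@_m)) -> apx f f_.
Proof.
move=> h hc; split=> //; exists (msize f); apply: filterS h => t h.
rewrite [X in (X <= _)%N]msizeE.
by apply/bigmax_leqP_seq => m /h mf _; apply: msize_mdeg_lt.
Qed.

(** The degree bounds leave finitely many monomials to compare, and finitely many conditions valid
    for almost all [t] hold simultaneously. *)
Lemma apx_uniq f f_ g_ : apx f f_ -> apx f g_ -> \forall t \near U, f_ t = g_ t.
Proof.
move=> [[d hd] hf] [[e he] hg].
have : \forall t \near U, forall m : 'X_{1..n < maxn d e}, (f_ t)@_m = (g_ t)@_m.
  by apply: filter_forall => m; apply/ulimfP; rewrite -hf -hg.
apply: filterS3 hd he => t hd he h; apply/mpolyP => m.
case: (ltnP (mdeg m) (maxn d e)) => [mB|]; first exact: (h (BMultinom mB)).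
rewrite geq_max => /andP[md me].
by rewrite !memN_msupp_eq0 // msize_mdeg_ge // (leq_trans hd, leq_trans he).
Qed.

Lemma apx_near f f_ : apx f f_ -> \forall t \near U, f_ t = ap t f.
Proof. by move=> h; apply: apx_uniq h (apx_ap f). Qed.

Lemma apx_inj f g f_ g_ : apx f f_ -> apx g g_ ->
  (\forall t \near U, f_ t = g_ t) -> f = g.
Proof.
move=> [_ hf] [_ hg] h; apply/mpolyP => m; apply: (fmorph_inj a).
by rewrite hf hg; apply/ulimfP; apply: filterS h => t ->.
Qed.

Lemma apx_C c c_ : a c = lim c_ -> apx c%:MP (fun t => (c_ t)%:MP).
Proof.
move=> h; split.
  exists 1; apply: filterE => t; rewrite msizeC; by case: eqP.
move=> m; rewrite mcoeffC rmorphM rmorph_nat h.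
case: eqP => /= [->|m0].
  by rewrite mulr1; apply/ulimfP; apply: filterE => t; rewrite mcoeffC eqxx mulr1.
rewrite mulr0; apply/esym/ulimf_eq0; apply: filterE => t.
by rewrite mcoeffC; move/eqP/negPf: m0 => ->; rewrite mulr0.
Qed.

Lemma apx_0 : apx 0 (fun=> 0).
Proof.
rewrite -mpolyC0; apply: apx_C.
by rewrite rmorph0; apply/esym/ulimf_eq0; apply: filterE.
Qed.

Lemma apx_1 : apx 1 (fun=> 1).
Proof. by rewrite -mpolyC1; apply: apx_C; rewrite rmorph1 -ulimf1. Qed.

Lemma apx_D f g f_ g_ : apx f f_ -> apx g g_ -> apx (f + g) (fun t => f_ t + g_ t).
Proof.
move=> [[d hd] hf] [[e he] hg]; split.
  exists (maxn d e); apply: filterS2 hd he => t hd he.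
  apply: leq_trans (msizeD_le _ _) _.
  by rewrite geq_max !leq_max hd he orbT.
move=> m; rewrite mcoeffD rmorphD hf hg -ulimfD; apply/ulimfP; apply: filterE => t.
by rewrite mcoeffD.
Qed.

Lemma apx_N f f_ : apx f f_ -> apx (- f) (fun t => - f_ t).
Proof.
move=> [[d hd] hf]; split.
  by exists d; apply: filterS hd => t; rewrite msizeN.
move=> m; rewrite mcoeffN rmorphN hf -ulimfN; apply/ulimfP; apply: filterE => t.
by rewrite mcoeffN.
Qed.

Lemma apx_B f g f_ g_ : apx f f_ -> apx g g_ -> apx (f - g) (fun t => f_ t - g_ t).
Proof. by move=> hf hg; apply: apx_D => //; apply: apx_N. Qed.

Lemma apx_M f g f_ g_ : apx f f_ -> apx g g_ -> apx (f * g) (fun t => f_ t * g_ t).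
Proof.
move=> [[d hd] hf] [[e he] hg]; split.
  exists (d + e).+1; apply: filterS2 hd he => t hd he.
  apply: leq_trans (msizeM_le _ _) _.
  by rewrite ltnS leq_add.
move=> m; rewrite mcoeffM rmorph_sum.
under eq_bigr do rewrite rmorphM hf hg -ulimfM.
by rewrite -ulimf_sum; apply/ulimfP; apply: filterE => t; rewrite mcoeffM.
Qed.

Lemma apx_X m : apx 'X_[m] (fun t => 'X_[m]).
Proof.
split; first by exists (mdeg m).+1; apply: filterE => t; rewrite msizeX.
move=> k; rewrite mcoeffX rmorph_nat; case: eqP => /= h.
  by rewrite -[LHS](@ulimf1 _ _ FU F_); apply/ulimfP; apply: filterE => t; rewrite mcoeffX h eqxx.
apply/esym/ulimf_eq0; apply: filterE => t.
by rewrite mcoeffX; move/eqP/negPf: h => ->.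
Qed.

Lemma apx_exp f f_ k : apx f f_ -> apx (f ^+ k) (fun t => f_ t ^+ k).
Proof.
move=> h; elim: k => [|k IH]; first by rewrite expr0; apply: apx_1.
rewrite exprS; have -> : (fun t => f_ t ^+ k.+1) = (fun t => f_ t * f_ t ^+ k).
  by apply: functional_extensionality_dep => t; rewrite exprS.
exact: apx_M.
Qed.

Lemma apx_sum (I : Type) (r : seq I) (f : I -> {mpoly K[n]}) f_ :
  (forall i, apx (f i) (f_ i)) ->
  apx (\sum_(i <- r) f i) (fun t => \sum_(i <- r) f_ i t).
Proof.
move=> h; elim: r => [|i r IH].
  rewrite big_nil; have -> // : (fun t => \sum_(i <- [::]) f_ i t) = fun=> 0.
    by apply: functional_extensionality_dep => t; rewrite big_nil.
  exact: apx_0.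
rewrite big_cons.
have -> : (fun t => \sum_(j <- i :: r) f_ j t) =
          (fun t => f_ i t + \sum_(j <- r) f_ j t).
  by apply: functional_extensionality_dep => t; rewrite big_cons.
exact: apx_D.
Qed.

Lemma ap_M f g : \forall t \near U, ap t (f * g) = ap t f * ap t g.
Proof. exact: apx_uniq (apx_ap _) (apx_M (apx_ap f) (apx_ap g)). Qed.
Lemma ap_1 : \forall t \near U, ap t 1 = 1.
Proof. exact: apx_uniq (apx_ap _) apx_1. Qed.
Lemma ap_eq0 f : (\forall t \near U, ap t f = 0) -> f = 0.
Proof. by move=> h; apply: (apx_inj (apx_ap f) apx_0). Qed.

Lemma ap_coef_neq0 f m : m \in msupp f -> \forall t \near U, (ap t f)@_m != 0.
Proof.
move=> mf; have : \forall t \near U, (ap t f)@_m <> 0.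
  apply/ultra_notP => h; move: mf; rewrite mcoeff_msupp => /eqP; apply.
  by apply: (fmorph_inj a); rewrite (proj2 (apx_ap f)) rmorph0; apply/ulimf_eq0.
by apply: filterS => t /eqP.
Qed.

End Fixed.

Section Eval.
Context (n : nat) (K_ : T -> closedFieldType) (i_ : forall t, {rmorphism F_ t -> K_ t}).
Context (b : {rmorphism K -> ufield FU K_}).
Hypothesis bE : forall c c_, a c = ulimf FU c_ -> b c = ulimf FU (fun t => i_ t (c_ t)).
Context (xi : 'I_n -> forall t, K_ t).

(** A common degree bound writes all the evaluations as sums over the same finite set of monomials,
    through which the limit passes. *)
Lemma apx_eval (f : {mpoly K[n]}) f_ : apx f f_ ->
  mmap b (fun i => ulimf FU (xi i)) f =
  ulimf FU (fun t => mmap (i_ t) (xi ^~ t) (f_ t)).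
Proof.
move=> h; have [[d hd] hf] := h.
have bf m : b f@_m = ulimf FU (fun t => i_ t (f_ t)@_m) by apply: bE.
have fd : (msize f <= d)%N.
  rewrite msizeE; apply/bigmax_leqP_seq => m mf _; rewrite ltnNge; apply/negP => dm.
  move: mf; rewrite mcoeff_msupp => /eqP; apply.
  apply: (fmorph_inj a); rewrite rmorph0 hf; apply/ulimf_eq0.
  by apply: filterS hd => t hd; rewrite memN_msupp_eq0 // msize_mdeg_ge // (leq_trans hd).
rewrite (mmapE _ fd).
have e (m : 'X_{1..n < d}) : mmap1 (fun i => ulimf FU (xi i)) m =
    ulimf FU (fun t => mmap1 (xi ^~ t) m).
  rewrite /mmap1; elim: (index_enum _) => [|i r IH].
    rewrite big_nil -ulimf1; apply/ulimfP; apply: filterE => t; by rewrite big_nil.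
  rewrite big_cons IH -ulimfX -ulimfM; apply/ulimfP; apply: filterE => t.
  by rewrite big_cons.
transitivity (\sum_(m : 'X_{1..n < d})
    ulimf FU (fun t => i_ t (f_ t)@_m * mmap1 (xi ^~ t) m)).
  by apply: eq_bigr => m _; rewrite ulimfM -e -bf.
rewrite -ulimf_sum; apply/ulimfP; apply: filterS hd => t hd.
by rewrite (mmapE _ hd).
Qed.
End Eval.
End Approx.

(** * Groebner bases and syzygies *)

(** Each index is chosen where [v] attains its minimum over the tail beyond the previous index. *)
Lemma nat_nondecreasing_subseq (v : nat -> nat) :
  exists psi : nat -> nat, (forall s, (psi s < psi s.+1)%N) /\
    forall s, (v (psi s) <= v (psi s.+1))%N.
Proof.
have argmin N : exists s, (N <= s)%N /\ forall t, (N <= t)%N -> (v s <= v t)%N.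
  pose P x := `[< exists2 s, (N <= s)%N & v s = x >].
  have exP : exists x, P x by exists (v N); apply/asboolP; exists N.
  case: (ex_minnP exP) => x /asboolP[s Ns vs] xmin; exists s; split=> // t Nt.
  by rewrite vs; apply: xmin; apply/asboolP; exists t.
pose g N := sval (cid (argmin N)).
have gP N : (N <= g N)%N /\ forall t, (N <= t)%N -> (v (g N) <= v t)%N.
  by rewrite /g; case: cid.
pose psi := fix psi s := if s is s'.+1 then g (psi s').+1 else g 0%N.
have lt s : (psi s < psi s.+1)%N by have [] := gP (psi s).+1.
exists psi; split=> // s.
have [N [gN h]] : exists N, (N <= psi s)%N /\
    forall t, (N <= t)%N -> (v (psi s) <= v t)%N.
  by case: s => [|s]; [exists 0%N; have [] := gP 0%N | exists (psi s).+1; have [] := gP (psi s).+1].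
by apply: h; apply: leq_trans gN (ltnW (lt s)).
Qed.

(** Otherwise there is an infinite sequence in [S] in which no term divides a later one. Passing to
    a subsequence once per coordinate makes all coordinates nondecreasing, a contradiction. *)
Lemma dickson (n : nat) (S : set 'X_{1..n}) :
  exists l : seq 'X_{1..n}, (forall e, e \in l -> S e) /\
    forall m, S m -> exists2 e, e \in l & (e <= m)%MM.
Proof.
apply: contrapT => /forallNP no.
have ex (l : seq 'X_{1..n}) : exists m, (forall e, e \in l -> S e) ->
    S m /\ forall e, e \in l -> ~~ (e <= m)%MM.
  case: (pselect (forall e, e \in l -> S e)) => [lS|]; last by exists 0%MM.
  have /not_andP[//|/existsNP[m /not_implyP[Sm h]]] := no l.
  exists m => _; split=> // e el; apply/negP => em; apply: h; by exists e.
pose f l := sval (cid (ex l)).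
have fP (l : seq 'X_{1..n}) : (forall e, e \in l -> S e) -> S (f l) /\ forall e, e \in l -> ~~ (e <= f l)%MM.
  by rewrite /f; case: cid.
(* [hist k] lists the first [k] terms of the bad sequence, so that the next term can avoid the
   multiples of all of them. *)
pose hist := fix hist k := if k is k'.+1 then f (hist k') :: hist k' else [::].
have histS k : forall e, e \in hist k -> S e.
  elim: k => // k IH e; rewrite inE => /orP[/eqP ->|]; last exact: IH.
  by have [] := fP _ IH.
pose u k := f (hist k).
have uhist i j : (i < j)%N -> u i \in hist j.
  elim: j => // j IH; rewrite ltnS leq_eqVlt inE => /orP[/eqP ->|/IH ->].
    by rewrite eqxx.
  by rewrite orbT.
have bad i j : (i < j)%N -> ~~ (u i <= u j)%MM.
  by move=> ij; have [_] := fP _ (histS j); apply; apply: uhist.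
have : forall k, (k <= n)%N -> exists phi : nat -> nat, (forall s, (phi s < phi s.+1)%N) /\
    forall (i : 'I_n), (i < k)%N -> forall s, (u (phi s) i <= u (phi s.+1) i)%N.
  elim=> [|k IH] kn; first by exists id; split.
  have [phi [lt mono]] := IH (ltnW kn).
  have [psi [ltpsi h]] := nat_nondecreasing_subseq (fun s => u (phi s) (Ordinal kn)).
  exists (phi \o psi); split=> [s /=|i ik s /=].
    have phim : {homo phi : x y / (x < y)%N} by apply: homo_ltn => // y x z; apply: ltn_trans.
    exact: phim.
  move: ik; rewrite ltnS leq_eqVlt => /orP[/eqP ik|ik].
    have -> : i = Ordinal kn by apply: val_inj.
    exact: h.
  have mi : {homo (fun s => u (phi s) i) : x y / (x <= y)%N}.
    by apply: homo_leq => //; [move=> y x z; apply: leq_trans | apply: mono].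
  by apply: mi; apply: ltnW.
case/(_ n (leqnn n)) => phi [lt mono].
have /negP := bad _ _ (lt 0%N); apply; apply/mnm_lepP => i.
exact: mono.
Qed.

(** * Bounds on the monomials of a polynomial *)

Section Leading.
Context (F : fieldType) (n : nat).
Implicit Types (f g : {mpoly F[n]}) (m mu : 'X_{1..n}).

(** Both bounds are stated on coefficients rather than on [mlead], so that the zero polynomial needs
    no separate case and sums are immediate. *)
Definition below mu f : Prop := forall m, (mu <= m)%O -> f@_m = 0.
Definition upto mu f : Prop := forall m, (mu < m)%O -> f@_m = 0.

Lemma belowP mu f : below mu f <-> f = 0 \/ (mlead f < mu)%O.
Proof.
split=> [h|[->|h] m mm]; last 2 first.
- by rewrite mcoeff0.
- by apply: mcoeff_gt_mlead; apply: Order.POrderTheory.lt_le_trans mm.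
case: (eqVneq f 0) => [|f0]; [by left | right].
rewrite Order.TotalTheory.ltNge; apply/negP => /h /eqP.
by rewrite mleadc_eq0 (negPf f0).
Qed.

Lemma uptoP mu f : upto mu f <-> f = 0 \/ (mlead f <= mu)%O.
Proof.
split=> [h|[->|h] m mm]; last 2 first.
- by rewrite mcoeff0.
- by apply: mcoeff_gt_mlead; apply: Order.POrderTheory.le_lt_trans mm.
case: (eqVneq f 0) => [|f0]; [by left | right].
rewrite Order.TotalTheory.leNgt; apply/negP => /h /eqP.
by rewrite mleadc_eq0 (negPf f0).
Qed.

Lemma below0 mu : below mu 0. Proof. by move=> m _; rewrite mcoeff0. Qed.
Lemma belowD mu f g : below mu f -> below mu g -> below mu (f + g).
Proof. by move=> hf hg m mm; rewrite mcoeffD hf // hg // addr0. Qed.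
Lemma uptoD mu f g : upto mu f -> upto mu g -> upto mu (f + g).
Proof. by move=> hf hg m mm; rewrite mcoeffD hf // hg // addr0. Qed.
Lemma uptoN mu f : upto mu f -> upto mu (- f).
Proof. by move=> hf m mm; rewrite mcoeffN hf // oppr0. Qed.
Lemma below_upto mu f : below mu f -> upto mu f.
Proof. by move=> h m mm; apply: h; apply: Order.POrderTheory.ltW. Qed.
Lemma upto_below mu f : upto mu f -> f@_mu = 0 -> below mu f.
Proof.
move=> h f0 m; rewrite Order.POrderTheory.le_eqVlt => /orP[/eqP <- //|]; exact: h.
Qed.
Lemma below_trans mu nu f : (mu <= nu)%O -> below mu f -> below nu f.
Proof. by move=> mn h m nm; apply: h; apply: Order.POrderTheory.le_trans nm. Qed.

Lemma belowMX mu d c f : below mu f -> below (d + mu)%MM (c *: 'X_[d] * f).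
Proof.
move=> /belowP h; apply/belowP.
case: h => [->|h]; first by left; rewrite mulr0.
case: (eqVneq f 0) => [->|f0]; first by left; rewrite mulr0.
case: (eqVneq c 0) => [->|c0]; first by left; rewrite scale0r mul0r.
right; rewrite -scalerAl mleadZ // mleadM // ?mpolyX_neq0 ?mleadXm ?ltmc_add2r //.
by rewrite -msize_poly_eq0 msizeX.
Qed.

Lemma uptoMX d c f : upto (d + mlead f)%MM (c *: 'X_[d] * f).
Proof.
apply/uptoP; case: (eqVneq f 0) => [->|f0]; first by left; rewrite mulr0.
case: (eqVneq c 0) => [->|c0]; first by left; rewrite scale0r mul0r.
right; rewrite -scalerAl mleadZ // mleadM // ?mleadXm //.
by rewrite -msize_poly_eq0 msizeX.
Qed.

Lemma coefMX d c f m : (c *: 'X_[d] * f)@_(d + m) = c * f@_m.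
Proof. by rewrite -scalerAl mcoeffZ ['X_[d] * f]mulrC mcoeffMX. Qed.

Lemma fin_upto (m : nat) (f : 'I_m -> {mpoly F[n]}) :
  (forall k, f k = 0) \/ exists mu, (forall k, upto mu (f k)) /\
    exists k, f k <> 0 /\ mu = mlead (f k).
Proof.
case: (pselect (exists k, f k != 0)) => [[k0 fk0]|h]; last first.
  by left=> k; apply/eqP; apply: contrapT => /negP fk; apply: h; exists k.
right; case: (@Order.TotalTheory.arg_maxP _ _ _ k0 (fun k => f k != 0)
  (fun k => mlead (f k)) fk0) => i fi hi.
exists (mlead (f i)); split; last by exists i; split=> //; apply/eqP.
move=> k; apply/uptoP; case: (eqVneq (f k) 0) => [|fk]; [by left | right].
exact: hi.
Qed.

End Leading.

(** * Generation of syzygies by reductions of S-polynomials *)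

Section Syzygies.
Context (F : fieldType) (n m : nat).
Local Notation P := {mpoly F[n]}.

(* The reductions of the S-polynomials; [e] and [c] stand for the leading
   monomials and coefficients, and [h] for the quotients of the division. *)
Definition syz (e : 'I_m -> 'X_{1..n}) (c : 'I_m -> F) (h : 'I_m -> 'I_m -> 'I_m -> P)
    (s : 'I_m * 'I_m) (k : 'I_m) : P :=
  (c s.2)%:MP * 'X_[mlcm (e s.1) (e s.2) - e s.1] * (k == s.1)%:R
  - (c s.1)%:MP * 'X_[mlcm (e s.1) (e s.2) - e s.2] * (k == s.2)%:R
  - h s.1 s.2 k.

Definition lin_span (J : finType) (sg : J -> 'I_m -> P) (z : 'I_m -> P) : Prop :=
  exists w : J -> P, forall k, z k = \sum_s w s * sg s k.

Lemma lin_spanD (J : finType) (sg : J -> 'I_m -> P) z q s0 :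
  lin_span sg (fun k => z k - q * sg s0 k) -> lin_span sg z.
Proof.
move=> [w hw]; exists (fun s => w s + q * (s == s0)%:R) => k.
under eq_bigr do rewrite mulrDl.
rewrite big_split /= -hw (bigD1 s0) //= eqxx mulr1 big1 ?addr0 ?subrK // => s /negPf ->.
by rewrite mulr0 mul0r.
Qed.

Context (G : 'I_m -> P) (e : 'I_m -> 'X_{1..n}) (c : 'I_m -> F).
Context (h : 'I_m -> 'I_m -> 'I_m -> P).
Hypothesis G0 : forall i, G i != 0.
Hypothesis eG : forall i, mlead (G i) = e i.
Hypothesis cG : forall i, c i = (G i)@_(e i).
Hypothesis syz0 : forall s, \sum_k syz e c h s k * G k = 0.
Hypothesis h_below : forall i j k, below (mlcm (e i) (e j)) (h i j k * G k).

(* Two terms [z k * G k] reaching the top monomial [mu] are traded against the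
   syzygy of their S-polynomial, which kills one of them at [mu]. *)
Lemma schreyer_step mu (z : 'I_m -> P) i j : i != j ->
  (forall k, upto mu (z k * G k)) ->
  (z i * G i)@_mu != 0 -> (z j * G j)@_mu != 0 ->
  exists q, let z' k := z k - q * syz e c h (i, j) k in
    [/\ forall k, upto mu (z' k * G k), (z' i * G i)@_mu = 0
      & forall k, k != i -> k != j -> (z' k * G k)@_mu = (z k * G k)@_mu].
Proof.
move=> ij zmu ti tj.
have c0 k : c k != 0 by rewrite cG -eG mleadc_eq0.
have le_mu k : (z k * G k)@_mu != 0 -> (e k <= mu)%MM.
  move=> t0; have zG0 : z k * G k != 0.
    by apply: contraNneq t0 => ->; rewrite mcoeff0.
  have z0 : z k != 0 by apply: contraNneq zG0 => ->; rewrite mul0r.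
  suff <- : mlead (z k * G k) = mu by rewrite mleadM // eG lem_addl.
  apply: Order.POrderTheory.le_anti; apply/andP; split.
    by have /uptoP[/eqP|//] := zmu k; rewrite (negPf zG0).
  by apply: msupp_le_mlead; rewrite mcoeff_msupp.
set l := mlcm (e i) (e j).
have lmu : (l <= mu)%MM by rewrite lem_mlcm !le_mu.
(* Subtracting [q] times the syzygy removes [a * c j * c i] from the coefficient of [z i * G i] at
   [mu]; this [a] makes the coefficient vanish. *)
pose a := (z i * G i)@_mu / (c i * c j).
pose q := a *: 'X_[mu - l] : P.
have shift k b : (e k <= l)%MM ->
    upto mu (q * (b%:MP * 'X_[l - e k]) * G k) /\
    (q * (b%:MP * 'X_[l - e k]) * G k)@_mu = a * b * c k.
  move=> el; have dmu : ((mu - l) + (l - e k) + e k)%MM = mu.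
    by rewrite -addmA submK // submK.
  have -> : q * (b%:MP * 'X_[l - e k]) = (a * b) *: 'X_[(mu - l) + (l - e k)].
    by rewrite /q mul_mpolyC mpolyXD -scalerAr -scalerAl scalerA mulrC.
  rewrite -[X in upto X]dmu -[X in _@_X]dmu -{2}(eG k); split; first exact: uptoMX.
  by rewrite coefMX cG.
have hq k : below mu (q * h i j k * G k).
  by rewrite -mulrA -[X in below X](submK lmu); apply: belowMX; apply: h_below.
exists q => z'.
have [ui vi] := shift i (c j) (lem_mlcml _ _).
have [uj vj] := shift j (c i) (lem_mlcmr _ _).
have z'E k : z' k * G k = z k * G k
    - (k == i)%:R * (q * ((c j)%:MP * 'X_[l - e i]) * G i)
    + (k == j)%:R * (q * ((c i)%:MP * 'X_[l - e j]) * G j) + q * h i j k * G k.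
  rewrite /z' /syz /= -/l; case: eqP => [->|_]; case: eqP => [->|_];
  by rewrite /= ?mulr1 ?mulr0 ?mul1r ?mul0r; ring.
split.
- move=> k; rewrite z'E; apply: uptoD; last exact: below_upto.
  apply: uptoD; last by case: eqP => _; rewrite ?mul1r ?mul0r //; apply/below_upto/below0.
  apply: uptoD => //; apply: uptoN.
  by case: eqP => _; rewrite ?mul1r ?mul0r //; apply/below_upto/below0.
- rewrite z'E eqxx (negPf ij) mul0r addr0 mul1r mcoeffD mcoeffB vi.
  rewrite (hq i mu (Order.POrderTheory.lexx _)) addr0 /a.
  by apply/eqP; rewrite subr_eq0; apply/eqP; field; rewrite !c0.
- move=> k /negPf ki /negPf kj.
  by rewrite z'E ki kj !mul0r subr0 addr0 mcoeffD (hq k mu (Order.POrderTheory.lexx _)) addr0.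
Qed.

(** Induction on a monomial [mu] bounding the terms [z k * G k], then on the number of terms that
    reach it. [schreyer_step] removes one such term without creating another. Only the leading data
    of [G] and the finitely many reductions enter, which is what allows the result to be applied in
    almost all factors. *)
Lemma schreyer (z : 'I_m -> P) :
  \sum_k z k * G k = 0 -> lin_span (syz e c h) z.
Proof.
have main : forall mu N (z : 'I_m -> P), \sum_k z k * G k = 0 ->
    (forall k, upto mu (z k * G k)) -> (#|[pred k | (z k * G k)@_mu != 0%R]| <= N)%N ->
    lin_span (syz e c h) z.
  elim/(well_founded_ind (@ltom_wf n)) => mu IHmu; elim=> [|N IHN] {}z zG zmu.
    rewrite leqn0 => /eqP/card0_eq T0.
    have zb k : below mu (z k * G k).
      apply: upto_below => //; apply/eqP; apply: contraT => t.
      by have := T0 k; rewrite inE t.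
    have [z0|[nu [znu [k [zk nuk]]]]] := fin_upto (fun k => z k * G k).
      exists (fun=> 0) => k; rewrite big1 => [|s _]; last by rewrite mul0r.
      by have /eqP := z0 k; rewrite mulf_eq0 (negPf (G0 k)) orbF => /eqP.
    have [//|numu] := iffLR (belowP _ _) (zb k).
    by apply: (IHmu nu _ m) => //; rewrite ?nuk // -[X in (_ <= X)%N]card_ord max_card.
  move=> zN; case: (pselect (exists i, (z i * G i)@_mu != 0)) => [[i ti]|no]; last first.
    apply: IHN => //; rewrite eq_card0 // => k; rewrite !inE; apply/eqP; apply: contrapT => /eqP t.
    by apply: no; exists k.
  (* The terms sum to zero, so a term with a non-zero coefficient at [mu] needs a partner. *)
  have [j ji tj] : exists2 j, j != i & (z j * G j)@_mu != 0.
    apply: contrapT => no; move/eqP: ti; apply.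
    have := congr1 (fun f : P => f@_mu) zG; rewrite raddf_sum mcoeff0 /= (bigD1 i) //=.
    rewrite big1 ?addr0 // => j ji; apply/eqP; apply: contrapT => /negP tj.
    by apply: no; exists j.
  have ij : i != j by rewrite eq_sym.
  have [q [z'mu t'i t']] := schreyer_step ij zmu ti tj.
  apply: (@lin_spanD _ _ _ q (i, j)); apply: IHN => //.
    under eq_bigr do rewrite mulrBl.
    rewrite sumrB zG sub0r -[RHS](oppr0); congr (- _).
    transitivity (q * \sum_k syz e c h (i, j) k * G k); last by rewrite syz0 mulr0.
    by rewrite mulr_sumr; apply: eq_bigr => k _; rewrite mulrA.
  rewrite -ltnS; apply: leq_trans zN; apply: proper_card; apply/properP; split.
    apply/fintype.subsetP => k; rewrite !inE; case: (eqVneq k i) => [-> //|ki].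
    case: (eqVneq k j) => [-> //|kj]; by rewrite t'.
  by exists i; rewrite !inE // t'i eqxx.
move=> zG; have [z0|[mu [zmu _]]] := fin_upto (fun k => z k * G k).
  exists (fun=> 0) => k; rewrite big1 => [|s _]; last by rewrite mul0r.
  by have /eqP := z0 k; rewrite mulf_eq0 (negPf (G0 k)) orbF => /eqP.
by apply: (main mu m) => //; rewrite -[X in (_ <= X)%N]card_ord max_card.
Qed.

End Syzygies.

(** * Groebner bases and division *)

Section Groebner.
Context (F : fieldType) (n : nat) (I : set {mpoly F[n]}).
Hypothesis I0 : I 0.
Hypothesis ID : forall f g, I f -> I g -> I (f + g).
Hypothesis IM : forall f g, I g -> I (f * g).

(** Dickson's lemma yields finitely many leading monomials of [I] dividing all others; one element
    of [I] is chosen for each. *)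
Lemma groebner_basis : exists m (G : 'I_m -> {mpoly F[n]}),
  [/\ forall i, I (G i), forall i, G i != 0
    & forall f, I f -> f != 0 -> exists i, (mlead (G i) <= mlead f)%MM].
Proof.
have [l [lS lD]] := dickson [set e | exists f, [/\ I f, f != 0 & mlead f = e]].
pose g (i : 'I_(size l)) := sval (cid (lS (tnth (in_tuple l) i) (mem_tnth _ _))).
have gP i : [/\ I (g i), g i != 0 & mlead (g i) = tnth (in_tuple l) i].
  by rewrite /g; case: cid.
exists (size l), g; split; try by move=> i; have [] := gP i.
move=> f If f0; have [e el ef] := lD (mlead f) (ex_intro _ f (And3 If f0 erefl)).
have [i ei] : exists i, tnth (in_tuple l) i = e.
  by have /tnthP[i ->] : e \in in_tuple l by []; exists i.
by exists i; have [_ _ ->] := gP i; rewrite ei.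
Qed.

Section Reduction.
Context (m : nat) (G : 'I_m -> {mpoly F[n]}).
Hypothesis IG : forall i, I (G i).
Hypothesis G0 : forall i, G i != 0.
Hypothesis GB : forall f, I f -> f != 0 -> exists i, (mlead (G i) <= mlead f)%MM.

Lemma groebner_reduce f : I f -> f != 0 -> exists i q,
  [/\ I (f - q * G i), upto (mlead f) (q * G i) & below (mlead f) (f - q * G i)].
Proof.
move=> If f0; have [i ei] := GB If f0; set mu := mlead f in ei *.
pose c := f@_mu / (G i)@_(mlead (G i)).
exists i, (c *: 'X_[mu - mlead (G i)]).
have qG : upto mu (c *: 'X_[mu - mlead (G i)] * G i).
  by rewrite -[X in upto X](submK ei); apply: uptoMX.
split=> //; first by apply: ID => //; rewrite -mulNr; apply: IM.
apply: upto_below.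
  apply: uptoD; last exact: uptoN.
  by apply/uptoP; right; apply: Order.POrderTheory.lexx.
rewrite mcoeffB -[X in (_ * _)@_X](submK ei) coefMX /c divfK ?subrr //.
by rewrite mleadc_eq0.
Qed.

(** Besides a representation of [f], the proof controls the size of each term: no product
    [h k * G k] reaches [nu]. For S-polynomials, with [nu] the lcm of the leading monomials, this is
    the hypothesis [h_below] of Schreyer's theorem. *)
Lemma groebner_division nu f : I f -> below nu f ->
  exists h : 'I_m -> {mpoly F[n]}, f = \sum_k h k * G k /\ forall k, below nu (h k * G k).
Proof.
move: f; elim/(well_founded_ind (@ltom_wf n)): nu => nu IH f If fnu.
case: (eqVneq f 0) => [->|f0].
  exists (fun=> 0); split; last by move=> k; rewrite mul0r; apply: below0.
  by rewrite big1 // => k _; rewrite mul0r.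
have [|lf] := iffLR (belowP _ _) fnu; first by move/eqP; rewrite (negPf f0).
have [i [q [If' qG fb]]] := groebner_reduce If f0.
have [h [fh hb]] := IH _ lf _ If' fb.
exists (fun k => h k + (k == i)%:R * q); split.
  under eq_bigr do rewrite mulrDl.
  rewrite big_split /= -fh (bigD1 i) //= eqxx mul1r big1 ?addr0 ?subrK // => k /negPf ->.
  by rewrite !mul0r.
move=> k; rewrite mulrDl; apply: belowD.
  by apply: below_trans (hb k); apply: Order.POrderTheory.ltW.
case: eqP => [->|_]; last by rewrite !mul0r; apply: below0.
rewrite mul1r => m' nm; apply: qG; exact: Order.POrderTheory.lt_le_trans nm.
Qed.

Lemma groebner_generates f : I f ->
  exists h : 'I_m -> {mpoly F[n]}, f = \sum_k h k * G k.
Proof.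
move=> If; case: (eqVneq f 0) => [->|f0].
  by exists (fun=> 0); rewrite big1 // => k _; rewrite mul0r.
have [i [q [If' _ fb]]] := groebner_reduce If f0.
have [h [fh _]] := groebner_division If' fb.
exists (fun k => h k + (k == i)%:R * q).
under eq_bigr do rewrite mulrDl.
rewrite big_split /= -fh (bigD1 i) //= eqxx mul1r big1 ?addr0 ?subrK // => k /negPf ->.
by rewrite !mul0r.
Qed.

End Reduction.
End Groebner.

(** * Transfer of syzygies and colon ideals to the factors *)

Section SyzygyTransfer.
Context (T : Type) (U : set_system T) (FU : UltraFilter U).
Context (F_ : T -> closedFieldType) (K : fieldType).
Context (a : {rmorphism K -> ufield FU F_}) (n : nat).
Local Notation ap t f := (ap a t f).
Local Notation apx := (apx a).
Local Notation apx_ap := (apx_ap a).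

Lemma apx_nat (k : nat) : apx (k%:R : {mpoly K[n]}) (fun t => k%:R).
Proof.
elim: k => [|k IH]; first exact: apx_0.
rewrite -natr1.
have -> : (fun t => k.+1%:R : {mpoly (F_ t)[n]}) = (fun t => k%:R + 1).
  by apply: functional_extensionality_dep => t; rewrite natr1.
by apply: apx_D => //; apply: apx_1.
Qed.

Lemma ap_below t mu (f : {mpoly K[n]}) : below mu f -> below mu (ap t f).
Proof. by move=> h m /h fm; rewrite ap_coef mcoeff_msupp fm eqxx. Qed.

Lemma ap_mlead (f : {mpoly K[n]}) : f != 0 ->
  \forall t \near U, ap t f != 0 /\ mlead (ap t f) = mlead f.
Proof.
move=> f0; apply: filterS (ap_coef_neq0 a (mlead_supp f0)) => t ft.
have apf0 : ap t f != 0 by apply: contraNneq ft => ->; rewrite mcoeff0.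
split=> //; apply: Order.POrderTheory.le_anti; apply/andP; split.
  by apply: msupp_le_mlead; apply: ap_supp; apply: mlead_supp.
by apply: msupp_le_mlead; rewrite mcoeff_msupp.
Qed.

Lemma ap_sumM (I : finType) (x y : I -> {mpoly K[n]}) :
  \forall t \near U, ap t (\sum_i x i * y i) = \sum_i ap t (x i) * ap t (y i).
Proof.
apply: apx_uniq (apx_ap _) _.
by apply: apx_sum => i; apply: apx_M; apply: apx_ap.
Qed.

(** With a Groebner basis [G] of the ideal of [f] and matrices such that [f = A G] and [G = B f],
    the syzygies of [f] are generated by the rows of [1 - A B] and by the products with [B] of the
    syzygies [sg] of [G]. These data are finite and defined over [K], and their identities hold in
    almost all factors. *)
Lemma uniform_syzygies r (f : 'I_r -> {mpoly K[n]}) :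
  exists (J : finType) (Z : J -> 'I_r -> {mpoly K[n]}),
    (forall j, \sum_k Z j k * f k = 0) /\
    \forall t \near U, forall z : 'I_r -> {mpoly (F_ t)[n]},
      \sum_k z k * ap t (f k) = 0 -> lin_span (fun j k => ap t (Z j k)) z.
Proof.
pose I : set {mpoly K[n]} := [set g | exists z, g = \sum_k z k * f k].
have I0 : I 0 by exists (fun=> 0); rewrite big1 // => k _; rewrite mul0r.
have ID x y : I x -> I y -> I (x + y).
  move=> [z ->] [z' ->]; exists (fun k => z k + z' k).
  by rewrite -big_split; apply: eq_bigr => k _; rewrite mulrDl.
have IM x y : I y -> I (x * y).
  move=> [z ->]; exists (fun k => x * z k).
  by rewrite mulr_sumr; apply: eq_bigr => k _; rewrite mulrA.
have [m [G [IG G0 GB]]] := groebner_basis I.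
pose B i := sval (cid (IG i)).
have GBf i : G i = \sum_k B i k * f k by rewrite /B; case: cid.
have If j : I (f j).
  exists (fun k => (k == j)%:R); rewrite (bigD1 j) //= eqxx mul1r big1 ?addr0 //.
  by move=> k /negPf ->; rewrite mul0r.
pose A j := sval (cid (groebner_generates ID IM IG G0 GB (If j))).
have fAG j : f j = \sum_i A j i * G i by rewrite /A; case: cid.
pose e i := mlead (G i); pose c i := (G i)@_(e i).
pose l s := mlcm (e s.1) (e s.2).
pose sp (s : 'I_m * 'I_m) := (c s.2)%:MP * 'X_[l s - e s.1] * G s.1
  - (c s.1)%:MP * 'X_[l s - e s.2] * G s.2.
have Isp s : I (sp s).
  by apply: (ID _ _ (IM _ _ (IG _))); rewrite -mulNr; apply: (IM _ _ (IG _)).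
have spb s : below (l s) (sp s).
  have up i b : (e i <= l s)%MM -> upto (l s) (b%:MP * 'X_[l s - e i] * G i) /\
      (b%:MP * 'X_[l s - e i] * G i)@_(l s) = b * c i.
    move=> el; rewrite mul_mpolyC -[X in upto X](submK el) -[X in _@_X](submK el).
    by split; [apply: uptoMX | rewrite coefMX].
  have [u1 v1] := up s.1 (c s.2) (lem_mlcml _ _).
  have [u2 v2] := up s.2 (c s.1) (lem_mlcmr _ _).
  apply: upto_below; first by apply: uptoD => //; apply: uptoN.
  by rewrite mcoeffB v1 v2 mulrC subrr.
pose h i j := sval (cid (groebner_division ID IM IG G0 GB (Isp (i, j)) (spb (i, j)))).
have hP i j : sp (i, j) = \sum_k h i j k * G k /\ forall k, below (l (i, j)) (h i j k * G k).
  by rewrite /h; case: cid.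
pose sg := syz e c h.
have sgG s : \sum_k sg s k * G k = 0.
  case: s => i j; rewrite /sg /syz /=.
  under eq_bigr do rewrite mulrBl mulrBl.
  rewrite !sumrB -(proj1 (hP i j)) /sp /= (bigD1 i) //= eqxx mulr1 big1 => [|k /negPf ->]; last first.
    by rewrite mulr0 mul0r.
  rewrite addr0 [X in _ - X - _](bigD1 j) //= eqxx mulr1 big1 => [|k /negPf ->]; last first.
    by rewrite mulr0 mul0r.
  by rewrite addr0 subrr.
pose Z (s : 'I_r + 'I_m * 'I_m) k := match s with
  | inl j => (j == k)%:R - \sum_i A j i * B i k
  | inr s => \sum_i sg s i * B i k end.
have sgB s : \sum_k (\sum_i sg s i * B i k) * f k = 0.
  rewrite -[RHS](sgG s); under eq_bigr do rewrite mulr_suml.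
  rewrite exchange_big; apply: eq_bigr => i _; rewrite GBf mulr_sumr.
  by apply: eq_bigr => k _; rewrite mulrA.
exists ('I_r + 'I_m * 'I_m)%type, Z; split.
  case=> [j|s]; last exact: sgB.
  rewrite /Z; under eq_bigr do rewrite mulrBl.
  rewrite sumrB (bigD1 j) //= eqxx mul1r big1 ?addr0 => [|k]; last first.
    by rewrite eq_sym => /negPf ->; rewrite mul0r.
  apply/eqP; rewrite subr_eq0 fAG; apply/eqP.
  under [RHS]eq_bigr do rewrite mulr_suml.
  rewrite exchange_big; apply: eq_bigr => i _; rewrite GBf mulr_sumr.
  by apply: eq_bigr => k _; rewrite mulrA.
pose c_ t i := (ap t (G i))@_(e i).
pose h_ t i j k := ap t (h i j k).
have apx_sg s k : apx (sg s k) (fun t => syz e (c_ t) (h_ t) s k).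
  apply: apx_B; last exact: apx_ap.
  apply: apx_B; apply: apx_M; try exact: apx_nat; apply: apx_M; try exact: apx_X.
    by apply: apx_C; apply: (proj2 (apx_ap (G s.2))).
  by apply: apx_C; apply: (proj2 (apx_ap (G s.1))).
(* [H1] to [H7] are everything the argument needs in a factor: unchanged leading monomials, the
   reductions of the S-polynomials, and the identities defining [Z]. *)
have H1 : \forall t \near U, forall i, ap t (G i) != 0 /\ mlead (ap t (G i)) = e i.
  by apply: filter_forall => i; apply: ap_mlead.
have H2 : \forall t \near U, forall s, \sum_k syz e (c_ t) (h_ t) s k * ap t (G k) = 0.
  apply: filter_forall => s; apply: apx_uniq (apx_0 a n).
  by rewrite -(sgG s); apply: apx_sum => k; apply: apx_M => //; apply: apx_ap.
have H3 : \forall t \near U, forall s : 'I_m * 'I_m * 'I_m,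
    ap t (h s.1.1 s.1.2 s.2 * G s.2) = h_ t s.1.1 s.1.2 s.2 * ap t (G s.2).
  by apply: filter_forall => s; apply: ap_M.
have H4 : \forall t \near U, forall s : ('I_m * 'I_m) * 'I_m,
    ap t (sg s.1 s.2) = syz e (c_ t) (h_ t) s.1 s.2.
  by apply: filter_forall => s; apply: apx_uniq (apx_ap _) (apx_sg _ _).
have H5 : \forall t \near U, forall j, ap t (f j) = \sum_i ap t (A j i) * ap t (G i).
  by apply: filter_forall => j; have := ap_sumM (A j) G; rewrite -fAG.
have H6 : \forall t \near U, forall s : 'I_r * 'I_r, ap t (Z (inl s.1) s.2) =
    (s.1 == s.2)%:R - \sum_i ap t (A s.1 i) * ap t (B i s.2).
  apply: filter_forall => s; apply: apx_uniq (apx_ap _) _.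
  apply: apx_B; first exact: apx_nat.
  by apply: apx_sum => i; apply: apx_M; apply: apx_ap.
have H7 : \forall t \near U, forall s : ('I_m * 'I_m) * 'I_r, ap t (Z (inr s.1) s.2) =
    \sum_i ap t (sg s.1 i) * ap t (B i s.2).
  by apply: filter_forall => s; apply: ap_sumM.
near=> t => z zf.
have h1 : forall i, ap t (G i) != 0 /\ mlead (ap t (G i)) = e i by near: t.
have h2 : forall s, \sum_k syz e (c_ t) (h_ t) s k * ap t (G k) = 0 by near: t.
have h3 : forall s : 'I_m * 'I_m * 'I_m,
    ap t (h s.1.1 s.1.2 s.2 * G s.2) = h_ t s.1.1 s.1.2 s.2 * ap t (G s.2) by near: t.
have h4 : forall s : ('I_m * 'I_m) * 'I_m,
    ap t (sg s.1 s.2) = syz e (c_ t) (h_ t) s.1 s.2 by near: t.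
have h5 : forall j, ap t (f j) = \sum_i ap t (A j i) * ap t (G i) by near: t.
have h6 : forall s : 'I_r * 'I_r, ap t (Z (inl s.1) s.2) =
    (s.1 == s.2)%:R - \sum_i ap t (A s.1 i) * ap t (B i s.2) by near: t.
have h7 : forall s : ('I_m * 'I_m) * 'I_r, ap t (Z (inr s.1) s.2) =
    \sum_i ap t (sg s.1 i) * ap t (B i s.2) by near: t.
(* The row [y = z A] is a syzygy of [G], and [z = z (1 - A B) + y B]. *)
pose y i := \sum_j z j * ap t (A j i).
have yG : \sum_i y i * ap t (G i) = 0.
  rewrite -[RHS]zf; under eq_bigr do rewrite mulr_suml.
  rewrite exchange_big; apply: eq_bigr => j _; rewrite h5 mulr_sumr.
  by apply: eq_bigr => i _; rewrite mulrA.
have [|||||w yw] := @schreyer _ _ _ (fun i => ap t (G i)) e (c_ t) (h_ t) _ _ _ _ _ y yG.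
- by move=> i; have [] := h1 i.
- by move=> i; have [] := h1 i.
- by [].
- exact: h2.
- move=> i j k; have := h3 ((i, j), k) => /= <-; apply: ap_below.
  by have [_] := hP i j; apply.
exists (fun s => match s with inl j => z j | inr s => w s end) => k.
rewrite big_sumType /=.
under eq_bigr do rewrite (h6 (_, k)) /= mulrBr.
under [X in _ + X]eq_bigr do rewrite (h7 (_, k)) /=.
rewrite sumrB (bigD1 k) //= eqxx mulr1 [X in _ + X - _]big1 => [|j /negPf ->]; last by rewrite mulr0.
rewrite addr0 -[LHS]addr0 -addrA; congr (_ + _); apply/esym/eqP; rewrite addrC subr_eq0; apply/eqP.
transitivity (\sum_i y i * ap t (B i k)).
  under [RHS]eq_bigr do rewrite yw mulr_suml.
  rewrite exchange_big; apply: eq_bigr => s _; rewrite mulr_sumr.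
  by apply: eq_bigr => i _; rewrite (h4 (s, i)) mulrA.
rewrite /y; under [LHS]eq_bigr do rewrite mulr_suml.
rewrite exchange_big; apply: eq_bigr => j _; rewrite mulr_sumr.
by apply: eq_bigr => i _; rewrite mulrA.
Unshelve. all: by end_near.
Qed.

(** The colon ideal of the ideal of [s] by [h] consists of the coefficients of [h] in the syzygies
    of the family [h, s]; its generators are read off from those of the syzygies. *)
Lemma colon_transfer r (s : 'I_r -> {mpoly K[n]}) (h : {mpoly K[n]}) :
  exists (J : finType) (R : J -> {mpoly K[n]}),
    (forall j, exists y, h * R j = \sum_k y k * s k) /\
    \forall t \near U, forall f y, ap t h * f = \sum_k y k * ap t (s k) ->
      exists w, f = \sum_j w j * ap t (R j).
Proof.
pose g (i : 'I_r.+1) := if unlift ord0 i is Some k then s k else h.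
have g0 : g ord0 = h by rewrite /g unlift_none.
have gS k : g (lift ord0 k) = s k by rewrite /g liftK.
have [J [Z [Zg HZ]]] := uniform_syzygies g.
exists J, (fun j => Z j ord0); split.
  move=> j; exists (fun k => - Z j (lift ord0 k)).
  have := Zg j; rewrite big_ord_recl g0 mulrC => /eqP; rewrite addr_eq0 => /eqP ->.
  by rewrite -sumrN; apply: eq_bigr => k _; rewrite gS mulNr.
apply: filterS HZ => t HZ f y e.
have [|w hw] := HZ (fun i => if unlift ord0 i is Some k then - y k else f).
  rewrite big_ord_recl unlift_none g0 mulrC e.
  rewrite -big_split big1 //= => k _; by rewrite liftK gS mulNr subrr.
by exists w; have := hw ord0; rewrite unlift_none.
Qed.

End SyzygyTransfer.

(** * Generic points *)

Section Ideals.
Context (R : comPzRingType).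

Lemma seq_ideal_gen (s : seq R) y : y \in s -> seq_ideal s y.
Proof.
move=> ys; exists (fun k => (k == index y s)%:R).
have iy : (index y s < size s)%N by rewrite index_mem.
rewrite (bigD1 (Ordinal iy)) //= eqxx mul1r nth_index // big1 ?addr0 // => i.
by rewrite -val_eqE /= => /negPf ->; rewrite mul0r.
Qed.

Lemma ideal_sum (J : ideal R) (I : Type) (r : seq I) (P : pred I) (F : I -> R) :
  (forall i, P i -> J (F i)) -> J (\sum_(i <- r | P i) F i).
Proof. by move=> h; apply: big_ind => //; [apply: ideal0 | apply: idealD]. Qed.

Lemma seq_ideal_le (s : seq R) (J : ideal R) y :
  (forall x, x \in s -> J x) -> seq_ideal s y -> J y.
Proof.
move=> h [c ->]; apply: ideal_sum => i _; apply: idealM; apply: h.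
exact: mem_nth.
Qed.

End Ideals.

Lemma seq_ideal_map (R R' : comPzRingType) (phi : {rmorphism R -> R'}) (s : seq R) y :
  seq_ideal s y -> seq_ideal [seq phi x | x <- s] (phi y).
Proof.
move=> [c ->]; rewrite rmorph_sum; apply: ideal_sum => i _.
by rewrite rmorphM; apply: idealM; apply: seq_ideal_gen; apply: map_f; apply: mem_nth.
Qed.

(** * Fractions, pseudo-division, and splitting off the last variable *)

Section Fracset.
Context (R : comNzRingType) (K : fieldType) (phi : {rmorphism R -> K}).

Definition fracset : set K := [set z | exists a b, phi b != 0 /\ z = phi a / phi b].

Lemma fracset_subfield : subfield fracset.
Proof.
split.
- by exists 1, 1; rewrite !rmorph1 oner_neq0 divr1.
- move=> _ _ [a [b [b0 ->]]] [c [d [d0 ->]]].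
  exists (a * d - c * b), (b * d); rewrite rmorphB !rmorphM mulf_neq0 //; split=> //.
  by field; rewrite b0 d0.
- move=> _ _ [a [b [b0 ->]]] [c [d [d0 ->]]].
  have [c0|c0] := eqVneq (phi c) 0.
    by exists 0, 1; rewrite c0 mul0r invr0 mulr0 rmorph0 mul0r rmorph1 oner_neq0.
  exists (a * d), (b * c); rewrite !rmorphM mulf_neq0 //; split=> //.
  by field; rewrite b0 c0 d0.
Qed.

Lemma fracset_id a : fracset (phi a).
Proof. by exists a, 1; rewrite rmorph1 oner_neq0 divr1. Qed.

Lemma fracset_clear (q : {poly K}) : polyin fracset q ->
  exists b (r : {poly R}), [/\ phi b != 0, (size r <= size q)%N
    & map_poly phi r = phi b *: q].
Proof.
move=> Eq.
have [//|i _|b [A [_ b0 hA]]] :=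
  @common_denominator _ _ phi (fun=> True) I _ (size q) (fun i => q`_i).
  by have [a [b [b0 ->]]] := Eq i; exists a, b.
exists b, (\poly_(i < size q) A i); split; [exact: b0 | exact: size_poly |].
apply/polyP => i; rewrite coef_map coef_poly coefZ; case: ltnP => iq.
  by have [_ /= ->] := hA i iq; rewrite mulrC.
by rewrite nth_default // mulr0 /= rmorph0.
Qed.

End Fracset.

Lemma size_map_poly_le (R K : nzRingType) (phi : {rmorphism R -> K}) (q : {poly R}) :
  (size (map_poly phi q) <= size q)%N.
Proof. by apply/leq_sizeP => i h; rewrite coef_map nth_default //; apply: rmorph0. Qed.

(** Dropping the top coefficients killed by [phi] ensures that the leading coefficient survives, as
    pseudo-division requires. *)
Lemma map_poly_trunc (R : nzRingType) (K : nzRingType) (phi : {rmorphism R -> K}) (q : {poly R}) :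
  exists r : {poly R}, size r = size (map_poly phi q) /\ map_poly phi r = map_poly phi q.
Proof.
set k := size (map_poly phi q).
have e : map_poly phi (\poly_(i < k) q`_i) = map_poly phi q.
  apply/polyP => i; rewrite !coef_map coef_poly; case: ltnP => // ki.
  have h0 : phi q`_i = 0 by rewrite -coef_map nth_default.
  by transitivity (0 : K); [exact: rmorph0 | exact: esym h0].
exists (\poly_(i < k) q`_i); split=> //; apply/eqP; rewrite eqn_leq size_poly /=.
by apply: leq_trans (size_map_poly_le phi _); rewrite e.
Qed.

(** Dividing by a polynomial whose leading coefficient is not invertible costs a power of that
    coefficient; the localizing element [h] of a generic point absorbs such powers. *)
Lemma pseudo_division (R : comNzRingType) (q g : {poly R}) : g != 0 ->
  exists M s t, (lead_coef g ^+ M) *: q = s * g + t /\ (size t < size g)%N.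
Proof.
move=> g0; exists (Pdiv.Ring.rscalp q g), (Pdiv.Ring.rdivp q g), (Pdiv.Ring.rmodp q g).
by rewrite -Pdiv.ComRing.rdivp_eq Pdiv.Ring.ltn_rmodp.
Qed.

Lemma pseudo_map (R S : comNzRingType) (phi : {rmorphism R -> S}) (c : R) M q s g t :
  c ^+ M *: q = s * g + t ->
  phi c ^+ M *: map_poly phi q = map_poly phi s * map_poly phi g + map_poly phi t.
Proof.
move=> /(congr1 (map_poly phi)).
by rewrite -mul_polyC !rmorphD !rmorphM /= map_polyC /= rmorphXn mul_polyC.
Qed.

Lemma pseudo_root (R S : comNzRingType) (phi : {rmorphism R -> S}) (c : R) M q s g t y :
  c ^+ M *: q = s * g + t -> root (map_poly phi g) y ->
  phi c ^+ M * (map_poly phi q).[y] = (map_poly phi t).[y].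
Proof.
move=> /(pseudo_map phi) /(congr1 (horner^~ y)) e /rootP ry.
by move: e; rewrite hornerZ hornerD hornerM ry mulr0 add0r.
Qed.

Lemma pseudo_rmorph (R S : comNzRingType) (psi : {rmorphism {poly R} -> S}) (c : R) M q s g t :
  c ^+ M *: q = s * g + t ->
  psi c%:P ^+ M * psi q = psi s * psi g + psi t.
Proof.
by move=> /(congr1 psi); rewrite -mul_polyC !rmorphD !rmorphM /= polyC_exp rmorphXn.
Qed.

Section MuniEval.
Context (n : nat) (R : comNzRingType).
Local Notation widen := (widen_ord (leqnSn n)).

Lemma mmap_muni (K : comNzRingType) (phi : {rmorphism R -> K}) (xi : 'I_n.+1 -> K)
    (f : {mpoly R[n.+1]}) :
  mmap phi xi f =
  (map_poly (mmap phi (fun i => xi (widen i))) (muni f)).[xi ord_max].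
Proof.
rewrite muniE rmorph_sum horner_sum; apply: eq_bigr => m _.
rewrite -mul_polyC rmorphM /= map_polyC /= map_polyXn hornerCM hornerXn.
rewrite mmapZ mmapX -mulrA; congr (_ * _).
rewrite /mmap1 big_ord_recr /=; congr (_ * _).
by apply: eq_bigr => i _; rewrite mnmE.
Qed.

(** A left inverse of [muni] which is by construction a ring morphism, so that approximations and
    ideal memberships pass through it. *)
Definition unmuni (q : {poly {mpoly R[n]}}) : {mpoly R[n.+1]} :=
  (map_poly (@mwiden n R) q).['X_ord_max].

Lemma unmuni_zmod : zmod_morphism unmuni.
Proof. by move=> p q; rewrite /unmuni rmorphB hornerD hornerN. Qed.
HB.instance Definition _ := GRing.isZmodMorphism.Build _ _ unmuni unmuni_zmod.
Lemma unmuni_monoid : monoid_morphism unmuni.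
Proof. by split=> [|p q]; rewrite /unmuni ?rmorph1 ?hornerE // rmorphM hornerM. Qed.
HB.instance Definition _ := GRing.isMonoidMorphism.Build _ _ unmuni unmuni_monoid.

Lemma unmuniK f : unmuni (muni f) = f.
Proof.
rewrite -[RHS]comp_mpoly_id /comp_mpoly.
have -> : tnth [tuple 'X_i | i < n.+1] = (fun i => 'X_i : {mpoly R[n.+1]}).
  by apply: functional_extensionality_dep => i; rewrite tnth_mktuple.
exact: (esym (@mmap_muni _ (@mpolyC n.+1 R) (fun i => 'X_i) f)).
Qed.

Lemma unmuniC c : unmuni c%:P = mwiden c.
Proof. by rewrite /unmuni map_polyC hornerC. Qed.

Lemma mmap_mwiden (K : comNzRingType) (phi : {rmorphism R -> K}) (xi : 'I_n.+1 -> K) f :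
  mmap phi xi (mwiden f) = mmap phi (fun i => xi (widen i)) f.
Proof.
elim/mpolyind: f => [|c m f _ _ IH]; first by rewrite !raddf0.
rewrite !raddfD /= IH mwidenZ mwidenX !mmapZ !mmapX; congr (_ * _ + _).
rewrite /mmap1 big_ord_recr /= mnmwiden_ordmax expr0 mulr1.
by apply: eq_bigr => i _; rewrite mnmwiden_widen.
Qed.

Lemma mmap_unmuni (K : comNzRingType) (phi : {rmorphism R -> K}) (xi : 'I_n.+1 -> K) q :
  mmap phi xi (unmuni q) =
  (map_poly (mmap phi (fun i => xi (widen i))) q).[xi ord_max].
Proof.
rewrite /unmuni -(horner_map (mmap phi xi)) /= -map_poly_comp mmapX mmap1U.
by congr (_.[_]); apply: eq_map_poly => f /=; apply: mmap_mwiden.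
Qed.

End MuniEval.

Lemma exprM_shuffle (R : comPzRingType) (x y z : R) N M :
  (x * y) ^+ (N + M) * z = (x ^+ M * y ^+ N) * (x ^+ N * (y ^+ M * z)).
Proof. by rewrite exprMn !exprD; ring. Qed.

Lemma ltn_add_pred (i j : nat) : (1 < j)%N -> (i < (i + j).-1)%N.
Proof. by case: j => [|[|j]] // _; rewrite !addnS ltnS leq_addr. Qed.

(** * Construction of generic points *)

Section Tower.
Context (T : Type) (U : set_system T) (FU : UltraFilter U).
Context (F_ : T -> closedFieldType) (C : fieldType).
Context (a : {rmorphism C -> ufield FU F_}).
Context (K_ : T -> closedFieldType) (i_ : forall t, {rmorphism F_ t -> K_ t}).
Context (b : {rmorphism C -> ufield FU K_}).
Hypothesis a_surj : forall z, exists c, a c = z.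
Hypothesis bE : forall c c_, a c = ulimf FU c_ -> b c = ulimf FU (fun t => i_ t (c_ t)).
Hypothesis char0 : [pchar ufield FU K_] =i pred0.
Context (L : fieldType) (lam : {rmorphism C -> L}).

Local Notation apx := (apx a).
Local Notation apx_ap := (apx_ap a).
Local Notation K := (ufield FU K_).
Local Notation lim := (@ulimf T U FU K_).
Local Notation widen n := (widen_ord (leqnSn n)).

Lemma apx_Z n c c_ (f : {mpoly C[n]}) f_ : a c = ulimf FU c_ -> apx f f_ ->
  apx (c *: f) (fun t => c_ t *: f_ t).
Proof.
move=> hc hf; rewrite -mul_mpolyC.
have -> : (fun t => c_ t *: f_ t) = (fun t => (c_ t)%:MP * f_ t).
  by apply: functional_extensionality_dep => t; rewrite mul_mpolyC.
by apply: apx_M => //; apply: apx_C.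
Qed.

Lemma apx_mwiden n (f : {mpoly C[n]}) : apx (mwiden f) (fun t => mwiden (ap a t f)).
Proof.
rewrite {1}(mpolyE f) raddf_sum.
have -> : (fun t => mwiden (ap a t f)) = (fun t => \sum_(m <- msupp f)
    sval (ufield_surj (a f@_m)) t *: 'X_[mnmwiden m]).
  apply: functional_extensionality_dep => t; rewrite raddf_sum.
  by apply: eq_bigr => m _ /=; rewrite mwidenZ mwidenX.
apply: apx_sum => m; rewrite /= mwidenZ mwidenX.
by apply: apx_Z; [rewrite /ulimf; case: ufield_surj | apply: apx_X].
Qed.

Lemma coef_map_ap n t (q : {poly {mpoly C[n]}}) i :
  (map_poly (ap a t) q)`_i = ap a t q`_i.
Proof. by apply: coef_map_id0; apply: ap0. Qed.

Lemma size_map_ap n t (q : {poly {mpoly C[n]}}) :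
  (size (map_poly (ap a t) q) <= size q)%N.
Proof. by apply/leq_sizeP => i h; rewrite coef_map_ap nth_default // ap0. Qed.

Lemma apx_unmuni n (q : {poly {mpoly C[n]}}) :
  apx (unmuni q) (fun t => unmuni (map_poly (ap a t) q)).
Proof.
rewrite {1}/unmuni (horner_coef_wide _ (size_map_poly_le _ q)).
have -> : (fun t => unmuni (map_poly (ap a t) q)) =
    (fun t => \sum_(i < size q) mwiden (ap a t q`_i) * 'X_ord_max ^+ i).
  apply: functional_extensionality_dep => t; rewrite /unmuni.
  rewrite (horner_coef_wide _ (leq_trans (size_map_poly_le _ _) (size_map_ap t q))).
  by apply: eq_bigr => i _; rewrite coef_map coef_map_ap.
apply: apx_sum => i; apply: apx_M; last by apply: apx_exp; apply: apx_X.
by rewrite coef_map; apply: apx_mwiden.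
Qed.

(** Three evaluations are compared from here on: [evx] at the given point, [evt] at the point of a
    single factor, [evl] at the limit point in the ultraproduct. *)
Definition evx n (x : 'I_n -> L) (f : {mpoly C[n]}) : L := mmap lam x f.
HB.instance Definition _ n (x : 'I_n -> L) := GRing.RMorphism.copy (evx x) (mmap lam x).
Definition evt n (xi : 'I_n -> forall t, K_ t) t (f : {mpoly (F_ t)[n]}) : K_ t :=
  mmap (i_ t) (xi ^~ t) f.
HB.instance Definition _ n (xi : 'I_n -> forall t, K_ t) t :=
  GRing.RMorphism.copy (evt xi (t := t)) (mmap (i_ t) (xi ^~ t)).
Definition evl n (xi : 'I_n -> forall t, K_ t) (f : {mpoly C[n]}) : K :=
  mmap b (fun i => lim (xi i)) f.
HB.instance Definition _ n (xi : 'I_n -> forall t, K_ t) :=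
  GRing.RMorphism.copy (evl xi) (mmap b (fun i => lim (xi i))).

(* The last clause is what keeps minimal polynomials over the function field of
   [x] irreducible over those of the [xi t]. *)
Definition generic_point n (x : 'I_n -> L) (xi : 'I_n -> forall t, K_ t) : Prop :=
  [/\ forall f, evx x f = 0 <-> evl xi f = 0,
      exists h G, [/\ evx x h != 0, forall g, g \in G -> evx x g = 0
        & \forall t \near U, forall f, evt xi f = 0 ->
            exists N, seq_ideal [seq ap a t g | g <- G] (ap a t h ^+ N * f)]
    & rel_alg_closed (fun t => fracset (evt xi (t := t))) (fracset (evl xi))].

Lemma evl_lim n xi (f : {mpoly C[n]}) f_ : apx f f_ ->
  evl xi f = lim (fun t => evt xi (f_ t)).
Proof. exact: (apx_eval bE). Qed.

Lemma fracset_evl_sub n xi :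
  fracset (@evl n xi) `<=` ulimset (FU := FU) (fun t => fracset (evt xi (t := t))).
Proof.
move=> _ [u [v [v0 ->]]] /=.
rewrite (evl_lim _ (apx_ap u)) (evl_lim _ (apx_ap v)) -ulimfV -ulimfM.
exists (fun t => evt xi (ap a t u) / evt xi (ap a t v)) => //.
have : \forall t \near U, evt xi (ap a t v) <> 0.
  apply/ultra_notP => /ulimf_eq0; rewrite -(evl_lim _ (apx_ap v)).
  exact/eqP.
by apply: filterS => t /eqP h; exists (ap a t u), (ap a t v).
Qed.

(** Without variables all function fields consist of constants. Relative closedness holds because
    [a] is onto: every sequence of constants of the [F_ t] has a limit coming from [C]. *)
Lemma generic_point0 (x : 'I_0 -> L) (xi : 'I_0 -> forall t, K_ t) : generic_point x xi.
Proof.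
have const (R : nzRingType) (f : {mpoly R[0]}) : f = (f@_0)%:MP.
  apply: msize1_polyC; rewrite msizeE; apply/bigmax_leqP_seq => m _ _.
  by rewrite ltnS leqn0 mdeg_eq0; apply/eqP/mnmP => -[].
split.
- move=> f; rewrite (const _ f) /evx /evl !mmapC.
  split=> /eqP; rewrite fmorph_eq0 => /eqP ->; exact: rmorph0.
- exists 1, [::]; split; [by rewrite rmorph1 oner_neq0 | by [] |].
  apply: filterE => t f; rewrite (const _ f) /evt !mmapC => /eqP.
  rewrite fmorph_eq0 => /eqP ->; exists 0%N.
  by rewrite mpolyC0 mulr0; apply: ideal0.
- move=> z [z_ <- hz] _.
  have {}hz : \forall t \near U, exists c, z_ t = i_ t c.
    apply: filterS hz => t [u [v [v0 ->]]]; exists (u@_0 / v@_0).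
    by rewrite /= {1}(const _ u) {1}(const _ v) /evt !mmapC fmorph_div.
  pose c_ t := if pselect (exists c, z_ t = i_ t c) is left h then sval (cid h) else 0.
  have [c ca] := a_surj (ulimf FU c_).
  have -> : lim z_ = b c.
    rewrite (bE ca); apply/ulimfP; apply: filterS hz => t h.
    by rewrite /c_; case: pselect => // h'; case: cid.
  exists c%:MP, 1; rewrite rmorph1 oner_neq0 divr1; split=> //.
  by rewrite /= /evl mmapC.
Qed.

Section Step.
Context (n : nat) (x : 'I_n.+1 -> L) (xi : 'I_n.+1 -> forall t, K_ t).
Local Notation x0 := (fun i => x (widen n i)).
Local Notation xi0 := (fun i => xi (widen n i)).
Local Notation ex := (evx x0).
Local Notation et t := (evt xi0 (t := t)).
Local Notation el := (evl xi0).
Local Notation x' := (x ord_max).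
Local Notation theta := (xi ord_max).
Hypothesis gen : generic_point x0 xi0.

Lemma fracset_step_t t : fracset (evt xi (t := t)) = ratext (fracset (et t)) (theta t).
Proof.
apply/seteqP; split=> z.
  move=> [u [v [v0 ->]]]; exists (map_poly (et t) (muni u)), (map_poly (et t) (muni v)).
  by move: v0; rewrite /= /evt !mmap_muni => v0; split=> // i; rewrite coef_map; apply: fracset_id.
move=> [u [v [Eu Ev v0 ->]]].
have sE := fracset_subfield (evt xi (t := t)).
have th : fracset (evt xi (t := t)) (theta t).
  by exists 'X_ord_max, 1; rewrite rmorph1 oner_neq0 divr1 /= /evt mmapX mmap1U.
have sub : fracset (et t) `<=` fracset (evt xi (t := t)).
  move=> _ [p [q [q0 ->]]]; exists (mwiden p), (mwiden q).
  by rewrite /= /evt !mmap_mwiden.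
by apply: subfield_div => //; apply: polyin_horner => // i; apply: sub.
Qed.

Lemma fracset_step : fracset (evl xi) = ratext (fracset el) (lim theta).
Proof.
apply/seteqP; split=> z.
  move=> [u [v [v0 ->]]]; exists (map_poly el (muni u)), (map_poly el (muni v)).
  by move: v0; rewrite /= /evl !mmap_muni => v0; split=> // i; rewrite coef_map; apply: fracset_id.
move=> [u [v [Eu Ev v0 ->]]].
have sE := fracset_subfield (evl xi).
have th : fracset (evl xi) (lim theta).
  by exists 'X_ord_max, 1; rewrite rmorph1 oner_neq0 divr1 /= /evl mmapX mmap1U.
have sub : fracset el `<=` fracset (evl xi).
  move=> _ [p [q [q0 ->]]]; exists (mwiden p), (mwiden q).
  by rewrite /= /evl !mmap_mwiden.
by apply: subfield_div => //; apply: polyin_horner => // i; apply: sub.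
Qed.

Lemma rac_step_trans :
  (\forall t \near U, forall q, root (map_poly (et t) q) (theta t) -> map_poly (et t) q = 0) ->
  rel_alg_closed (fun t => fracset (evt xi (t := t))) (fracset (evl xi)).
Proof.
move=> tr; have [_ _ rac] := gen; rewrite fracset_step.
rewrite (@functional_extensionality_dep _ _ _ _ fracset_step_t).
apply: (rac_trans _ _ _ rac char0).
- by move=> t; apply: fracset_subfield.
- exact: fracset_subfield.
- exact: fracset_evl_sub.
apply: filterS tr => t tr p Ep rp.
have [c [r [c0 _ e]]] := fracset_clear Ep.
have /eqP : map_poly (et t) r = 0 by apply: tr; rewrite e rootZ.
by rewrite e scaler_eq0 (negPf c0) => /eqP.
Qed.

Lemma rac_step_alg (g : {poly {mpoly C[n]}}) : map_poly el g != 0 ->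
  root (map_poly el g) (lim theta) ->
  rel_alg_closed (fun t => fracset (evt xi (t := t))) (fracset (evl xi)).
Proof.
move=> g0 rg; have [_ _ rac] := gen; rewrite fracset_step.
rewrite (@functional_extensionality_dep _ _ _ _ fracset_step_t).
apply: (rac_alg _ _ _ rac char0).
- by move=> t; apply: fracset_subfield.
- exact: fracset_subfield.
- exact: fracset_evl_sub.
by exists (map_poly el g); split=> // i; rewrite coef_map; apply: fracset_id.
Qed.

Lemma coef_ideal h (G : seq {mpoly C[n]}) t (q : {poly {mpoly (F_ t)[n]}}) :
  (forall f, et t f = 0 -> exists N, seq_ideal [seq ap a t g | g <- G] (ap a t h ^+ N * f)) ->
  map_poly (et t) q = 0 ->
  exists N, seq_ideal [seq mwiden (ap a t g) | g <- G] (mwiden (ap a t h) ^+ N * unmuni q).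
Proof.
move=> hG q0.
have hN i : exists N, seq_ideal [seq ap a t g | g <- G] (ap a t h ^+ N * q`_i).
  by apply: hG; have := congr1 (fun p : {poly _} => p`_i) q0; rewrite coef_map coef0.
(* The sum of the exponents serves all coefficients of [q] at once. *)
pose N i := sval (cid (hN i)); pose M := \sum_(i < size q) N i.
have HM i : (i < size q)%N -> seq_ideal [seq ap a t g | g <- G] (ap a t h ^+ M * q`_i).
  move=> iq; have NM : (N i <= M)%N.
    by rewrite /M (bigD1 (Ordinal iq)) //= leq_addr.
  rewrite -(subnK NM) exprD -mulrA; apply: idealM.
  by rewrite /N; case: cid.
exists M; rewrite {1}/unmuni (horner_coef_wide _ (size_map_poly_le _ q)) mulr_sumr.
apply: ideal_sum => i _; rewrite coef_map mulrA mulrC; apply: idealM.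
rewrite -rmorphXn -rmorphM (_ : [seq _ | _ <- _] = map (@mwiden _ _) (map (ap a t) G)).
  by apply: seq_ideal_map; apply: HM.
by rewrite -map_comp.
Qed.

Lemma coef_el_eq0 (q : {poly {mpoly C[n]}}) i :
  (map_poly ex q)`_i = 0 <-> (map_poly el q)`_i = 0.
Proof. by have [h _ _] := gen; rewrite !coef_map; exact: h. Qed.

Lemma map_el_eq0 (q : {poly {mpoly C[n]}}) :
  map_poly ex q = 0 <-> map_poly el q = 0.
Proof.
split=> h; apply/polyP => i; rewrite coef0.
  by apply/coef_el_eq0; rewrite h coef0.
by apply/coef_el_eq0; rewrite h coef0.
Qed.

Lemma size_map_el (q : {poly {mpoly C[n]}}) :
  size (map_poly ex q) = size (map_poly el q).
Proof.
apply/eqP; rewrite eqn_leq; apply/andP; split; apply/leq_sizeP => i h;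
by apply/coef_el_eq0; rewrite nth_default.
Qed.

Lemma evx_muni f : evx x f = (map_poly ex (muni f)).[x'].
Proof. exact: mmap_muni. Qed.
Lemma evl_muni f : evl xi f = (map_poly el (muni f)).[lim theta].
Proof. exact: mmap_muni. Qed.
Lemma evt_muni t f : evt xi f = (map_poly (et t) (muni f)).[theta t].
Proof. exact: mmap_muni. Qed.

Lemma ap_mwiden (G : seq {mpoly C[n]}) : \forall t \near U,
  [seq ap a t (mwiden g) | g <- G] = [seq mwiden (ap a t g) | g <- G].
Proof.
elim: G => [|g G IH]; first exact: filterE.
have h : \forall t \near U, ap a t (mwiden g) = mwiden (ap a t g).
  exact: apx_uniq (apx_ap _) (apx_mwiden g).
by apply: filterS2 IH h => t /= -> ->.
Qed.

(** At a transcendental coordinate a polynomial vanishes exactly when all its coefficients in the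
    last variable vanish at the previous point, so the old [h] and [G] still serve. *)
Lemma generic_step_trans :
  (forall q, root (map_poly ex q) x' -> map_poly ex q = 0) ->
  (\forall t \near U, forall q, root (map_poly (et t) q) (theta t) -> map_poly (et t) q = 0) ->
  generic_point x xi.
Proof.
move=> trx trt; have [h1 [h [G [h0 G0 hG]]] rac] := gen.
split; last exact: rac_step_trans.
- move=> f; rewrite evx_muni; split=> [/rootP/trx/map_el_eq0 e|].
    by rewrite evl_muni e horner0.
  have pf := apx_unmuni (muni f); rewrite unmuniK in pf.
  rewrite (evl_lim _ pf) => /ulimf_eq0 e.
  suff -> : map_poly ex (muni f) = 0 by rewrite horner0.
  apply/polyP => i; rewrite coef0 coef_map; apply/h1.
  rewrite (evl_lim _ (apx_ap _)); apply/ulimf_eq0.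
  apply: filterS2 e trt => t; rewrite {1}/evt mmap_unmuni => /rootP r /(_ _ r) e.
  by rewrite -coef_map_ap -coef_map e coef0.
exists (mwiden h), [seq mwiden g | g <- G]; split.
- by rewrite /evx mmap_mwiden.
- by move=> _ /mapP[g gG ->]; rewrite /evx mmap_mwiden; apply: G0.
have hh := ap_mwiden [:: h]; have hGG := ap_mwiden G.
near=> t.
have tr : forall q, root (map_poly (et t) q) (theta t) -> map_poly (et t) q = 0 by near: t.
have hGt : forall f, et t f = 0 ->
  exists N, seq_ideal [seq ap a t g | g <- G] (ap a t h ^+ N * f) by near: t.
have [eh] : [seq ap a t (mwiden h) | h <- [:: h]] = [seq mwiden (ap a t h) | h <- [:: h]].
  by near: t.
have eG : [seq ap a t (mwiden g) | g <- G] = [seq mwiden (ap a t g) | g <- G] by near: t.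
move=> f; rewrite evt_muni => /rootP/tr e.
have [N] := coef_ideal hGt e.
by rewrite -eh -eG unmuniK => hN; exists N; rewrite -map_comp.
Unshelve. all: by end_near.
Qed.

Section Algebraic.
Context (g : {poly {mpoly C[n]}}).
Hypothesis size_g : size (map_poly ex g) = size g.
Hypothesis g_gt1 : (1 < size g)%N.
Hypothesis min_x : forall r, (size (map_poly ex r) < size g)%N ->
  root (map_poly ex r) x' -> map_poly ex r = 0.
Hypothesis root_x : root (map_poly ex g) x'.
Hypothesis root_l : root (map_poly el g) (lim theta).

Let c := lead_coef g.

Let exg0 : map_poly ex g != 0.
Proof. by rewrite -size_poly_gt0 size_g ltnW. Qed.

Let exc0 : ex c != 0.
Proof.
have := exg0; rewrite -lead_coef_eq0 lead_coefE size_g coef_map.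
by rewrite -lead_coefE.
Qed.

Let elg0 : map_poly el g != 0.
Proof. by rewrite -size_poly_gt0 -size_map_el size_poly_gt0. Qed.

Let elc0 : el c != 0.
Proof. by apply: contra_neq exc0 => h; have [h1 _ _] := gen; apply/h1. Qed.

Let g0 : g != 0.
Proof. by rewrite -size_poly_gt0 ltnW. Qed.

(** Minimality is known at [x'] and is wanted at [lim theta], of which only [root_l] is known. A
    shorter relation [r] at [lim theta] pseudo-divides [g] with a remainder that vanishes by
    induction. This factorization of [g] carries over to [ex], where [x'] is then a root of a factor
    shorter than [g]. *)
Lemma min_el r : (size (map_poly el r) < size g)%N ->
  root (map_poly el r) (lim theta) -> map_poly el r = 0.
Proof.
have [k] := ubnP (size (map_poly el r)); elim: k r => // k IH r.
rewrite ltnS => rk rg rr; apply/eqP; apply: contraT => r0.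
have [r' [sr' er']] := map_poly_trunc el r; rewrite -!er' in r0 rr rk rg sr'.
have r'0 : r' != 0 by rewrite -size_poly_gt0 sr' size_poly_gt0.
have ellc0 : el (lead_coef r') != 0.
  by have := r0; rewrite -lead_coef_eq0 lead_coefE -sr' coef_map -lead_coefE.
have exlc0 : ex (lead_coef r') != 0.
  by apply: contra_neq ellc0 => h; have [h1 _ _] := gen; apply/h1.
have [M [s [t [e st]]]] := pseudo_division g r'0.
have elt : map_poly el t = 0.
  apply: IH.
  - apply: leq_ltn_trans (size_map_poly_le _ _) _; apply: leq_trans st _.
    by rewrite sr'.
  - apply: leq_ltn_trans (size_map_poly_le _ _) _; apply: leq_trans st _.
    by rewrite sr' ltnW.
  by apply/rootP; rewrite -(pseudo_root e rr) (rootP root_l) mulr0.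
have ext : map_poly ex t = 0 by apply/map_el_eq0.
have ex_e := pseudo_map ex e; rewrite ext addr0 in ex_e.
have exM0 : ex (lead_coef r') ^+ M != 0 by rewrite expf_neq0.
have ex_n0 : map_poly ex s * map_poly ex r' != 0.
  by rewrite -ex_e scaler_eq0 negb_or exM0.
have : root (map_poly ex s * map_poly ex r') x' by rewrite -ex_e rootZ.
move: ex_n0; rewrite mulf_eq0 negb_or => /andP[s0 exr0].
have sr1 : (1 < size (map_poly ex r'))%N.
  by rewrite size_map_el; apply: root_size_gt1 r0 rr.
have sz : size g = (size (map_poly ex s) + size (map_poly ex r')).-1.
  by rewrite -(size_mul s0 exr0) -ex_e (size_scale _ exM0).
rewrite rootM => /orP[rs|rr']; last first.
  have sr'g : (size (map_poly ex r') < size g)%N by rewrite size_map_el.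
  by have := exr0; rewrite (min_x sr'g rr') eqxx.
have ssg : (size (map_poly ex s) < size g)%N by rewrite sz; apply: ltn_add_pred.
by have := s0; rewrite (min_x ssg rs) eqxx.
Qed.

(** Shorter relations in almost all factors have bounded size, so they have a limit: a non-zero
    polynomial over the ultraproduct of the fields [fracset (et t)] which vanishes at [lim theta].
    It is too short, because by [rac_minpoly] the minimal polynomial over [fracset el] remains
    minimal over that larger field. *)
Lemma min_et : \forall t \near U, forall r, (size (map_poly (et t) r) < size g)%N ->
  root (map_poly (et t) r) (theta t) -> map_poly (et t) r = 0.
Proof.
have [_ _ rac] := gen.
have sE := fracset_subfield el.
have sEt t := fracset_subfield (et t).
have alg : algin (fracset el) (lim theta).
  by exists (map_poly el g); split=> // i; rewrite coef_map; apply: fracset_id.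
have [m mm] := minpoly_exists sE alg; have [Em mon_m rm _] := mm.
have m0 := monic_neq0 mon_m.
have gm : (size g <= size m)%N.
  rewrite leqNgt; apply/negP => mg.
  have [d [r [d0 _ e]]] := fracset_clear Em.
  have := @min_el r; rewrite e size_scale // rootZ // => /(_ mg rm) /eqP.
  by rewrite scaler_eq0 (negPf d0) (negPf m0).
have [_ _ _ mmin] := rac_minpoly sEt sE (@fracset_evl_sub _ xi0) rac mm.
case: (ultra_dec (fun t => forall r, (size (map_poly (et t) r) < size g)%N ->
  root (map_poly (et t) r) (theta t) -> map_poly (et t) r = 0)) => // h; exfalso.
pose bad t p := [/\ polyin (fracset (et t)) p, (size p <= (size g).-1)%N,
  root p (theta t) & p != 0].
have {}h : \forall t \near U, exists p, bad t p.
  apply: filterS h => t /existsNP[r /not_implyP[sr /not_implyP[rr /eqP r0]]].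
  exists (map_poly (et t) r); split=> //.
    by move=> i; rewrite coef_map; apply: fracset_id.
  by rewrite -ltnS prednK // ltnW.
pose p_ t := if pselect (exists p, bad t p) is left h then sval (cid h) else 0.
have {}h : \forall t \near U, bad t (p_ t).
  by apply: filterS h => t h; rewrite /p_; case: pselect => // h'; case: cid.
have sp : \forall t \near U, (size (p_ t) <= (size g).-1)%N by apply: filterS h => t [].
have pp := papx_of_bound FU sp; set p := \poly_(i < _) _ in pp.
have Lp : polyin (ulimset (FU := FU) (fun t => fracset (et t))) p.
  move=> i; have [_ ->] := pp; exists (fun t => (p_ t)`_i) => //.
  by apply: filterS h => t [hp _ _ _]; apply: hp.
have rp : root p (lim theta).
  apply/rootP; rewrite (papx_horner _ pp); apply/ulimf_eq0.
  by apply: filterS h => t [_ _ /rootP].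
(* Among the finitely many possible positions, one carries a non-zero coefficient of [p_ t] for
   almost all [t]. *)
have p0 : p != 0.
  have : \forall t \near U, exists i : 'I_(size g), (p_ t)`_i <> 0.
    apply: filterS h => t [_ st _ pt0].
    have lt : ((size (p_ t)).-1 < size g)%N.
      apply: leq_ltn_trans (leq_pred _) _.
      by apply: leq_ltn_trans st _; rewrite ltn_predL ltnW.
    by exists (Ordinal lt); apply/eqP; rewrite -lead_coefE lead_coef_eq0.
  move=> /ultra_fin[i hi]; apply/eqP => p0; have [_ /(_ i)] := pp.
  rewrite p0 coef0 => /esym/ulimf_eq0 h0; apply: (@ultra_false _ U).
  by apply: filterS2 hi h0 => t.
have := leq_trans gm (leq_trans (dvdp_leq p0 (mmin _ Lp rp)) (size_poly _ _)).
by rewrite leqNgt ltn_predL ltnW.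
Qed.

Let reduce (R : fieldType) (phi : {rmorphism {mpoly C[n]} -> R}) (y : R) M q s t :
  root (map_poly phi g) y -> phi c != 0 -> c ^+ M *: q = s * g + t ->
  (map_poly phi q).[y] = 0 <-> (map_poly phi t).[y] = 0.
Proof.
move=> rg c0 e; rewrite -(pseudo_root e rg); split=> [->|/eqP]; first by rewrite mulr0.
by rewrite mulf_eq0 expf_eq0 (negPf c0) andbF => /eqP.
Qed.

(** If [f] vanishes at the point of a factor, so does its pseudo-remainder modulo the approximation
    of [g]. The remainder is short, so by [min_et] its coefficients vanish at the previous point and
    the old [h] and [G] handle it. Hence [g] joins [G], and its leading coefficient [c] joins
    [h]. *)
Lemma generic_step_alg : generic_point x xi.
Proof.
have [h1 [h [G [h0 G0 hG]]] rac] := gen.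
split; last exact: rac_step_alg elg0 root_l.
- move=> f; rewrite evx_muni evl_muni.
  have [M [s [t [e st]]]] := pseudo_division (muni f) g0.
  have sm (R : fieldType) (phi : {rmorphism {mpoly C[n]} -> R}) :
      (size (map_poly phi t) < size g)%N.
    exact: leq_ltn_trans (size_map_poly_le _ _) st.
  split.
    move=> /(reduce root_x exc0 e)/rootP/(min_x (sm _ _))/map_el_eq0 t0.
    by apply/(reduce root_l elc0 e); rewrite t0 horner0.
  move=> /(reduce root_l elc0 e)/rootP/(min_el (sm _ _))/map_el_eq0 t0.
  by apply/(reduce root_x exc0 e); rewrite t0 horner0.
exists (mwiden (h * c)), (unmuni g :: [seq mwiden g | g <- G]); split.
- by rewrite /evx mmap_mwiden rmorphM mulf_neq0.
- move=> f; rewrite inE => /orP[/eqP ->|/mapP[k kG ->]].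
    by rewrite /evx mmap_unmuni; apply/rootP.
  by rewrite /evx mmap_mwiden; apply: G0.
have hc0 : \forall t \near U, ap a t c <> 0.
  apply/ultra_notP => /ap_eq0 c_0; move: exc0; rewrite c_0 rmorph0 eqxx //.
have hroot : \forall t \near U, root (map_poly (et t) (map_poly (ap a t) g)) (theta t).
  have : evl xi (unmuni g) = 0 by rewrite /evl mmap_unmuni; apply/rootP.
  rewrite (evl_lim _ (apx_unmuni g)) => /ulimf_eq0; apply: filterS => t.
  by rewrite /evt mmap_unmuni => /rootP.
have hM := ap_M a h c.
have hh := ap_mwiden [:: h * c]; have hGG := ap_mwiden G.
have hg : \forall t \near U, ap a t (unmuni g) = unmuni (map_poly (ap a t) g).
  exact: apx_uniq (apx_ap _) (apx_unmuni g).
have hmin := min_et.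
near=> t.
have c_0 : ap a t c <> 0 by near: t.
have r_t : root (map_poly (et t) (map_poly (ap a t) g)) (theta t) by near: t.
have [eh] : [seq ap a t (mwiden h) | h <- [:: h * c]] =
  [seq mwiden (ap a t h) | h <- [:: h * c]] by near: t.
have eM : ap a t (h * c) = ap a t h * ap a t c by near: t.
have eG : [seq ap a t (mwiden g) | g <- G] = [seq mwiden (ap a t g) | g <- G] by near: t.
have eg : ap a t (unmuni g) = unmuni (map_poly (ap a t) g) by near: t.
have mt : forall r, (size (map_poly (et t) r) < size g)%N ->
  root (map_poly (et t) r) (theta t) -> map_poly (et t) r = 0 by near: t.
have hGt : forall f, et t f = 0 ->
  exists N, seq_ideal [seq ap a t g | g <- G] (ap a t h ^+ N * f) by near: t.
set gt := map_poly (ap a t) g in r_t eg.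
(* Approximation keeps the degree of [g] because the leading coefficient [c] stays non-zero. *)
have sgt : size gt = size g.
  apply/eqP; rewrite eqn_leq size_map_ap /=.
  rewrite leqNgt; apply/negP => lt; apply: c_0.
  by rewrite -coef_map_ap nth_default // -ltnS prednK // ltnW.
have lgt : lead_coef gt = ap a t c by rewrite lead_coefE sgt coef_map_ap.
move=> f; rewrite evt_muni => rf.
have gt0 : gt != 0 by rewrite -size_poly_gt0 sgt ltnW.
have [M [s [r [e sr]]]] := pseudo_division (muni f) gt0; rewrite lgt in e.
have r0 : map_poly (et t) r = 0.
  apply: mt; first by apply: leq_ltn_trans (size_map_poly_le _ _) _; rewrite -sgt.
  by apply/rootP; rewrite -(pseudo_root e r_t) rf mulr0.
have [N hN] := coef_ideal hGt r0.
exists (N + M)%N; rewrite /= -map_comp.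
rewrite (_ : [seq _ | _ <- _] = [seq mwiden (ap a t g) | g <- G]) // eg eh eM rmorphM /=.
have e' := pseudo_rmorph (@unmuni _ _) e; rewrite /= unmuniC unmuniK in e'.
set H := mwiden (ap a t h) in hN *; set c' := mwiden (ap a t c) in e' *.
have -> : (H * c') ^+ (N + M) * f = (H ^+ M * c' ^+ N) * (H ^+ N * (c' ^+ M * f)).
  exact: exprM_shuffle.
rewrite e' mulrDr.
suff h2 : seq_ideal (unmuni gt :: [seq mwiden (ap a t g) | g <- G])
    (H ^+ M * c' ^+ N * (H ^+ N * (unmuni s * unmuni gt) + H ^+ N * unmuni r)) by [].
apply: idealM; apply: idealD.
  by apply: idealM; apply: idealM; apply: seq_ideal_gen; rewrite mem_head.
have h3 y : y \in [seq mwiden (ap a t g) | g <- G] ->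
    seq_ideal (unmuni gt :: [seq mwiden (ap a t g) | g <- G]) y.
  by move=> yG; apply: seq_ideal_gen; rewrite inE yG orbT.
exact: seq_ideal_le h3 hN.
Unshelve. all: by end_near.
Qed.

End Algebraic.

End Step.

Lemma widen_ext (V : Type) n (y : 'I_n -> V) (z : V) :
  exists y' : 'I_n.+1 -> V, (fun i => y' (widen n i)) = y /\ y' ord_max = z.
Proof.
exists (fun i => if unlift ord_max i is Some j then y j else z); split; last first.
  by rewrite unlift_none.
apply: functional_extensionality_dep => i.
have -> : widen n i = lift ord_max i by apply: val_inj; rewrite /= /bump leqNgt ltn_ord.
by rewrite liftK.
Qed.

Hypothesis transcendental : forall t k (eta : 'I_k -> K_ t), exists tau,
  forall q : {poly {mpoly (F_ t)[k]}},
    root (map_poly (mmap (i_ t) eta) q) tau -> map_poly (mmap (i_ t) eta) q = 0.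

Theorem generic_point_exists n (x : 'I_n -> L) : exists xi, generic_point x xi.
Proof.
elim: n x => [|n IH] x; first by exists (fun _ _ => 0); apply: generic_point0.
have [xi0 gen0] := IH (fun i => x (widen n i)).
pose ex := evx (fun i => x (widen n i)).
case: (pselect (exists q, map_poly ex q != 0 /\ root (map_poly ex q) (x ord_max))); last first.
  move=> tr; pose tau t := sval (cid (transcendental (fun i => xi0 i t))).
  have [xi [e1 e2]] := widen_ext xi0 tau; exists xi.
  apply: generic_step_trans; rewrite ?e1 ?e2 //.
    move=> q rq; apply/eqP; apply: contraT => q0; case: tr; by exists q.
  apply: filterE => t; rewrite /tau; by case: cid.
move=> [q0 [q00 rq0]].
pose P k := `[< exists q, [/\ map_poly ex q != 0, root (map_poly ex q) (x ord_max)
  & size (map_poly ex q) = k] >].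
have exP : exists k, P k by exists (size (map_poly ex q0)); apply/asboolP; exists q0.
case: (ex_minnP exP) => k /asboolP[q [qn0 rq sq]] kmin.
have [g [sg eg]] := map_poly_trunc ex q; rewrite -eg in sg qn0 rq sq.
have root_gt1 := root_size_gt1 qn0 rq.
have : size (map_poly (evl xi0) g) != 1%N.
  (* The last coordinate of [xi1] is a dummy: [size_map_el] is stated for a full point but depends
     only on the previous coordinates. *)
  have [xi1 [e1 _]] := widen_ext xi0 (fun=> 0).
  have := @size_map_el _ x xi1; rewrite e1 => <- //.
  by rewrite neq_ltn root_gt1 orbT.
(* The root is taken in the ultraproduct, which is algebraically closed; any representative of it
   supplies the new coordinates in the factors. *)
move=> /closed_rootP[z rz]; have [theta zE] := ulimf_surj z.
have [xi [e1 e2]] := widen_ext xi0 theta; exists xi.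
apply: (@generic_step_alg _ x xi _ g); rewrite ?e1 ?e2 ?zE //.
- by rewrite sg.
- move=> r sr rr; apply/eqP; apply: contraT => r0.
  have /kmin : P (size (map_poly ex r)) by apply/asboolP; exists r.
  by rewrite -sq -sg leqNgt sr.
Qed.

End Tower.

(** * Approximations of prime ideals *)

Section DomainFractions.
Context (A : comPzRingType) (dA : is_domain A).

(* The idle [let] attaches the domain hypothesis to this copy of [A]. *)
Definition dom_type : Type := let _ := dA in A.
HB.instance Definition _ := GRing.ComPzRing.copy dom_type A.

Lemma dom_one_neq0 : (1 : dom_type) != 0.
Proof. by apply/eqP; case: dA. Qed.
HB.instance Definition _ := GRing.PzSemiRing_isNonZero.Build dom_type dom_one_neq0.

Definition dom_unit : pred dom_type := fun x => `[< exists y, y * x = 1 >].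
Definition dom_inv (x : dom_type) : dom_type :=
  if pselect (exists y, y * x = 1) is left h then sval (cid h) else x.

Lemma dom_mulVx : {in dom_unit, left_inverse 1 dom_inv *%R}.
Proof.
move=> x /asboolP h; rewrite /dom_inv; case: pselect => // h'.
by case: cid.
Qed.

Lemma dom_unitPl (x y : dom_type) : y * x = 1 -> dom_unit x.
Proof. by move=> h; apply/asboolP; exists y. Qed.

Lemma dom_inv0id : {in [predC dom_unit], dom_inv =1 id}.
Proof.
move=> x /negP h; rewrite /dom_inv; case: pselect => // h'.
by case: h; apply/asboolP.
Qed.

HB.instance Definition _ :=
  GRing.ComNzRing_hasMulInverse.Build dom_type dom_mulVx dom_unitPl dom_inv0id.

Lemma dom_mulf_eq0 : GRing.integral_domain_axiom dom_type.
Proof.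
move=> x y h; case: dA => _ /(_ x y h) [->|->]; by rewrite eqxx ?orbT.
Qed.

HB.instance Definition _ := GRing.ComUnitRing_isIntegral.Build dom_type dom_mulf_eq0.

Definition dom_frac (x : A) : {fraction dom_type} := @tofrac dom_type x.

Lemma dom_frac_zmod : zmod_morphism dom_frac.
Proof. exact: (rmorphB (@tofrac dom_type)). Qed.
HB.instance Definition _ :=
  GRing.isZmodMorphism.Build A {fraction dom_type} dom_frac dom_frac_zmod.
Lemma dom_frac_monoid : monoid_morphism dom_frac.
Proof. by split; [exact: (rmorph1 (@tofrac dom_type)) | exact: (rmorphM (@tofrac dom_type))]. Qed.
HB.instance Definition _ :=
  GRing.isMonoidMorphism.Build A {fraction dom_type} dom_frac dom_frac_monoid.

End DomainFractions.

Lemma domain_embeds (A : comPzRingType) : is_domain A ->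
  exists (L : fieldType) (j : {rmorphism A -> L}), injective j.
Proof.
move=> dA; exists ({fraction (dom_type dA)} : fieldType).
exists (@dom_frac _ dA).
by move=> x y /eqP; rewrite /= /dom_frac tofrac_eq => /eqP.
Qed.

(** * Maps between ultraproducts, and transcendental elements of ultrapowers *)

Section UfieldMap.
Context (T : Type) (U : set_system T) (FU : UltraFilter U).
Context (F_ K_ : T -> closedFieldType) (i_ : forall t, {rmorphism F_ t -> K_ t}).

Definition ufield_map (z : ufield FU F_) : ufield FU K_ :=
  ulimf FU (fun t => i_ t (sval (ufield_surj z) t)).

Lemma ufield_mapE c : ufield_map (ulimf FU c) = ulimf FU (fun t => i_ t (c t)).
Proof.
apply/ulimfP; case: ufield_surj => c' /= /ulim_ofP.
by apply: filterS => t ->.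
Qed.

Lemma ufield_map_zmod : zmod_morphism ufield_map.
Proof.
move=> x y; have [c <-] := ulimf_surj x; have [d <-] := ulimf_surj y.
rewrite -ulimfB !ufield_mapE -ulimfB; apply/ulimfP; apply: filterE => t.
by rewrite rmorphB.
Qed.
HB.instance Definition _ :=
  GRing.isZmodMorphism.Build (ufield FU F_) (ufield FU K_) ufield_map ufield_map_zmod.

Lemma ufield_map_monoid : monoid_morphism ufield_map.
Proof.
split.
  rewrite -[1 in LHS](@ulimf1 _ _ FU F_) ufield_mapE -[RHS](@ulimf1 _ _ FU K_).
  by apply/ulimfP; apply: filterE => t; rewrite rmorph1.
move=> x y; have [c <-] := ulimf_surj x; have [d <-] := ulimf_surj y.
rewrite -ulimfM !ufield_mapE -ulimfM; apply/ulimfP; apply: filterE => t.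
by rewrite rmorphM.
Qed.
HB.instance Definition _ :=
  GRing.isMonoidMorphism.Build (ufield FU F_) (ufield FU K_) ufield_map ufield_map_monoid.

End UfieldMap.

Section Diagonal.
Context (T : Type) (U : set_system T) (FU : UltraFilter U) (F : closedFieldType).

Definition udiag (c : F) : ufield FU (fun=> F) := ulimf FU (fun=> c).

Lemma udiag_zmod : zmod_morphism udiag.
Proof. by move=> x y; rewrite /udiag -ulimfB. Qed.
HB.instance Definition _ :=
  GRing.isZmodMorphism.Build F (ufield FU (fun=> F)) udiag udiag_zmod.
Lemma udiag_monoid : monoid_morphism udiag.
Proof.
by split=> [|x y]; rewrite /udiag -?ulimfM // -[RHS](@ulimf1 _ _ FU (fun=> F)).
Qed.
HB.instance Definition _ :=
  GRing.isMonoidMorphism.Build F (ufield FU (fun=> F)) udiag udiag_monoid.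

End Diagonal.

(** A countable field has only countably many polynomials, and [countable_nonroot] avoids the roots
    of all those that do not map to 0. The coding as nested lists of coefficients and monomials
    makes the polynomials enumerable by [pickle]; codes of nothing give the harmless polynomial
    0. *)
Lemma transcendental_ultrapower (U : set_system prime_number) (FU : UltraFilter U)
    (U_nonprincipal : forall p : prime_number, ~ U [set p])
    (F : countClosedFieldType) k (eta : 'I_k -> ufield FU (fun=> F : closedFieldType)) :
  exists tau, forall q : {poly {mpoly F[k]}},
    root (map_poly (mmap (@udiag _ U FU F) eta) q) tau ->
    map_poly (mmap (@udiag _ U FU F) eta) q = 0.
Proof.
pose encode (q : {poly {mpoly F[k]}}) : seq (seq (F * 'X_{1..k})) :=
  [seq [seq (f@_m, m) | m <- msupp f] | f : {mpoly F[k]} <- q].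
pose decode (l : seq (seq (F * 'X_{1..k}))) : {poly {mpoly F[k]}} :=
  Poly [seq \sum_(cm <- s) cm.1 *: 'X_[cm.2] | s <- l].
have encodeK q : decode (encode q) = q.
  rewrite /decode /encode -map_comp -[RHS]polyseqK; congr Poly.
  rewrite -[RHS]map_id; apply: eq_map => f /=.
  by rewrite big_map [RHS]mpolyE.
pose Q i := if unpickle i is Some l then map_poly (mmap (@udiag _ U FU F) eta) (decode l) else 0.
have [tau htau] := countable_nonroot U_nonprincipal Q.
exists tau => q; have := htau (pickle (encode q)).
by rewrite /Q pickleK encodeK.
Qed.

Lemma exprS_shuffle (R : comPzRingType) (x y f : R) N :
  (x * y) ^+ N.+1 * f = (x ^+ N * y) * (y ^+ N * (x * f)).
Proof. by rewrite exprMn !exprS; ring. Qed.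

(** * Comparison of approximated ideals with kernels of evaluations *)

Section PrimeApproximation.
Context (U : set_system prime_number) (FU : UltraFilter U).
Hypothesis U_nonprincipal : forall p : prime_number, ~ U [set p].
Context (C : fieldType) (a : {rmorphism C -> ufield FU Falg}).
Hypothesis char0 : [pchar C] =i pred0.
Hypothesis a_surj : forall z, exists c, a c = z.

(** The ultrafilter serves twice: for the ultraproduct over [p], and again for the ultrapower of
    each single [Falg p], which thereby acquires elements transcendental over [Falg p]. *)
Let K_ (p : prime_number) : closedFieldType := ufield FU (fun=> Falg p).
Let i_ p : {rmorphism Falg p -> K_ p} := @udiag _ U FU (Falg p).
Let b : {rmorphism C -> ufield FU K_} := @ufield_map _ U FU Falg K_ i_ \o a.

Lemma prime_kernels n (L : fieldType) (x : {rmorphism {mpoly C[n]} -> L}) :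
  exists (M : prime_number -> fieldType)
         (e : forall p, {rmorphism {mpoly (Falg p)[n]} -> M p}),
    (forall f, x f = 0 <-> \forall p \near U, e p (ap a p f) = 0) /\
    exists h G, [/\ x h != 0, forall g, g \in G -> x g = 0
      & \forall p \near U, forall f, e p f = 0 ->
          exists N, seq_ideal [seq ap a p g | g <- G] (ap a p h ^+ N * f)].
Proof.
have bE c c_ : a c = ulimf FU c_ -> b c = ulimf FU (fun p => i_ p (c_ p)).
  by move=> h; rewrite /b /= h ufield_mapE.
have char0K : [pchar ufield FU K_] =i pred0.
  by move=> p; rewrite -(char0 p) (fmorph_pchar b).
have tr p k (eta : 'I_k -> K_ p) := @transcendental_ultrapower _ FU U_nonprincipal
  (projT1 (countable_algebraic_closure 'F_(val p))) k eta.
pose lam : {rmorphism C -> L} := x \o @mpolyC n C.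
have [xi [h1 hG _]] := generic_point_exists a_surj bE char0K lam tr (fun i => x 'X_i).
have ex f : evx lam (fun i => x 'X_i) f = x f.
  rewrite /evx; elim/mpolyind: f => [|c m f _ _ IH]; first by rewrite !raddf0.
  rewrite !raddfD /= IH mmapZ mmapX -mul_mpolyC rmorphM; congr (_ * _ + _).
  rewrite /mmap1 mpolyXE_id rmorph_prod; apply: eq_bigr => i _.
  by rewrite rmorphXn.
exists K_, (fun p => evt i_ xi (t := p)); split.
  by move=> f; rewrite -ex h1 (evl_lim bE _ (apx_ap a f)); apply: ulimf_eq0.
have [h [G [h0 G0 hp]]] := hG; exists h, G; split=> //; first by rewrite -ex.
by move=> g gG; rewrite -ex; apply: G0.
Qed.

Lemma seq_ideal_transfer n (s : seq {mpoly C[n]}) f : seq_ideal s f ->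
  \forall p \near U, seq_ideal [seq ap a p g | g <- s] (ap a p f).
Proof.
move=> [c ->].
have h := apx_sum (index_enum 'I_(size s))
  (fun i => apx_M (apx_ap a (c i)) (apx_ap a s`_i)).
apply: filterS (apx_uniq (apx_ap a _) h) => p ->.
apply: ideal_sum => i _; apply: idealM; apply: seq_ideal_gen.
by apply: map_f; apply: mem_nth.
Qed.

Lemma seq_idealP (R : comPzRingType) (s : seq R) f :
  seq_ideal s f <-> exists y : 'I_(size s) -> R, f = \sum_k y k * s`_k.
Proof.
split=> [[c ->]|[y ->]]; first by exists (fun i => c i).
by apply: ideal_sum => i _; apply: idealM; apply: seq_ideal_gen; apply: mem_nth.
Qed.

Lemma common_multiplier (R : comPzRingType) (Phi : R -> Prop) (J : ideal R)
    (I : finType) (F : I -> R) :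
  Phi 1 -> (forall u v, Phi u -> Phi v -> Phi (u * v)) ->
  (forall i, exists u, Phi u /\ J (u * F i)) ->
  exists u, Phi u /\ forall i, J (u * F i).
Proof.
move=> Phi1 PhiM h; pose u i := sval (cid (h i)).
have uP i : Phi (u i) /\ J (u i * F i) by rewrite /u; case: cid.
exists (\prod_i u i); split.
  by apply: big_ind => // i _; have [] := uP i.
move=> i; rewrite (bigD1 i) //= mulrAC mulrC; apply: idealM.
by have [] := uP i.
Qed.

(** The kernel of [x] is the saturation of the ideal of [s] by [Phi], which is trivial for a
    finitely generated algebra and the complement of a prime in the local case. One multiplier [u1]
    takes the elements of [G] into that ideal. Since [x h] is non-zero, the generators [R] of the
    colon ideal by [h] also lie in the kernel, and a multiplier [u2] takes them into it. Over almost
    all [p], the element [u1] then replaces [G] by [s], and [u2] cancels the powers of [h]. *)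
Lemma prime_approximation n (L : fieldType) (x : {rmorphism {mpoly C[n]} -> L})
    (s : seq {mpoly C[n]}) (Phi : {mpoly C[n]} -> Prop) :
  Phi 1 -> (forall u v, Phi u -> Phi v -> Phi (u * v)) ->
  (forall f, f \in s -> x f = 0) ->
  (forall f, x f = 0 -> exists u, Phi u /\ seq_ideal s (u * f)) ->
  exists (M : prime_number -> fieldType)
         (e : forall p, {rmorphism {mpoly (Falg p)[n]} -> M p}),
    (forall f, x f = 0 <-> \forall p \near U, e p (ap a p f) = 0) /\
    exists u, Phi u /\ \forall p \near U, forall f,
      (seq_ideal [seq ap a p g | g <- s] f -> e p f = 0) /\
      (e p f = 0 -> exists N, seq_ideal [seq ap a p g | g <- s] (ap a p u ^+ N * f)).
Proof.
move=> Phi1 PhiM sx hx.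
have [M [e [ex [h [G [h0 G0 hG]]]]]] := prime_kernels x.
exists M, e; split=> //.
have xs f : seq_ideal s f -> x f = 0.
  move=> [c ->]; rewrite rmorph_sum big1 // => i _.
  by rewrite rmorphM (sx _ (mem_nth 0 (ltn_ord i))) mulr0.
have [|u1 [Phi_u1 hu1]] := @common_multiplier _ _ (seq_ideal s) 'I_(size G)
  (fun i => G`_i) Phi1 PhiM.
  by move=> i; apply: hx; apply: G0; apply: mem_nth.
have [J [R [hR colR]]] := colon_transfer a (fun i : 'I_(size s) => s`_i) h.
have [|u2 [Phi_u2 hu2]] := @common_multiplier _ _ (seq_ideal s) J R Phi1 PhiM.
  move=> j; apply: hx; have [y hy] := hR j.
  have : x (h * R j) = 0 by apply: xs; apply/seq_idealP; exists y.
  by rewrite rmorphM => /eqP; rewrite mulf_eq0 (negPf h0) => /eqP.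
exists (u1 * u2); split; first exact: PhiM.
have H1 : \forall p \near U, forall i : 'I_(size G),
    seq_ideal [seq ap a p g | g <- s] (ap a p (u1 * G`_i)).
  by apply: filter_forall => i; apply: seq_ideal_transfer.
have H2 : \forall p \near U, forall j,
    seq_ideal [seq ap a p g | g <- s] (ap a p (u2 * R j)).
  by apply: filter_forall => j; apply: seq_ideal_transfer.
have H3 : \forall p \near U, forall i : 'I_(size G), ap a p (u1 * G`_i) = ap a p u1 * ap a p G`_i.
  by apply: filter_forall => i; apply: ap_M.
have H4 : \forall p \near U, forall j, ap a p (u2 * R j) = ap a p u2 * ap a p (R j).
  by apply: filter_forall => j; apply: ap_M.
have H5 := ap_M a u1 u2.
have H6 : \forall p \near U, forall i : 'I_(size s), e p (ap a p s`_i) = 0.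
  by apply: filter_forall => i; apply/ex; apply: sx; apply: mem_nth.
near=> p.
have h1 : forall i : 'I_(size G),
    seq_ideal [seq ap a p g | g <- s] (ap a p (u1 * G`_i)) by near: p.
have h2 : forall j, seq_ideal [seq ap a p g | g <- s] (ap a p (u2 * R j)) by near: p.
have h3 : forall i : 'I_(size G), ap a p (u1 * G`_i) = ap a p u1 * ap a p G`_i by near: p.
have h4 : forall j, ap a p (u2 * R j) = ap a p u2 * ap a p (R j) by near: p.
have h5 : ap a p (u1 * u2) = ap a p u1 * ap a p u2 by near: p.
have h6 : forall i : 'I_(size s), e p (ap a p s`_i) = 0 by near: p.
have hGp : forall f, e p f = 0 ->
  exists N, seq_ideal [seq ap a p g | g <- G] (ap a p h ^+ N * f) by near: p.
have colp : forall f (y : 'I_(size s) -> _), ap a p h * f = \sum_k y k * ap a p (s`_k) ->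
  exists w, f = \sum_j w j * ap a p (R j) by near: p.
set Ip := seq_ideal _ in h1 h2 *.
have sz : size [seq ap a p g | g <- s] = size s by rewrite size_map.
have colon f : Ip (ap a p h * f) -> Ip (ap a p u2 * f).
  move=> [c hc]; have [|w ->] := colp f (fun i => c i).
    rewrite hc; rewrite -(big_mkord predT (fun i => c i * [seq ap a p g | g <- s]`_i)).
    rewrite sz big_mkord; apply: eq_bigr => i _.
    by rewrite (nth_map 0).
  rewrite mulr_sumr; apply: ideal_sum => j _; rewrite mulrCA; apply: idealM.
  by rewrite -h4; apply: h2.
(* Each factor [h] is traded for a factor [u2], so no bound on [N] is required. *)
have colonN N f : Ip (ap a p h ^+ N * f) -> Ip (ap a p u2 ^+ N * f).
  elim: N f => [|N IH] f; first by rewrite !expr0.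
  rewrite exprS -mulrA => /colon; rewrite mulrCA => /IH.
  by rewrite mulrA -exprSr.
move=> f; split.
  move=> [c ->]; rewrite rmorph_sum big1 // => i _; rewrite rmorphM.
  have is' : (i < size s)%N by rewrite -sz.
  by rewrite (nth_map 0) // (h6 (Ordinal is')) mulr0.
move=> /hGp[N hN]; exists N.+1; rewrite h5.
have hN' : Ip (ap a p u1 * (ap a p h ^+ N * f)).
  case: hN => [c ->]; rewrite mulr_sumr; apply: ideal_sum => i _.
  have iG : (i < size G)%N by apply: leq_trans (ltn_ord i) _; rewrite size_map.
  rewrite mulrCA; apply: idealM; rewrite (nth_map 0) //.
  by have := h1 (Ordinal iG); rewrite h3.
rewrite mulrCA in hN'; have := colonN _ _ hN'.
by rewrite exprS_shuffle => h7; apply: idealM.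
Unshelve. all: by end_near.
Qed.

End PrimeApproximation.

(** * Domains among quotients and their localizations *)

Section QuotientLocalization.
Context (R : comPzRingType).

Lemma to_quot_eq0 (I : ideal R) f : to_quot I f = 0 <-> I f.
Proof.
have e0 : to_quot I 0 = 0 := rmorph0 (to_quot I).
by rewrite -e0 to_quotP subr0.
Qed.

Lemma quot_domain (I : ideal R) (M : fieldType) (e : {rmorphism R -> M}) :
  (forall f, I f <-> e f = 0) -> is_domain (quot I).
Proof.
move=> Ie; split.
  have e1 : to_quot I 1 = 1 := rmorph1 (to_quot I).
  by rewrite -e1 => /to_quot_eq0/Ie/eqP; rewrite rmorph1 oner_eq0.
move=> x y; have [f <-] := to_quot_surj x; have [g <-] := to_quot_surj y.
rewrite -rmorphM => /to_quot_eq0/Ie/eqP; rewrite rmorphM mulf_eq0.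
by move=> /orP[/eqP h|/eqP h]; [left|right]; apply/to_quot_eq0/Ie.
Qed.

Lemma mult_closure_prime (P : ideal R) : prime_ideal P ->
  forall u, mult_closure (~` P) u <-> ~ P u.
Proof.
move=> [P1 PM] u; split=> [[s sP ->]|Pu]; last first.
  exists [:: u]; last by rewrite big_seq1.
  by move=> y; rewrite inE => /eqP ->.
elim: s sP => [|y s IH] sP; first by rewrite big_nil.
rewrite big_cons => /PM[]; first by apply: sP; rewrite mem_head.
by apply: IH => z zs; apply: sP; rewrite inE zs orbT.
Qed.

Section ToLocalization.
Context (S : set R).

Definition to_loc (f : R) : localization S := frac f (mult_closure1 S).

Lemma frac_eq0 f s (Ms : mult_closure S s) :
  frac f Ms = 0 <-> exists2 u, mult_closure S u & u * f = 0.
Proof.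
rewrite frac0E fracP; split=> -[u Mu h]; exists u => //.
  by move: h; rewrite mulr1 mul0r subr0.
by rewrite mulr1 mul0r subr0.
Qed.

Lemma to_loc_zmod : zmod_morphism to_loc.
Proof.
move=> x y; rewrite /to_loc frac_opp frac_add; apply/fracP.
by exists 1; [exact: mult_closure1 | ring].
Qed.
HB.instance Definition _ :=
  GRing.isZmodMorphism.Build R (localization S) to_loc to_loc_zmod.
Lemma to_loc_monoid : monoid_morphism to_loc.
Proof.
split=> // x y; rewrite /to_loc frac_mul; apply/fracP.
by exists 1; [exact: mult_closure1 | ring].
Qed.
HB.instance Definition _ :=
  GRing.isMonoidMorphism.Build R (localization S) to_loc to_loc_monoid.

End ToLocalization.
End QuotientLocalization.

Section QuotientLocalizationDomain.
Context (R : comPzRingType).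

(** The kernel of [e1] is a prime containing [I] whose elements are taken into [I] by powers of [v].
    As [v] is invertible in the localization at [P], that localization is also one of the domain of
    [e1]-values. *)
Lemma localization_domain (I : ideal R) (P : ideal (quot I)) (M1 M2 : fieldType)
    (e1 : {rmorphism R -> M1}) (e2 : {rmorphism R -> M2}) v :
  (forall f, I f -> e1 f = 0) ->
  (forall f, e1 f = 0 -> exists N, I (v ^+ N * f)) ->
  (forall f, P (to_quot I f) <-> e2 f = 0) -> e2 v <> 0 ->
  is_domain (localization_at P).
Proof.
move=> Ie1 e1I Pe2 /eqP v0.
have Pprime : prime_ideal P.
  split; first by rewrite -(rmorph1 (to_quot I)) => /Pe2/eqP; rewrite rmorph1 oner_eq0.
  move=> x y; have [f <-] := to_quot_surj x; have [g <-] := to_quot_surj y.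
  rewrite -rmorphM => /Pe2/eqP; rewrite rmorphM mulf_eq0.
  by move=> /orP[/eqP h|/eqP h]; [left|right]; apply/Pe2.
have clP := mult_closure_prime Pprime.
have v_ker f : e1 f = 0 -> exists2 u, mult_closure (~` P) u & u * to_quot I f = 0.
  move=> /e1I[N hN]; exists (to_quot I (v ^+ N)).
    by apply/clP => /Pe2/eqP; rewrite rmorphXn expf_eq0 (negPf v0) andbF.
  by rewrite -rmorphM; apply/to_quot_eq0.
have e1_e2 f : e1 f = 0 -> e2 f = 0.
  move=> /e1I[N hN]; have : P (to_quot I (v ^+ N * f)).
    by rewrite (iffRL (to_quot_eq0 _ _) hN); apply: ideal0.
  by move=> /Pe2/eqP; rewrite rmorphM rmorphXn mulf_eq0 expf_eq0 (negPf v0) andbF => /eqP.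
split.
  rewrite frac1E => /frac_eq0[u /clP Pu]; rewrite mulr1 => u0; apply: Pu.
  by rewrite u0; apply: ideal0.
move=> x y; have [f [s [Ms ->]]] := frac_surj x; have [g [t [Mt ->]]] := frac_surj y.
have [f' ff] := to_quot_surj f; have [g' gg] := to_quot_surj g; rewrite -ff -gg.
rewrite frac_mul => /frac_eq0[u /clP Pu].
have [u' uu] := to_quot_surj u; rewrite -uu in Pu *.
rewrite -(rmorphM (to_quot I) f' g') -(rmorphM (to_quot I) u').
move=> /to_quot_eq0/Ie1/eqP; rewrite !rmorphM !mulf_eq0.
move=> /orP[/eqP/e1_e2/Pe2 //|/orP[/eqP|/eqP] /v_ker h].
  by left; apply/frac_eq0.
by right; apply/frac_eq0.
Qed.

Lemma localized_idealE (s gs : seq R) f :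
  seq_ideal [seq to_quot (seq_ideal s) g | g <- gs] (to_quot (seq_ideal s) f) <->
  seq_ideal (s ++ gs) f.
Proof.
split.
  move=> [c]; rewrite size_map.
  pose d i := sval (cid (to_quot_surj (c i))).
  have dc i : to_quot (seq_ideal s) (d i) = c i by rewrite /d; case: cid.
  have -> : \sum_(i < size gs) c i * [seq to_quot (seq_ideal s) g | g <- gs]`_i =
      to_quot (seq_ideal s) (\sum_(i < size gs) d i * gs`_i).
    rewrite rmorph_sum; apply: eq_bigr => i _.
    by rewrite rmorphM /= dc (nth_map 0).
  move=> /to_quotP h; rewrite -(subrK (\sum_(i < size gs) d i * gs`_i) f).
  apply: idealD.
    have h3 x : x \in s -> seq_ideal (s ++ gs) x.
      by move=> xs; apply: seq_ideal_gen; rewrite mem_cat xs.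
    exact: (seq_ideal_le h3 h).
  apply: (@ideal_sum _ (seq_ideal (s ++ gs))) => i _.
  apply: (@idealM _ (seq_ideal (s ++ gs))); apply: seq_ideal_gen.
  by rewrite mem_cat mem_nth ?orbT.
move=> /(seq_ideal_map (to_quot (seq_ideal s))) h.
apply: (seq_ideal_le _ h) => _ /mapP[x xs ->].
move: xs; rewrite mem_cat => /orP[xs|xgs]; last by apply: seq_ideal_gen; apply: map_f.
rewrite /= (iffRL (to_quot_eq0 _ x) (seq_ideal_gen xs)).
exact: (ideal0 (seq_ideal _)).
Qed.

End QuotientLocalizationDomain.

(** * Approximations of affine domains *)

Section AffineApproximation.
Context (U : set_system prime_number) (FU : UltraFilter U).
Hypothesis U_nonprincipal : forall p : prime_number, ~ U [set p].
Context (C : fieldType) (a : {rmorphism C -> ufield FU Falg}).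
Hypothesis char0 : [pchar C] =i pred0.
Hypothesis a_surj : forall z, exists c, a c = z.
Context (n : nat).

Lemma approximates_seq_ap (s : seq {mpoly C[n]}) s_ :
  approximates_seq (a : C -> ulim U Falg) s s_ ->
  \forall p \near U, s_ p = [seq ap a p f | f <- s].
Proof.
move=> [sz h].
have : \forall p \near U, forall i : 'I_(size s), (s_ p)`_i = ap a p s`_i.
  apply: filter_forall => i; apply: apx_near.
  by have [h1 h2] := h i; apply: apx_supp.
apply: filterS => p hp; apply: (@eq_from_nth _ 0); first by rewrite size_map sz.
move=> i; rewrite sz => is'; rewrite (nth_map 0) //.
exact: (hp (Ordinal is')).
Qed.

Lemma domain_approximation (s : seq {mpoly C[n]}) : is_domain (quot (seq_ideal s)) ->
  exists (M : prime_number -> fieldType)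
         (e : forall p, {rmorphism {mpoly (Falg p)[n]} -> M p}),
    (forall f, seq_ideal s f <-> \forall p \near U, e p (ap a p f) = 0) /\
    \forall p \near U, forall f, seq_ideal [seq ap a p g | g <- s] f <-> e p f = 0.
Proof.
move=> /domain_embeds[L [j j_inj]].
pose x : {rmorphism {mpoly C[n]} -> L} := j \o to_quot (seq_ideal s).
have x0 f : x f = 0 <-> seq_ideal s f.
  rewrite -to_quot_eq0 /x /=; split=> [h|->]; last exact: rmorph0.
  by apply: j_inj; rewrite h rmorph0.
have [||||M [e [he [u [-> hu]]]]] := @prime_approximation _ FU U_nonprincipal _ a char0
  a_surj n L x s (fun u => u = 1).
- by [].
- by move=> u v -> ->; rewrite mulr1.
- by move=> f fs; apply/x0; apply: seq_ideal_gen.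
- by move=> f /x0 h; exists 1; rewrite mul1r.
exists M, e; split; first by move=> f; rewrite -x0.
apply: filterS2 hu (ap_1 a n) => p hp ap1 f; have [h1 h2] := hp f.
by split=> // /h2[N]; rewrite ap1 expr1n mul1r.
Qed.

(** In the local case two families of primes are approximated: the kernels of [e1] come from the
    kernel of the map to the localization, those of [e2] from the prime at which one localizes. The
    multiplier [u] lies outside that prime, hence outside the kernel of [e2 p] for almost all [p],
    and [localization_domain] combines the two. *)
Theorem affine_approximation_domain (A : affine_presentation C n) A_ :
  localized_at_prime A -> is_domain (affine_ring A) ->
  approximates_affine (a : C -> ulim U Falg) A A_ ->
  \forall p \near U, is_domain (affine_ring (A_ p)).
Proof.
case: A => s [gs|] /=; rewrite /localized_at_prime /affine_ring /=; last first.
  move=> _ dA [/= /approximates_seq_ap hs hloc].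
  have [M [e [_ he]]] := domain_approximation dA.
  apply: filterS2 hs he => p; have := hloc p.
  rewrite /affine_fg; case: (A_ p) => /= sp [//|] _ -> h.
  exact: (@quot_domain _ (seq_ideal [seq ap a p f | f <- s]) _ (e p) h).
rewrite /localized_ideal /affine_fg /=; set I := seq_ideal s.
set P := seq_ideal _ => Pprime dA [/= /approximates_seq_ap hs].
move=> [gs_ hloc /approximates_seq_ap hgs].
have PE f : P (to_quot I f) <-> seq_ideal (s ++ gs) f := localized_idealE s gs f.
have clP := mult_closure_prime Pprime.
(* [P] is prime and its preimage in the polynomial ring is generated by [s ++ gs], so the case
   without localization applies to that quotient. *)
have dJ : is_domain (quot (seq_ideal (s ++ gs))).
  have [P1 PM] := Pprime; split.
    rewrite -(rmorph1 (to_quot _)) => /to_quot_eq0/PE.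
    by rewrite rmorph1.
  move=> x y; have [f <-] := to_quot_surj x; have [g <-] := to_quot_surj y.
  rewrite -rmorphM => /to_quot_eq0/PE; rewrite rmorphM => /PM.
  by move=> [/PE h|/PE h]; [left|right]; apply/to_quot_eq0.
have [M2 [e2 [he2 hJ]]] := domain_approximation dJ.
have [L [j j_inj]] := domain_embeds dA.
pose x : {rmorphism {mpoly C[n]} -> L} := j \o (@to_loc _ (~` P) \o to_quot I).
have x0 f : x f = 0 <-> exists2 u, ~ P u & u * to_quot I f = 0.
  have -> : x f = 0 <-> to_loc (~` P) (to_quot I f) = 0.
    rewrite /x /=; split=> [h|->]; last exact: rmorph0.
    by apply: j_inj; rewrite h rmorph0.
  rewrite frac_eq0; split=> -[u Mu h]; exists u => //; exact/clP.
have [||||M1 [e1 [he1 [u [Pu hu]]]]] := @prime_approximation _ FU U_nonprincipal _ a char0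
  a_surj n L x s (fun u => ~ P (to_quot I u)).
- by rewrite rmorph1; have [] := Pprime.
- by move=> u v Pu Pv; rewrite rmorphM => /(proj2 Pprime)[].
- move=> f fs; apply/x0; exists 1; first by have [] := Pprime.
  by rewrite mul1r; apply/to_quot_eq0; apply: seq_ideal_gen.
- move=> f /x0[v Pv]; have [u uv] := to_quot_surj v; rewrite -uv in Pv *.
  by rewrite -rmorphM => /to_quot_eq0 h; exists u.
have hu2 : \forall p \near U, e2 p (ap a p u) <> 0.
  by apply/ultra_notP => /he2 h; apply: Pu; apply/PE.
near=> p.
have es : relations (A_ p) = [seq ap a p f | f <- s] by near: p.
have egs : gs_ p = [seq ap a p f | f <- gs] by near: p.
have hJp : forall f, seq_ideal [seq ap a p g | g <- s ++ gs] f <-> e2 p f = 0 by near: p.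
have hup : forall f,
      (seq_ideal [seq ap a p g | g <- s] f -> e1 p f = 0) /\
      (e1 p f = 0 -> exists N, seq_ideal [seq ap a p g | g <- s] (ap a p u ^+ N * f)).
  by near: p.
have u2 : e2 p (ap a p u) <> 0 by near: p.
have := hloc p; rewrite /affine_ring /localized_ideal /affine_fg; case: (A_ p) es => sp [gp|//] /= -> [->].
rewrite egs; apply: (@localization_domain _ _ _ _ _ (e1 p) (e2 p) (ap a p u)) => //.
- by move=> f; have [] := hup f.
- by move=> f; have [] := hup f.
- by move=> f; rewrite -hJp map_cat; apply: localized_idealE.
Unshelve. all: by end_near.
Qed.

End AffineApproximation.

Lemma mulr_shuffle6 (R : comPzRingType) (x1 x2 x3 x4 x5 x6 : R) :
  x1 * x6 * (x4 * x5) * (x2 * x3) = x1 * x2 * x4 * (x5 * (x6 * x3)).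
Proof. by ring. Qed.

(** * Absolutely integrally closed domains *)

Lemma maximal_prime (S : comPzRingType) (M : ideal S) : maximal_ideal M -> prime_ideal M.
Proof.
move=> [M1 Mmax]; split=> // x y Mxy.
case: (pselect (M x)) => [|nMx]; [by left | right].
pose J : set S := [set z | exists m b, M m /\ z = m + b * x].
have J0 : J 0 by exists 0, 0; split; [apply: ideal0 | rewrite mul0r addr0].
have JD u v : J u -> J v -> J (u + v).
  move=> [m [b [Mm ->]]] [m' [b' [Mm' ->]]]; exists (m + m'), (b + b').
  by split; [apply: idealD | rewrite mulrDl addrACA].
have JM u v : J v -> J (u * v).
  move=> [m [b [Mm ->]]]; exists (u * m), (u * b).
  by split; [apply: idealM | rewrite mulrDr mulrA].
have MJ : M `<=` Ideal J0 JD JM by move=> m Mm; exists m, 0; rewrite mul0r addr0.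
case: (Mmax _ MJ) => [[m [b [Mm e1]]]|JsM].
  rewrite -[y]mul1r e1 mulrDl; apply: idealD; first by rewrite mulrC; apply: idealM.
  by rewrite -mulrA; apply: idealM.
by case: nMx; apply: JsM; exists 0, 1; split; [apply: ideal0 | rewrite mul1r add0r].
Qed.

Lemma monic_splits (D : idomainType) :
  (forall n (c : 'I_n -> D), (0 < n)%N -> exists x, x ^+ n + \sum_(i < n) c i * x ^+ i = 0) ->
  forall p : {poly D}, p \is monic -> exists rs, p = \prod_(r <- rs) ('X - r%:P).
Proof.
move=> aic p; have [k] := ubnP (size p); elim: k p => // k IH p; rewrite ltnS => pk mp.
have p0 := monic_neq0 mp.
case: (ltnP (size p) 2) => [p1|p1].
  exists [::]; rewrite big_nil; have /size_poly1P[c c0 pc] : size p == 1%N.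
    by rewrite eqn_leq -ltnS p1 size_poly_gt0.
  by move: mp; rewrite pc monicE lead_coefC => /eqP ->.
pose n := (size p).-1.
have sp : size p = n.+1 by rewrite /n prednK // ltnW.
have n0 : (0 < n)%N by rewrite -ltnS -sp.
have [x xr] := aic n (fun i => p`_i) n0.
have rx : root p x.
  rewrite rootE horner_coef sp big_ord_recr /= -[p`_n]/(p`_(n.+1.-1)) -sp -lead_coefE.
  by rewrite (monicP mp) mul1r addrC xr.
have /factor_theorem[q pq] := rx.
have mq : q \is monic by rewrite -(monicMr q (monicXsubC x)) -pq.
have [|rs qrs] := IH q _ mq.
  have := size_Mmonic (monic_neq0 mq) (monicXsubC x).
  by rewrite -pq size_XsubC addn2 /= => e; rewrite -e.
by exists (x :: rs); rewrite big_cons -qrs mulrC.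
Qed.

(** The polynomial splits into factors ['X - r%:P]. Its value at [a] is the product of the
    differences [a - r], and primality puts one of them into [P]. *)
Lemma monic_root_near (D : idomainType) (P : set D) :
  ~ P 1 -> (forall x y, P (x * y) -> P x \/ P y) ->
  (forall n (c : 'I_n -> D), (0 < n)%N -> exists x, x ^+ n + \sum_(i < n) c i * x ^+ i = 0) ->
  forall n (c : 'I_n -> D) a, P (a ^+ n + \sum_(i < n) c i * a ^+ i) ->
    exists2 b, b ^+ n + \sum_(i < n) c i * b ^+ i = 0 & P (a - b).
Proof.
move=> P1 PM aic n c a Pa.
pose p : {poly D} := 'X^n + \sum_(i < n) c i *: 'X^i.
have pE x : p.[x] = x ^+ n + \sum_(i < n) c i * x ^+ i.
  rewrite hornerD hornerXn horner_sum; congr (_ + _); apply: eq_bigr => i _.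
  by rewrite hornerZ hornerXn.
have mp : p \is monic.
  rewrite monicE lead_coefDl ?lead_coefXn // size_polyXn ltnS.
  apply: leq_trans (size_sum _ _ _) _; apply/bigmax_leqP => i _.
  by apply: leq_trans (size_scale_leq _ _) _; rewrite size_polyXn.
have [rs prs] := monic_splits aic mp.
have : exists2 r, r \in rs & P (a - r).
  move: Pa; rewrite -pE prs horner_prod; elim: rs {prs} => [|r rs IH].
    by rewrite big_nil.
  rewrite big_cons hornerXsubC => /PM[Pr|/IH[r' r'rs Pr']].
    by exists r; rewrite ?mem_head.
  by exists r'; rewrite ?inE ?r'rs ?orbT.
move=> [r rrs Pr]; exists r => //; rewrite -pE; apply/rootP.
by rewrite prs root_prod_XsubC.
Qed.

Lemma aic_lifts (S : comPzRingType) (M : ideal S) :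
  absolutely_integrally_closed S -> maximal_ideal M -> lifts_simple_roots M.
Proof.
move=> [dS aic] /maximal_prime[M1 MM] n c a Ma _.
have [b b0 Mb] := @monic_root_near (dom_type dS) (M : set S) M1 MM aic n c a Ma.
exists b => //; suff -> : b - a = - ((a : S) - b) by apply: idealN.
by rewrite opprB.
Qed.

(** * Localizations of absolutely integrally closed domains *)

Section LocalizationAIC.
Context (S : comPzRingType) (M : ideal S).
Hypothesis aicS : absolutely_integrally_closed S.
Hypothesis Mprime : prime_ideal M.
Local Notation SM := (localization (~` M)).

Let clM := mult_closure_prime Mprime.

Lemma localization_aic_domain : is_domain SM.
Proof.
have [[S1 SM0] _] := aicS.
have nz u : mult_closure (~` M) u -> u <> 0 by move=> /clM Mu u0; apply: Mu; rewrite u0; apply: ideal0.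
split.
  by rewrite frac1E => /frac_eq0[u /nz u0]; rewrite mulr1.
move=> x y; have [f [s [Ms ->]]] := frac_surj x; have [g [t [Mt ->]]] := frac_surj y.
rewrite frac_mul => /frac_eq0[u /nz u0 /SM0[//|/SM0[]->]]; [left|right];
  apply/frac_eq0; exists 1; rewrite ?mulr0 //; exact: mult_closure1.
Qed.

Lemma common_fraction n (c : 'I_n -> SM) : exists s (Ms : mult_closure (~` M) s) (b : 'I_n -> S),
  forall i, c i = to_loc (~` M) (b i) * frac 1 Ms.
Proof.
pose f i := cid (frac_surj (c i)).
pose num i := sval (f i); pose g i := cid (svalP (f i)).
pose den i := sval (g i).
have gP i : exists Ms : mult_closure (~` M) (den i), c i = frac (num i) Ms := svalP (g i).
have Mden i : mult_closure (~` M) (den i) by have [] := gP i.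
have MP (P : pred 'I_n) : mult_closure (~` M) (\prod_(j | P j) den j).
  by apply: big_ind => //; [exact: mult_closure1 | exact: mult_closureM].
exists (\prod_j den j), (MP xpredT), (fun i => num i * \prod_(j | j != i) den j) => i.
have [Mi ->] := gP i; rewrite /to_loc frac_mul; apply/fracP.
exists 1; first exact: mult_closure1.
by rewrite (bigD1 i) //=; ring.
Qed.

(** With a common denominator, [c i = b i / s]. A root [r] in [S] of the monic polynomial with
    coefficients [b i * s ^+ (n.-1 - i)] gives the root [r / s]. *)
Lemma localization_aic : absolutely_integrally_closed SM.
Proof.
split; first exact: localization_aic_domain.
move=> n c n0; have [s [Ms [b cE]]] := common_fraction c.
have [_ aic] := aicS.
have [r hr] := aic n (fun i => b i * s ^+ (n.-1 - i)) n0.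
pose tau : SM := frac 1 Ms.
have st : to_loc (~` M) s * tau = 1.
  rewrite /tau /to_loc frac_mul frac1E; apply/fracP.
  by exists 1; [exact: mult_closure1 | ring].
exists (to_loc (~` M) r * tau).
transitivity (to_loc (~` M) (monic_eval (fun i => b i * s ^+ (n.-1 - i)) r) * tau ^+ n); last first.
  by rewrite hr (rmorph0 (to_loc (~` M))) mul0r.
rewrite /monic_eval (rmorphD (to_loc (~` M))) mulrDl rmorphXn exprMn; congr (_ + _).
rewrite (rmorph_sum (to_loc (~` M))) mulr_suml; apply: eq_bigr => i _.
rewrite cE (rmorphM (to_loc (~` M))) (rmorphM (to_loc (~` M)) (b i)) !rmorphXn /=.
have en : n = (i + (n.-1 - i).+1)%N.
  by rewrite addnS subnKC ?prednK // -ltnS prednK.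
rewrite -/tau [in RHS](_ : tau ^+ n = tau ^+ i * (tau * tau ^+ (n.-1 - i))); last first.
  by rewrite -exprS -exprD -en.
have e1 : to_loc (~` M) s ^+ (n.-1 - i) * tau ^+ (n.-1 - i) = 1.
  by rewrite -exprMn st expr1n.
rewrite exprMn.
transitivity (to_loc (~` M) (b i) * tau * (to_loc (~` M) r ^+ i * tau ^+ i) *
  (to_loc (~` M) s ^+ (n.-1 - i) * tau ^+ (n.-1 - i))); first by rewrite e1 mulr1.
exact: mulr_shuffle6.
Qed.

Definition loc_max : set SM := [set x | exists a s (Ms : mult_closure (~` M) s), M a /\ x = frac a Ms].

Lemma loc_max0 : loc_max 0.
Proof. by exists 0, 1, (mult_closure1 _); split; [apply: ideal0 | exact: frac0E]. Qed.
Lemma loc_maxD x y : loc_max x -> loc_max y -> loc_max (x + y).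
Proof.
move=> [a [s [Ms [Ma ->]]]] [b [t [Mt [Mb ->]]]].
exists (a * t + b * s), (s * t), (mult_closureM Ms Mt); rewrite frac_add; split=> //.
by apply: idealD; rewrite mulrC; apply: idealM.
Qed.
Lemma loc_maxM x y : loc_max y -> loc_max (x * y).
Proof.
have [b [t [Mt ->]]] := frac_surj x.
move=> [a [s [Ms [Ma ->]]]]; exists (b * a), (t * s), (mult_closureM Mt Ms).
by rewrite frac_mul; split=> //; apply: idealM.
Qed.
Definition loc_max_ideal : ideal SM := Ideal loc_max0 loc_maxD loc_maxM.

Lemma loc_max_proper : ~ loc_max_ideal 1.
Proof.
move=> [a [s [Ms [Ma]]]]; rewrite frac1E => /fracP[u Mu].
rewrite mul1r mulr1 mulrBr => /eqP; rewrite subr_eq0 => /eqP e.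
have : M (u * s) by rewrite e; apply: idealM.
by case: Mprime => _ PM /PM[]; apply/clM.
Qed.

(** A fraction outside [loc_max_ideal] has its numerator outside [M], so it is invertible. *)
Lemma loc_max_largest (J : ideal SM) : J 1 \/ J `<=` loc_max_ideal.
Proof.
case: (pselect (J `<=` loc_max_ideal)) => [|nJ]; [by right | left].
move/existsNP: nJ => [x /not_implyP[Jx nx]].
have [a [s [Ms xE]]] := frac_surj x.
have Ma : mult_closure (~` M) a by apply/clM => Ma; apply: nx; exists a, s, Ms.
suff -> : 1 = frac s Ma * x by apply: idealM.
rewrite xE frac_mul frac1E; apply/fracP.
by exists 1; [exact: mult_closure1 | ring].
Qed.

Lemma localization_henselian_local : henselian_local SM.
Proof.
have maxN : maximal_ideal loc_max_ideal.
  by split; [exact: loc_max_proper | move=> J _; apply: loc_max_largest].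
exists loc_max_ideal; split=> //; last exact: aic_lifts localization_aic maxN.
move=> N [N1 Nmax]; have NJ : N `<=` loc_max_ideal.
  by case: (loc_max_largest N).
by case: (Nmax _ NJ) => [/loc_max_proper|JN] //; split.
Qed.

End LocalizationAIC.

Lemma aic_henselian (S : comPzRingType) : absolutely_integrally_closed S -> henselian S.
Proof.
move=> aicS M Mmax; split; first exact: aic_lifts.
exact: (localization_henselian_local aicS (maximal_prime Mmax)).
Qed.

Lemma ulim_aic (T : Type) (U : set_system T) (FU : UltraFilter U) (R_ : T -> comPzRingType) :
  (\forall t \near U, absolutely_integrally_closed (R_ t)) ->
  absolutely_integrally_closed (ulim U R_).
Proof.
move=> aic; split; first by apply: ulim_domain; apply: filterS aic => t [].
move=> n c n0; pose c_ i := sval (cid (ulim_of_surj (c i))).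
have cE i : ulim_of U (c_ i) = c i by rewrite /c_; case: cid.
(* A root in every factor that has one, and 0 in the others, which are negligible. *)
pose x t := if pselect (exists x, monic_eval (fun i => c_ i t) x = 0) is left h
  then sval (cid h) else 0.
exists (ulim_of U x); rewrite /monic_eval -ulim_ofX.
under eq_bigr do rewrite -cE -ulim_ofX -ulim_ofM.
rewrite -ulim_of_sum -ulim_ofD; apply/ulim_of_eq0.
apply: filterS aic => t [_ /(_ n (fun i => c_ i t) n0) h].
by rewrite /x; case: pselect => // h'; case: cid.
Qed.

(** A root in [L] of a monic polynomial over the image of [E] is integral over that image, hence
    over [D] by transitivity, and so it belongs to the image. *)
Lemma absolute_integral_closure_aic (D E : comPzRingType) :
  is_absolute_integral_closure D E -> is_domain D -> absolutely_integrally_closed E.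
Proof.
move=> [+ _] dD; case/(_ dD) => K [inK [L [inL [j [_ _ _ j_inj jE]]]]].
split.
  split.
    by move=> /(congr1 j) /eqP; rewrite rmorph1 rmorph0 oner_eq0.
  move=> x y /(congr1 j) /eqP; rewrite rmorphM rmorph0 mulf_eq0.
  by move=> /orP[/eqP h|/eqP h]; [left|right]; apply: j_inj; rewrite h rmorph0.
move=> n c n0.
have [psi psiE] : exists psi : {rmorphism dom_type dD -> L}, forall d : D, psi d = inL (inK d).
  pose f (x : dom_type dD) : L := inL (inK x).
  have f_zmod : zmod_morphism f by exact: (rmorphB (inL \o inK)).
  have f_monoid : monoid_morphism f.
    by split; [exact: (rmorph1 (inL \o inK)) | exact: (rmorphM (inL \o inK))].
  by exists (HB.pack_for {rmorphism dom_type dD -> L} f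
    (GRing.isZmodMorphism.Build _ _ f f_zmod) (GRing.isMonoidMorphism.Build _ _ f f_monoid)).
have jint z : (exists x, j x = z) <-> integralOver psi z.
  rewrite jE; split=> [[q [mq qD] rq]|[p mp rp]]; last first.
    exists (map_poly psi p) => //; split; first exact: monic_map.
    by move=> i; rewrite coef_map; exists p`_i; apply: psiE.
  pose d i : dom_type dD := sval (cid (qD i)).
  have dE i : q`_i = psi (d i) by rewrite /d; case: cid => x /= ->.
  have q0 := monic_neq0 mq.
  (* Only the lower coefficients of [q] are lifted; the top one is set to 1, so [p] is monic
     whatever preimages were chosen. *)
  pose p : {poly dom_type dD} := 'X^((size q).-1) + \poly_(i < (size q).-1) d i.
  exists p.
    rewrite monicE lead_coefDl ?lead_coefXn // size_polyXn ltnS.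
    exact: size_poly.
  rewrite (_ : map_poly _ p = q) //; apply/polyP => i.
  have -> : (map_poly psi p)`_i = psi p`_i := coef_map psi p i.
  rewrite coefD coefXn coef_poly rmorphD rmorph_nat.
  case: (ltngtP i (size q).-1) => ik.
  - by rewrite add0r -dE.
  - rewrite nth_default; last exact: leq_trans (leqSpred _) ik.
    by rewrite add0r rmorph0.
  - rewrite ik -lead_coefE (monicP mq) -[RHS]addr0; congr (_ + _).
    by rewrite rmorph0.
(* [solve_monicpoly] solves an equation of the form [z ^+ n = \sum_(i < n) P i * z ^+ i], whence the
   sign; the default 0 is used only for indices beyond [n]. *)
pose P i := if insub i is Some k then - j (c k) else 0.
have [z hz] := @solve_monicpoly L n P n0.
have zr : z ^+ n + \sum_(i < n) j (c i) * z ^+ i = 0.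
  rewrite hz -big_split big1 //= => i _.
  by rewrite /P valK mulNr addNr.
have : exists x, j x = z.
  apply/jint.
  pose q : {poly L} := 'X^n + \sum_(i < n) j (c i) *: 'X^i.
  have mq : q \is monic.
    rewrite monicE lead_coefDl ?lead_coefXn // size_polyXn ltnS.
    apply: leq_trans (size_sum _ _ _) _; apply/bigmax_leqP => i _.
    by apply: leq_trans (size_scale_leq _ _) _; rewrite size_polyXn.
  apply: (integral_root_monic mq).
    rewrite rootE hornerD hornerXn horner_sum; apply/eqP; rewrite -[RHS]zr; congr (_ + _).
    by apply: eq_bigr => i _; rewrite hornerZ hornerXn.
  apply/integral_poly => i; rewrite coefD coefXn coef_sum; apply: integral_add.
    exact: integral_nat.
  apply: big_ind => [||k _]; [exact: integral0 | exact: integral_add |].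
  rewrite coefZ coefXn; apply: integral_mul; last exact: integral_nat.
  by apply/jint; exists (c k).
move=> [x xz]; exists x; apply: j_inj; rewrite rmorph0 rmorphD rmorphXn rmorph_sum xz -[RHS]zr.
by congr (_ + _); apply: eq_bigr => i _; rewrite rmorphM rmorphXn xz.
Qed.

Unset Implicit Arguments.

Theorem proposition3p2 (R : realType)
    (U : set_system prime_number) (FU : UltraFilter U)
    (U_nonprincipal : forall p : prime_number, ~ U [set p]%classic)
    (iso : {rmorphism complex R -> ulim U Falg}) (iso_bij : bijective iso)
    (n : nat) (A : affine_presentation (complex R) n) (A_localized : localized_at_prime A)
    (A_domain : is_domain (affine_ring A))
    (A_ : forall p : prime_number, affine_presentation (Falg p) n)
    (A_approx : approximates_affine iso A A_)
    (Aplus : prime_number -> comPzRingType)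
    (Aplus_closure : forall p : prime_number,
        is_absolute_integral_closure (affine_ring (A_ p)) (Aplus p)) :
  absolutely_integrally_closed (ulim U Aplus) /\
  (local_affine A -> henselian (ulim U Aplus)).
Proof.
suff near_aic : \forall p \near U, absolutely_integrally_closed (Aplus p).
  have aic := ulim_aic FU near_aic.
  by split=> // _; apply: aic_henselian.
(* The given isomorphism, with its target viewed as the field [ufield]. *)
pose a (c : complex R) : ufield FU Falg := iso c.
have a_zmod : zmod_morphism a by exact: (rmorphB iso).
have a_monoid : monoid_morphism a by split; [exact: (rmorph1 iso) | exact: (rmorphM iso)].
pose a_rm : {rmorphism complex R -> ufield FU Falg} :=
  HB.pack_for {rmorphism complex R -> ufield FU Falg} a
  (GRing.isZmodMorphism.Build _ _ a a_zmod) (GRing.isMonoidMorphism.Build _ _ a a_monoid).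
have char0 : [pchar complex R] =i pred0 by move=> p; apply: Num.Theory.pchar_num.
have a_surj z : exists c, a_rm c = z by have [g _ gK] := iso_bij; exists (g z); apply: gK.
apply: filterS (affine_approximation_domain U_nonprincipal char0 a_surj A_localized A_domain A_approx).
by move=> p; apply: absolute_integral_closure_aic.
Qed.
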